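(* Let $T>0$, $F\in C^2(\mathbb{R},\mathbb{R}^d)$, and let $u$ be a bounded nonnegative weak solution with finite entropy production of $u_t+\operatorname{div}_xF(u)=0$, $u(0,\cdot)=u_0$, on $[0,T)\times\mathbb{R}^d$, with $\|u_0\|_{L^1(\mathbb{R}^d)}=1$. Let $\omega$ be a Lagrangian representation of $u$. Then for every smooth convex entropy $\eta$, $$(\pi_{t,x})_\sharp\Big(\int_\Gamma\mu^\eta_\gamma\,d\omega(\gamma)\Big)=\mu^\eta ,$$ where $\mu^\eta:=\eta(u)_t+\operatorname{div}_xQ(u)$, with $Q'=\eta'F'$, is the entropy production measure of $\eta$, and $\pi_{t,x}(t,x,v)=(t,x)$.
   Context: Weak solution with finite entropy production: $u\in C([0,T];L^1(\mathbb{R}^d))$ with $u(0,\cdot)=u_0$, solving the equation in the sense of distributions, and such that for every $\eta\in C^2(\mathbb{R})$ with $\eta''\ge0$ and $Q:\mathbb{R}\to\mathbb{R}^d$ with $Q'=\eta'F'$ the distribution $\eta(u)_t+\operatorname{div}_xQ(u)$ is a finite (signed) Radon measure in $[0,T]\times\mathbb{R}^d$. Curves: $\tilde\Gamma:=\mathrm{BV}([0,T);\mathbb{R}^d\times[0,+\infty))$ (right-continuous representatives), $\Gamma:=\{\gamma=(\gamma^1,\gamma^2)\in\tilde\Gamma:\gamma^1\text{ Lipschitz}\}$, with the product of the topology of uniform convergence on compact sets for $\gamma^1$ and the $L^1$ topology for $\gamma^2$; $e_t(\gamma):=\lim_{s\to t^+}\gamma(s)=\gamma(t)$. Let $E_{u(t)}:=\{(x,v)\in\mathbb{R}^d\times[0,+\infty):v\le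 u(t,x)\}$. A Lagrangian representation of $u$ is a nonnegative bounded Borel measure $\omega$ on $\Gamma$ such that: (1) $(e_t)_\sharp\omega=\mathscr L^{d+1}\llcorner E_{u(t)}$ for every $t\in[0,T)$; (2) $\omega$ is concentrated on curves $\gamma\in\Gamma$ with $\dot\gamma^1(t)=F'(\gamma^2(t))$ for a.e. $t\in[0,T)$; (3) $\int_\Gamma\mathrm{Tot.Var.}_{[0,T)}\gamma^2\,d\omega(\gamma)<\infty$. For a convex entropy $\eta$ and $\gamma\in\Gamma$, $$\mu^\eta_\gamma:=(\mathbb{I},\gamma)_\sharp\big((\eta''\circ\gamma^2)\,\tilde D\gamma^2\big)+\eta''(v)\big(\mathscr H^1\llcorner E^+_\gamma-\mathscr H^1\llcorner E^-_\gamma\big),$$ where $(\mathbb{I},\gamma)(t)=(t,\gamma(t))$, $\tilde D\gamma^2$ is the diffuse (absolutely continuous plus Cantor) part of the derivative measure $D\gamma^2$ on $(0,T)$, $\mathscr H^1$ is the one-dimensional Hausdorff measure and $$E^+_\gamma:=\{(t,x,v):\gamma^1(t)=x,\ \gamma^2(t-)<\gamma^2(t+),\ v\in(\gamma^2(t-),\gamma^2(t+))\},$$ $$E^-_\gamma:=\{(t,x,v):\gamma^1(t)=x,\ \gamma^2(t+)<\gamma^2(t-),\ v\in(\gamma^2(t+),\gamma^2(t-))\}.$$ The identity is between measures on $(0,T)\times\mathbb{R}^d$; here $t\in(0,T)$ in the definitions of $E_\gamma^\pm$. *)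

(* Defs.v *)
From HB Require Import structures.
From mathcomp Require Import all_boot all_order all_algebra.
From mathcomp Require Import all_classical all_reals all_analysis.

Set Implicit Arguments.
Unset Strict Implicit.
Unset Printing Implicit Defensive.

Import Order.TTheory GRing.Theory Num.Theory.
Import numFieldNormedType.Exports.

Local Open Scope ring_scope.
Local Open Scope classical_set_scope.

(* In ring_scope these notations denote derivatives of polynomials. *)
Local Notation "f ^` ()" := (derive1 f) : ring_scope.
Local Notation "f ^` ( n )" := (derive1n n f) : ring_scope.

(* The Borel sigma-algebra of R^d, generated by the coordinates exactly as the
   library does for tuples and pairs. *)
Section measurable_rV.
Context (R : realType) (d : nat).

Let coord (i : 'I_d) (x : 'rV[R]_d) : R := x ord0 i.

Let rV_set0 : g_sigma_preimage coord set0.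
Proof. exact: sigma_algebra0. Qed.

Let rV_setC A : g_sigma_preimage coord A -> g_sigma_preimage coord (~` A).
Proof. exact: sigma_algebraC. Qed.

Let rV_bigcup (F : _^nat) : (forall i, g_sigma_preimage coord (F i)) ->
  g_sigma_preimage coord (\bigcup_i (F i)).
Proof. exact: sigma_algebra_bigcup. Qed.

HB.instance Definition _ := @isMeasurable.Build default_measure_display
  'rV[R]_d (g_sigma_preimage coord) rV_set0 rV_setC rV_bigcup.

Lemma measurable_rV_coord (i : 'I_d) :
  measurable_fun [set: 'rV[R]_d] (fun x : 'rV[R]_d => x ord0 i).
Proof.
move=> _ Y mY; rewrite setTI; apply: sub_sigma_algebra => /=.
rewrite -bigcup_seq/=; exists i => /=; first by rewrite mem_index_enum.
by exists Y => //; rewrite setTI.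
Qed.

Lemma measurable_fun_rVP d' (S : measurableType d') (f : S -> 'rV[R]_d) :
  (forall i, measurable_fun [set: S] (fun s => f s ord0 i)) ->
  measurable_fun [set: S] f.
Proof.
move=> mf _ Y mY; rewrite setTI.
pose G : set (set 'rV[R]_d) := [set A | measurable (f @^-1` A)].
suff: g_sigma_preimage coord `<=` G by apply.
apply: smallest_sub.
- split=> [|A GA|F GF]; rewrite /G/=.
  + by rewrite preimage_set0.
  + by rewrite setTD preimage_setC; exact: measurableC.
  + by by rewrite preimage_bigcup; apply: bigcup_measurable => k _; exact: GF.
- move=> A; rewrite -bigcup_seq/= => -[i _ [B mB <-]].
  by rewrite /G/= setTI -[X in measurable X]setTI; exact: mf.
Qed.

End measurable_rV.

Section lebesgue_rV.
Context (R : realType).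

Definition cons_rV d (p : R * 'rV[R]_d) : 'rV[R]_d.+1 :=
  row_mx (const_mx p.1 : 'rV[R]_1) p.2.

Lemma measurable_cons_rV d : measurable_fun [set: measurableTypeR R * 'rV[R]_d] (@cons_rV d).
Proof.
apply: measurable_fun_rVP => i.
rewrite (_ : (fun s => _) = fun s : measurableTypeR R * 'rV[R]_d =>
  if @fintype.split 1 d i is inr j then s.2 ord0 j else s.1); last first.
  by apply/funext => s; rewrite mxE; case: fintype.split => j //; rewrite mxE.
case: fintype.split => j; first exact: measurable_fst.
exact: (measurableT_comp (measurable_rV_coord j) measurable_snd).
Qed.


Let uncons_rV d (x : 'rV[R]_d.+1) : R * 'rV[R]_d :=
  (x ord0 ord0, \row_j x ord0 (lift ord0 j)).

Let measurable_uncons_rV d : measurable_fun [set: 'rV[R]_d.+1] (@uncons_rV d).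
Proof.
apply: measurable_fun_pair => /=; first exact: measurable_rV_coord.
apply: measurable_fun_rVP => i; rewrite (_ : (fun s => _) =
  fun s : 'rV[R]_d.+1 => s ord0 (lift ord0 i)); first exact: measurable_rV_coord.
by apply/funext => s; rewrite mxE.
Qed.

Let cons_rVK d : cancel (@cons_rV d) (@uncons_rV d).
Proof.
move=> [a x]; rewrite /uncons_rV /cons_rV; congr pair.
  by rewrite mxE; case: fintype.splitP => // j _; rewrite mxE.
apply/rowP => j; rewrite !mxE; case: fintype.splitP => [k|k /= /eqP].
  by rewrite ord1.
by rewrite eqSS => /eqP jk; congr (x _ _); exact/val_inj.
Qed.

Section step.
Variables (d : nat) (m : {sigma_finite_measure set 'rV[R]_d -> \bar R}).

Let mu1 : {measure set 'rV[R]_d.+1 -> \bar R} :=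
  measure_function_pushforward__canonical__measure_function_Measure
    (lebesgue_measure \x m)%E (@measurable_cons_rV d).

Definition lebesgue_rVS := pushforward (lebesgue_measure \x m)%E (@cons_rV d).

HB.instance Definition _ := Measure.copy lebesgue_rVS mu1.

Let lebesgue_rVS_sigma_finite : sigma_finite setT lebesgue_rVS.
Proof.
have /sigma_finiteP[F [TF ndF Foo]] := sigma_finiteT (@lebesgue_measure R).
have /sigma_finiteP[G [TG ndG Goo]] := sigma_finiteT m.
exists (fun n => @uncons_rV d @^-1` (F n `*` G n)).
  apply/esym/seteqP; split => // x _.
  have [[n _ Fn] [k _ Gk]] : (\bigcup_n F n) (uncons_rV x).1 /\
      (\bigcup_n G n) (uncons_rV x).2 by rewrite -TF -TG.
  exists (maxn n k) => //; split.
  - by move: Fn; exact/subsetPset/ndF/leq_maxl.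
  - by move: Gk; exact/subsetPset/ndG/leq_maxr.
move=> n; have [mF Fn] := Foo n; have [mG Gn] := Goo n; split.
  rewrite -[X in measurable X]setTI; apply: measurable_uncons_rV => //.
  exact: measurableX.
rewrite /lebesgue_rVS /pushforward -comp_preimage (_ : _ \o _ = id).
  by rewrite preimage_id product_measure1E// lte_mul_pinfty// ge0_fin_numE.
by apply/funext => p /=; rewrite cons_rVK.
Qed.

HB.instance Definition _ := Measure_isSigmaFinite.Build _ _ _ lebesgue_rVS
  lebesgue_rVS_sigma_finite.

End step.

Fixpoint lebesgue_rV d : {sigma_finite_measure set 'rV[R]_d -> \bar R} :=
  if d is d'.+1 then lebesgue_rVS (lebesgue_rV d') else \d_(0 : 'rV[R]_0).

End lebesgue_rV.
Arguments lebesgue_rV {R} d.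

Section regularity.
Context (R : realType).

Definition C2 (V : normedModType R) (f : R -> V) : Prop :=
  [/\ forall v, derivable f v 1, forall v, derivable f^`() v 1 &
      continuous f^`(2)].

(* C^oo: every iterated directional derivative exists and is continuous. *)
Definition smooth (U : normedModType R) (f : U -> R) : Prop :=
  forall vs : seq U, let g := foldr (fun v h => 'D_v h) f vs in
    continuous g /\ forall p v, derivable g p v.

Definition test_function (U : normedModType R) (W : set U) (phi : U -> R) :=
  let supp := closure [set p | phi p != 0] in
  [/\ smooth phi, compact supp & supp `<=` W].

End regularity.

(* Integral against a signed measure, through its Jordan decomposition (which
   does not depend on the chosen Hahn decomposition). *)
Section charge_integral.
Local Open Scope ereal_scope.
Context d (X : measurableType d) (R : realType).

Definition charge_integral (nu : {charge set X -> \bar R}) (A : set X)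
    (f : X -> R) : \bar R :=
  let P := cid (Hahn_decomposition nu) in
  let N := cid (proj2_sig P) in
  \int[jordan_pos (proj2_sig N)]_(x in A) (f x)%:E
  - \int[jordan_neg (proj2_sig N)]_(x in A) (f x)%:E.

Lemma charge_integral0 A f :
  charge_integral [the {charge set X -> \bar R} of czero] A f = 0.
Proof.
rewrite /charge_integral; case: (cid _) => P eP; case: (cid _) => N nuPN /=.
rewrite (eq_measure_integral (m1 := jordan_pos nuPN) mzero); last first.
  by move=> B mB _; rewrite [LHS]jordan_posE cjordan_posE /crestr0/= mem_set.
rewrite (eq_measure_integral (m1 := jordan_neg nuPN) mzero); last first.
  move=> B mB _; rewrite [LHS]jordan_negE cjordan_negE /crestr0/= mem_set//.
  by rewrite /crestr/= oppr0.
by rewrite [X in X - _]integral_measure_zero [X in _ - X]integral_measure_zero subee.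
Qed.

End charge_integral.

(* One-dimensional Hausdorff measure of a distance; in dimension 1 the
   normalizing constant is 1. *)
Section hausdorff1.
Local Open Scope ereal_scope.
Context (R : realType) (X : Type) (dist : X -> X -> R).

(* The value 0 is added so that the empty set has diameter 0 and not -oo. *)
Definition diameter (A : set X) : \bar R :=
  ereal_sup (0 |` [set z | exists x y, [/\ A x, A y & z = (dist x y)%:E]]).

Definition hausdorff1_delta (delta : R) (A : set X) : \bar R :=
  ereal_inf [set s | exists C : (set X)^nat,
    [/\ A `<=` \bigcup_n C n, forall n, diameter (C n) <= delta%:E &
        s = \sum_(0 <= n <oo) diameter (C n)]].

Definition hausdorff1 (A : set X) : \bar R :=
  ereal_sup [set hausdorff1_delta delta A | delta in [set delta | (0 < delta)%R]].

End hausdorff1.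

Definition edist (R : realType) (d : nat) (p q : R * 'rV[R]_d * R) : R :=
  Num.sqrt ((p.1.1 - q.1.1) ^+ 2
    + \sum_(i < d) (p.1.2 ord0 i - q.1.2 ord0 i) ^+ 2 + (p.2 - q.2) ^+ 2).

Section bv.
Context (R : realType) (T : R).

(* [nu] is the distributional derivative of [f] on (0,T); it is a measure on R
   carried by (0,T). *)
Definition derivative_measure (f : R -> R)
    (nu : {charge set (measurableTypeR R) -> \bar R}) : Prop :=
  (forall A, measurable A -> nu A = nu (A `&` `]0, T[)) /\
  forall phi : R -> R, test_function `]0, T[ phi ->
    charge_integral nu `]0, T[ phi =
    (- \int[lebesgue_measure]_(t in `]0%R, T[) (f t * phi^`() t)%:E)%E.

(* Right-continuous representatives of BV functions on [0,T). *)
Definition BV_rc (f : R -> R) : Prop :=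
  [/\ lebesgue_measure.-integrable `]0, T[ (EFin \o f),
      exists nu, derivative_measure f nu &
      forall t, `[0, T[ t -> f s @[s --> t^'+] --> f t].

Definition Tot_Var (f : R -> R) : \bar R :=
  ereal_sup [set total_variation 0 b f | b in `[0, T[].

End bv.

Section curves.
Context (R : realType) (T : R) (d : nat).

(* A curve is defined on [0,T) only: it is extended by 0 so
   that equality of curves is equality on [0,T). *)
Record curve := Curve {
  curve_fun :> R -> 'rV[R]_d * R ;
  curve_outside : forall t, ~ `[0, T[ t -> curve_fun t = 0 ;
  curve_ge0 : forall t, 0 <= (curve_fun t).2 ;
  curve_BV1 : forall i, BV_rc T (fun t => (curve_fun t).1 ord0 i) ;
  curve_BV2 : BV_rc T (fun t => (curve_fun t).2) ;
  curve_lipschitz : [lipschitz (curve_fun t).1 | t in `[0, T[] }.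

Lemma BV_rc0 : BV_rc T (fun=> 0).
Proof.
split.
- exact: integrable0.
- exists [the {charge set (measurableTypeR R) -> \bar R} of czero].
  split => // phi _; rewrite charge_integral0.
  by under eq_integral do rewrite mul0r; rewrite integral0 oppe0.
- by move=> t _; exact: cvg_cst.
Qed.

Lemma zero_lipschitz : [lipschitz (0 : 'rV[R]_d) | t in (`[0, T[ : set R)].
Proof.
rewrite /lipschitz_on; near=> M => -[x y] _ /=.
by rewrite subrr normr0 mulr_ge0.
Unshelve. all: by end_near. Qed.

Definition zero_curve : curve.
Proof.
refine (@Curve (fun=> (0, 0)) _ _ _ _ _) => //.
- by move=> i; under eq_fun do rewrite mxE; exact: BV_rc0.
- exact: BV_rc0.
- exact: zero_lipschitz.
Defined.

HB.instance Definition _ := gen_eqMixin curve.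
HB.instance Definition _ := gen_choiceMixin curve.
HB.instance Definition _ := isPointed.Build curve zero_curve.
End curves.

Section borel_curves.
Context (R : realType) (T : R) (d : nat).

(* Product of the topology of uniform convergence on the compact subsets of
   [0,T) for the first component and of the L^1(0,T) topology for the second. *)
Definition curve_ball (g : curve T d) (K : set R) (e : R) : set (curve T d) :=
  [set h : curve T d | (forall t, K t -> `|(h t).1 - (g t).1| < e) /\
    (\int[lebesgue_measure]_(t in `]0%R, T[) (`|(h t).2 - (g t).2|)%:E < e%:E)%E].

Definition curve_open : set (set (curve T d)) :=
  [set A | forall g, A g -> exists K e,
    [/\ compact K, K `<=` `[0, T[, 0 < e & curve_ball g K e `<=` A]].

Definition Gamma := g_sigma_algebraType curve_open.

HB.instance Definition _ := Measurable.on Gamma.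

End borel_curves.

Section curve_production.
Context (R : realType) (T : R) (d : nat).
Implicit Types (g : curve T d) (eta : R -> R).

(* The derivative measure: by definition of BV one exists, and it is unique on
   Borel sets. *)
Definition derivative_of (f : R -> R) (fBV : BV_rc T f) :
    {charge set (measurableTypeR R) -> \bar R} :=
  let: And3 _ Df _ := fBV in proj1_sig (cid Df).

Definition atoms (nu : {charge set (measurableTypeR R) -> \bar R}) : set R :=
  [set t | nu [set t] != 0%E].

Definition left_value g (t : R) : R := lim ((g s).2 @[s --> t^'-]).
Definition right_value g (t : R) : R := lim ((g s).2 @[s --> t^'+]).

Definition jump_up g : set (R * 'rV[R]_d * R) :=
  [set p | let t := p.1.1 in
    [/\ `]0, T[ t, (g t).1 = p.1.2, left_value g t < right_value g t &
        left_value g t < p.2 < right_value g t]].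

Definition jump_down g : set (R * 'rV[R]_d * R) :=
  [set p | let t := p.1.1 in
    [/\ `]0, T[ t, (g t).1 = p.1.2, right_value g t < left_value g t &
        right_value g t < p.2 < left_value g t]].

(* The diffuse part of a signed measure is its restriction to the complement
   of its atoms. *)
Definition curve_production eta g (B : set (R * 'rV[R]_d * R)) : \bar R :=
  let D := derivative_of (curve_BV2 g) in
  (pushforward
     (fun A => charge_integral D (A `\` atoms D) (fun t => eta^`(2) (g t).2))
     (fun t => (t, (g t).1, (g t).2)) B
   + (\int[hausdorff1 (@edist R d)]_(p in B `&` jump_up g) (eta^`(2) p.2)%:E
      - \int[hausdorff1 (@edist R d)]_(p in B `&` jump_down g) (eta^`(2) p.2)%:E))%E.

End curve_production.

Section weak_solutions.
Context (R : realType) (T : R) (d : nat).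
Implicit Types (F Q : R -> 'rV[R]_d) (eta : R -> R) (u : R -> 'rV[R]_d -> R).

Definition strip : set (R * 'rV[R]_d) := `]0, T[ `*` setT.

(* Action on [phi] of the distribution eta(u)_t + div_x Q(u) on (0,T) x R^d.
   As u(t) is only given as an element of L^1 for each t, the integral is
   iterated; for u in C([0,T]; L^1) the inner integral is continuous in t. *)
Definition balance u eta Q (phi : R * 'rV[R]_d -> R) : R :=
  - \int[lebesgue_measure]_(t in `]0, T[) \int[lebesgue_rV d]_x
      (eta (u t x) * 'D_((1, 0) : R * 'rV[R]_d) phi (t, x)
       + \sum_(i < d)
           Q (u t x) ord0 i * 'D_((0, delta_mx ord0 i) : R * 'rV[R]_d) phi (t, x)).

Definition entropy_flux F eta Q : Prop :=
  forall v, is_derive (v : R) (1 : R) Q (eta^`() v *: F^`() v).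

(* The distribution eta(u)_t + div_x Q(u) is (the restriction to (0,T) x R^d of)
   the finite signed Borel measure [mu]. *)
Definition entropy_production u eta Q
    (mu : {charge set (R * 'rV[R]_d)%type -> \bar R}) : Prop :=
  forall phi, test_function strip phi ->
    charge_integral mu strip phi = (balance u eta Q phi)%:E.

Definition continuous_L1 u : Prop :=
  (forall t, `[0, T] t ->
    (lebesgue_rV d).-integrable setT (fun x => (u t x)%:E)) /\
  forall t0, `[0, T] t0 ->
    (\int[lebesgue_rV d]_x (`|u t x - u t0 x|)%:E)%E
      @[t --> within `[0, T] (nbhs t0)] --> (0 : \bar R).

Definition bounded_nonneg u : Prop :=
  exists M, forall t, `[0, T] t ->
    {ae lebesgue_rV d, forall x, 0 <= u t x <= M}.

Record weak_solution_fep F (u0 : 'rV[R]_d -> R) u : Prop := {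
  wsol_continuous : continuous_L1 u ;
  wsol_initial : {ae lebesgue_rV d, forall x, u 0 x = u0 x} ;
  wsol_equation : forall phi, test_function strip phi ->
    balance u id F phi = 0 ;
  wsol_entropy : forall eta Q, C2 eta -> (forall v, 0 <= eta^`(2) v) ->
    entropy_flux F eta Q -> exists mu, entropy_production u eta Q mu }.

Definition subgraph (v : 'rV[R]_d -> R) : set ('rV[R]_d * R) :=
  [set p | 0 <= p.2 <= v p.1].

Record lagrangian_representation F u
    (omega : {finite_measure set (Gamma T d) -> \bar R}) : Prop := {
  lagr_marginal : forall t, `[0, T[ t -> forall A : set ('rV[R]_d * R),
    measurable A ->
    pushforward omega (fun g : curve T d => g t) A =
      (lebesgue_rV d \x lebesgue_measure)%E (A `&` subgraph (u t)) ;
  lagr_characteristic : {ae omega, forall g : curve T d,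
    {ae lebesgue_measure, forall t, `[0, T[ t ->
      is_derive (t : R) (1 : R) (fun s => (g s).1) (F^`() (g t).2)}} ;
  lagr_variation :
    (\int[omega]_g Tot_Var T (fun t => ((g : curve T d) t).2) < +oo)%E }.

End weak_solutions.

Arguments strip {R} T d _.

(* Main.v *)
(* For a test function phi on the strip, the integral of phi against the
   production of a single curve gamma is the limit of the Riemann sums
     sum_i phi(t_(i+1), gamma^1(t_(i+1))) (eta'(gamma^2(t_(i+1))) - eta'(gamma^2(t_i))):
   at a jump, the increment of eta' is the integral of eta'' over the vertical
   segment, which is what the Hausdorff term contributes.  Abel summation and the
   characteristic equation turn these sums into
     - int eta'(gamma^2) (phi_t + F'(gamma^2) . grad phi)(t, gamma^1(t)) dt.
   Integrating in omega and using the marginals, the integral becomes one over the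
   subgraph of u(t); since the primitives of eta' and eta' F' are eta and Q, and since
   constants integrate to 0 against derivatives of phi, it is the balance of phi.
   The two signed measures thus agree on test functions converging to indicators of
   a pi-system, hence on all Borel subsets of the strip. *)

Require Import Defs.
From HB Require Import structures.
(* finmap also exports an inE, which the imports that follow must shadow. *)
From mathcomp Require Import finmap.
From mathcomp Require Import all_boot all_order all_algebra.
From mathcomp Require Import all_classical all_reals all_analysis.
From mathcomp Require Import measurable_realfun ring lra.

Set Implicit Arguments.
Unset Strict Implicit.
Unset Printing Implicit Defensive.

Import Order.TTheory GRing.Theory Num.Theory.
Import numFieldNormedType.Exports.

Local Open Scope ring_scope.
Local Open Scope classical_set_scope.

(** * Smooth cutoffs *)

(** The two terms in the production of a curve are treated at once. Let P and N be the Jordan parts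
    of the derivative of gamma^2. Each is multiplied by Lebesgue measure on (0,1) and carried by the
    map that fills every jump with a vertical segment; an atom, whose mass is the height of its
    jump, is thereby spread over a segment of that length, and this is the Hausdorff measure there.
    So the production is a difference of two finite measures on (t,x,v). P and N come from choices
    that need not be measurable in gamma. Measurability of the production in gamma therefore comes
    from Riemann sums, which read the curve at finitely many times only. Replacing eta'' by k eta''
    with k continuous in v reaches, in the limit, a pi-system generating the Borel sets of (t,x,v),
    not only preimages of sets in (t,x). Dominated convergence in omega needs a majorant measurable
    in gamma. It is the supremum of the variation sums over one sequence of grids, which controls
    the masses of P and N because indicators of Hahn sets are approximated in mean by continuous
    functions. *)

Section flat.
Context {R : realType}.
Implicit Types (x y : R) (n : nat).

(** The power of 1/y is carried along so that the family is closed under differentiation: all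
    derivatives of exp(-1/y), extended by 0, are combinations of its members. *)
Definition flat n y : R := if 0 < y then y ^- n * expR (- y^-1) else 0.

Lemma flat_ge0 n y : 0 <= flat n y.
Proof.
rewrite /flat; case: ifPn => // y0.
by rewrite mulr_ge0 ?expR_ge0// invr_ge0 exprn_ge0// ltW.
Qed.

Lemma flat_gt0 n y : 0 < y -> 0 < flat n y.
Proof.
by move=> y0; rewrite /flat y0 mulr_gt0 ?expR_gt0// invr_gt0 exprn_gt0.
Qed.

Lemma flat_eq0 n y : y <= 0 -> flat n y = 0.
Proof. by move=> y0; rewrite /flat ltNge y0. Qed.

(** The exponential at 1/y dominates the term of order n + 1 of its series. *)
Lemma flat_le n y : `|flat n y| <= n.+1`!%:R * `|y|.
Proof.
rewrite ger0_norm ?flat_ge0// /flat; case: ifPn => [y0|_]; last first.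
  by rewrite mulr_ge0.
have z0 : 0 < y^-1 by rewrite invr_gt0.
rewrite (gtr0_norm y0) -exprVn expRN.
rewrite ler_pdivrMr ?expR_gt0//.
apply: (@le_trans _ _ (n.+1`!%:R * y * (y^-1 ^+ n.+1 / n.+1`!%:R))).
  have f0 : (n.+1`!%:R : R) != 0 by rewrite pnatr_eq0 -lt0n fact_gt0.
  have y1 : y != 0 by rewrite gt_eqF.
  rewrite [leRHS](_ : _ = y^-1 ^+ n)//.
  by rewrite exprS; field; rewrite ?f0 ?y1.
apply: ler_wpM2l; first by rewrite mulr_ge0// ltW.
by apply: le_trans (expR_ge1Dxn n (ltW z0)); rewrite lerDr.
Qed.

Lemma flatS n y : y^-1 * flat n y = flat n.+1 y.
Proof.
rewrite /flat; case: ifPn => y0; last by rewrite mulr0.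
by rewrite exprS invfM mulrA.
Qed.

Lemma is_derive_flat n y :
  is_derive y 1 (flat n) (flat n.+2 y - n%:R * flat n.+1 y).
Proof.
have [y0|y0|->] := ltgtP y 0.
- rewrite !flat_eq0 ?ltW// mulr0 subr0.
  apply: (@near_eq_is_derive _ _ _ (cst 0)) => //.
  by near=> z; rewrite flat_eq0//; apply/ltW; near: z; exact: lt_nbhsl.
- have ny : \forall z \near y, z^-1 ^+ n * expR (- z^-1) = flat n z.
    near=> z; rewrite /flat.
    have -> : 0 < z by near: z; exact: lt_nbhsr.
    by rewrite exprVn.
  apply: near_eq_is_derive ny _.
  + have y1 : y != 0 by rewrite gt_eqF.
    have dV : is_derive y 1 (fun z : R => z^-1) (- y ^- 2).
      apply: is_derive_eq; first exact: (is_deriveV y1 (is_derive_id y 1)).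
      by rewrite /GRing.scale/= mulr1.
    have dE : is_derive y 1 (fun z : R => expR (- z^-1)) (y ^- 2 * expR (- y^-1)).
      have dN : is_derive y 1 (fun z : R => - z^-1) (y ^- 2).
        by rewrite -[X in is_derive _ _ _ X]opprK; exact: is_deriveN.
      rewrite mulrC; exact: (is_derive1_comp (is_derive_expR _) dN).
    have dX : is_derive y 1 (fun z : R => z^-1 ^+ n) (- n%:R * y ^- n.+1).
      rewrite (_ : (fun z : R => z^-1 ^+ n) = (fun z : R => z^-1) ^+ n); last first.
        by apply/funext => z; rewrite fctE.
      apply: is_derive_eq; rewrite /GRing.scale/=.
      case: n => [|m]; first by rewrite !mul0r oppr0 mul0r.
      by rewrite -!exprVn !exprS/= -mulr_natl; ring.
    rewrite (_ : (fun z => _) =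
      (fun z : R => z^-1 ^+ n) * (fun z : R => expR (- z^-1)))//.
    apply: (is_derive_eq (is_deriveM dX dE)).
    rewrite /GRing.scale/=;
    by rewrite /flat y0 -!exprVn !exprS; ring.
- rewrite !flat_eq0// mulr0 subr0.
  (* The difference quotient of [flat n] at 0 is [flat n.+1], which tends to 0 by [flat_le]. *)
  have c : h^-1 *: (flat n (h *: (1 : R) + 0) - flat n 0) @[h --> 0^'] --> (0 : R).
    rewrite (_ : (fun h => _) = flat n.+1); last first.
      apply/funext => h; rewrite (@flat_eq0 n 0)// subr0 addr0.
      by rewrite /GRing.scale/= mulr1 flatS.
    apply/cvgr0Pnorm_lt => e e0.
    near=> z; apply: le_lt_trans (flat_le _ _) _.
    rewrite mulrC -ltr_pdivlMr ?ltr0n ?fact_gt0//.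
    near: z; apply: dnbhs0_lt; rewrite divr_gt0// ltr0n fact_gt0//.
  apply: DeriveDef; first by apply/cvg_ex; exists 0.
  exact: cvg_lim c.
Unshelve. all: by end_near. Qed.

End flat.

Section elementary.
Context {R : realType} {U : normedModType R}.

(* Closed under directional derivatives, hence consisting of smooth functions. *)
Inductive elementary : (U -> R) -> Prop :=
| elementary_cst c : elementary (cst c)
| elementaryD f g : elementary f -> elementary g -> elementary (f + g)
| elementaryM f g : elementary f -> elementary g -> elementary (f * g)
| elementaryV f : (forall x, f x != 0) -> elementary f ->
    elementary (fun x => (f x)^-1)
| elementary_flat n (l : {linear U -> R}) c : continuous l ->
    elementary (fun x => flat n (l x + c)).

Lemma elementary_diff f : elementary f -> forall x, differentiable f x.
Proof.
elim=> [c|{}f g _ df _ dg|{}f g _ df _ dg|{}f f0 _ df|n l c cl] x.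
- exact: differentiable_cst.
- exact: differentiableD.
- exact: differentiableM.
- exact: differentiableV.
- rewrite (_ : (fun x => _) = flat n \o ((l : U -> R) + cst c))//.
  apply: differentiable_comp.
    by apply: differentiableD => //; exact: linear_differentiable.
  apply/derivable1_diffP.
  by have [] := is_derive_flat n (((l : U -> R) + cst c) x).
Qed.

Lemma elementary_derive f (v : U) : elementary f -> elementary ('D_v f).
Proof.
elim=> [c|{}f g ef edf eg edg|{}f g ef edf eg edg|{}f f0 ef edf|n l c cl].
- rewrite (_ : 'D_v _ = cst 0); first exact: elementary_cst.
  by apply/funext => x; rewrite derive_cst.
- rewrite (_ : 'D_v _ = 'D_v f + 'D_v g); first exact: elementaryD.
  by apply/funext => x; rewrite deriveD//; apply/diff_derivable/elementary_diff.
- rewrite (_ : 'D_v _ = f * 'D_v g + g * 'D_v f).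
    by apply: elementaryD; exact: elementaryM.
  by apply/funext => x; rewrite deriveM//; apply/diff_derivable/elementary_diff.
- rewrite (_ : 'D_v _ = (cst (-1)) * ((fun x => (f x)^-1) * (fun x => (f x)^-1)) * 'D_v f).
    by repeat apply: elementaryM => //; first [exact: elementary_cst|exact: elementaryV].
  apply/funext => x; rewrite deriveV//; last exact/diff_derivable/elementary_diff.
  by rewrite !fctE /GRing.scale/= expr2 invfM mulN1r.
- rewrite (_ : 'D_v _ = cst (l v) * ((fun x => flat n.+2 (l x + c)) +
     cst (- n%:R) * (fun x => flat n.+1 (l x + c)))).
    apply: elementaryM; first exact: elementary_cst.
    apply: elementaryD; first exact: elementary_flat.
    by apply: elementaryM; [exact: elementary_cst|exact: elementary_flat].
  apply/funext => x.
  have dl : differentiable ((l : U -> R) + cst c) x.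
    by apply: differentiableD => //; exact: linear_differentiable.
  have [df dfE] := is_derive_flat n (((l : U -> R) + cst c) x).
  have dn : differentiable (flat n : R -> R) (((l : U -> R) + cst c) x).
    by apply/derivable1_diffP; exact: df.
  have E := deriveE (1 : R) dn; rewrite dfE in E.
  rewrite (_ : (fun x => _) = flat n \o ((l : U -> R) + cst c))//.
  rewrite deriveE; last exact: differentiable_comp.
  rewrite diff_comp//= diffD//; last exact: linear_differentiable.
  rewrite /= diff_lin// diff_cst addr0.
  rewrite -[X in 'd _ _ X]mulr1 [X in 'd _ _ X](_ : _ = l v *: (1 : R))// linearZ.
  rewrite -E /GRing.scale/= !fctE; congr (_ * _).
  by rewrite /= mulNr.
Qed.

Lemma elementary_smooth f : elementary f -> smooth f.
Proof.
move=> ef vs /=.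
have eg : elementary (foldr (fun v h => 'D_v h) f vs).
  by elim: vs => //= v vs; exact: elementary_derive.
split=> [x|p v]; first exact/differentiable_continuous/elementary_diff.
exact/diff_derivable/elementary_diff.
Qed.

End elementary.

Section step.
Context {R : realType}.
Implicit Types y : R.

(** The standard smooth transition from 0 to 1 across [0, 1]. The denominator is positive because y
    and 1 - y are never both nonpositive. *)
Definition step y : R := flat 0 y / (flat 0 y + flat 0 (1 - y)).

Let den_gt0 y : 0 < flat 0 y + flat 0 (1 - y).
Proof.
have [y0|y0] := ltP 0 y; first by rewrite ltr_wpDr ?flat_ge0// flat_gt0.
by rewrite ltr_wpDl ?flat_ge0// flat_gt0// subr_gt0 (le_lt_trans y0).
Qed.

Lemma step_eq0 y : y <= 0 -> step y = 0.
Proof. by move=> y0; rewrite /step flat_eq0// mul0r. Qed.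

Lemma step_eq1 y : 1 <= y -> step y = 1.
Proof.
move=> y1; rewrite /step (@flat_eq0 _ _ (1 - y)) ?subr_le0// addr0 divff//.
by rewrite gt_eqF// flat_gt0// (lt_le_trans _ y1).
Qed.

Lemma step_ge0 y : 0 <= step y.
Proof. by rewrite /step divr_ge0 ?flat_ge0// ltW. Qed.

Lemma step_le1 y : step y <= 1.
Proof. by rewrite /step ler_pdivrMr// mul1r lerDl flat_ge0. Qed.

Lemma elementary_step (U : normedModType R) (l : {linear U -> R}) a c :
  continuous l -> elementary (fun x => step (a * l x + c)).
Proof.
move=> cl.
have cal : continuous (a \*: l) by move=> x; apply: continuous_comp; [exact: cl|exact: scaler_continuous].
have caNl : continuous ((- a) \*: l) by move=> x; apply: continuous_comp; [exact: cl|exact: scaler_continuous].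
pose f x := flat 0 ((a \*: l)%R x + c).
pose g x := flat 0 (((- a) \*: l)%R x + (1 - c)).
rewrite (_ : (fun x => _) = f * (fun x => ((f + g) x)^-1)); last first.
  apply/funext => x; rewrite /step /f /g !fctE/= /GRing.scale/=.
  by congr (_ / (_ + flat _ _)); ring.
have ef : elementary f by exact: elementary_flat.
apply: elementaryM => //; apply: elementaryV.
  move=> x; rewrite (_ : (f + g) x = flat 0 (a * l x + c) + flat 0 (1 - (a * l x + c))).
    by rewrite gt_eqF.
  by rewrite /f /g !fctE/= /GRing.scale/=; congr (_ + flat _ _); ring.
by apply: elementaryD => //; exact: elementary_flat.
Qed.

End step.

(** * Integration and functions of bounded variation *)

Section charge_integral_jordan.
Local Open Scope ereal_scope.
Context d (X : measurableType d) (R : realType).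

(** This exposes the Hahn set hidden in [charge_integral]: one and the same choice then serves for
    the values of [nu] and for integrals against it. *)
Lemma charge_integralP (nu : {charge set X -> \bar R}) :
  exists (P N : {finite_measure set X -> \bar R}) (H : set X),
  [/\ measurable H,
      forall A, measurable A -> P A = nu (A `&` H),
      forall A, measurable A -> N A = - nu (A `\` H),
      forall A, measurable A -> nu A = P A - N A &
      forall A f, charge_integral nu A f =
        \int[P]_(x in A) (f x)%:E - \int[N]_(x in A) (f x)%:E].
Proof.
pose H := cid (Hahn_decomposition nu); pose K := cid (proj2_sig H).
have nuPN : hahn_decomposition nu (sval H) (sval K) by case: K.
pose P : {finite_measure set X -> \bar R} := jordan_pos (proj2_sig K).
pose N : {finite_measure set X -> \bar R} := jordan_neg (proj2_sig K).
exists P, N, (sval H).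
have [[mH _] [mK _] HKT HK0] := nuPN.
have KE : sval K = ~` sval H.
  apply/seteqP; split => [x Kx Hx|x /= Hx].
    by have : (sval H `&` sval K) x by []; rewrite HK0.
  by have : [set: X] x by []; rewrite -HKT => -[].
have PE A : measurable A -> P A = nu (A `&` sval H).
  by move=> mA; rewrite /P/= jordan_posE cjordan_posE /crestr0/= mem_set.
have NE A : measurable A -> N A = - nu (A `\` sval H).
  move=> mA; rewrite /N/= jordan_negE cjordan_negE /crestr0/= mem_set//.
  by rewrite /crestr KE.
split => // A mA.
rewrite PE// NE// oppeK.
rewrite -[in LHS](setUIDK A (sval H)) chargeU//.
- exact: measurableI.
- exact: measurableD.
- by apply/seteqP; split => // x [[_ Hx] []].
Qed.

End charge_integral_jordan.

Section dominated_Rintegral.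
Context d (X : measurableType d) (R : realType) (m : {measure set X -> \bar R}).

Lemma dominated_cvg_Rintegral (A : set X) (f_ : nat -> X -> R) (f h : X -> R) :
  measurable A -> (forall n, measurable_fun A (f_ n)) -> measurable_fun A f ->
  {ae m, forall x, A x -> f_ n x @[n --> \oo] --> f x} ->
  m.-integrable A (EFin \o h) -> (forall n x, A x -> `|f_ n x| <= h x) ->
  (\int[m]_(x in A) f_ n x @[n --> \oo] --> \int[m]_(x in A) f x)%R.
Proof.
move=> mA mf_ mf f_f ih f_h.
have cE : {ae m, forall x, A x -> (f_ n x)%:E @[n --> \oo] --> (f x)%:E}.
  by apply: filterS f_f => x fx Ax; apply: cvg_EFin; [exact: nearW|exact: fx].
have mE n : measurable_fun A (fun x => (f_ n x)%:E) by apply/measurable_EFinP.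
have mE' : measurable_fun A (EFin \o f) by apply/measurable_EFinP.
have [] := @dominated_convergence _ _ R m A mA (fun n x => (f_ n x)%:E)
  (EFin \o f) (EFin \o h) mE mE' cE ih
  (aeW _ (fun x n Ax => f_h n x Ax)) => /integrable_fin_num ff _ hc.
by apply: fine_cvg; rewrite fineK// ff.
Qed.

Lemma bounded_integrable_fin (A : set X) (f : X -> R) (C : R) : measurable A ->
  (m A < +oo)%E -> measurable_fun A f -> (forall x, A x -> `|f x| <= C) ->
  m.-integrable A (EFin \o f).
Proof.
move=> mA Aoo mf fC.
apply: (@le_integrable _ _ _ m _ mA _ (EFin \o cst C)).
- exact/measurable_EFinP.
- by move=> x /fC h; rewrite /= lee_fin (le_trans h)// ler_norm.
- apply/integrableP; split => //.
    by apply/measurable_EFinP.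
  rewrite (_ : (\int[m]_(x in A) _)%E = `|C|%:E * m A)%E; last by rewrite -integral_cst.
  by rewrite lte_mul_pinfty// ?lee_fin.
Qed.

End dominated_Rintegral.

Section finite_measure_bounded.
Context d (X : measurableType d) (R : realType) (m : {finite_measure set X -> \bar R}).
Implicit Types (f g : X -> R) (C : R).

Lemma bounded_integrable (A : set X) f C : measurable A ->
  measurable_fun A f -> (forall x, A x -> `|f x| <= C) ->
  m.-integrable A (EFin \o f).
Proof.
by move=> mA; apply: bounded_integrable_fin => //; rewrite -ge0_fin_numE// fin_num_measure.
Qed.

Lemma bounded_cvg_Rintegral (A : set X) (f_ : nat -> X -> R) f C :
  measurable A -> (forall n, measurable_fun A (f_ n)) ->
  (forall x, A x -> f_ ^~ x @ \oo --> f x) ->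
  (forall n x, A x -> `|f_ n x| <= C) ->
  (\int[m]_(x in A) f_ n x @[n --> \oo] --> \int[m]_(x in A) f x)%R.
Proof.
move=> mA mf_ f_f f_C.
have mf : measurable_fun A f by exact: measurable_fun_cvg mf_ f_f.
exact: (dominated_cvg_Rintegral mA mf_ mf (aeW _ f_f) (finite_measure_integrable_cst m C mA) f_C).
Qed.

End finite_measure_bounded.

Section extend_integral.
Context d (X : measurableType d) (R : realType) (m : {measure set X -> \bar R}).

Lemma eq_integral_support (A B : set X) (f : X -> \bar R) :
  (forall x, A x -> ~ B x -> f x = 0%E) -> (forall x, B x -> ~ A x -> f x = 0%E) ->
  (\int[m]_(x in A) f x = \int[m]_(x in B) f x)%E.
Proof.
move=> AB BA; rewrite integral_mkcond [RHS]integral_mkcond; congr (integral _ _ _).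
apply/funext => x; rewrite !patchE; case: ifPn; case: ifPn => //.
  by rewrite notin_setE inE => Bx Ax; rewrite AB.
by rewrite notin_setE inE => Bx Ax; rewrite BA.
Qed.

End extend_integral.

Section real_integrable.
Context d (X : measurableType d) (R : realType) (m : {measure set X -> \bar R}).
Variables (A : set X) (mA : measurable A).
Implicit Types (f g : X -> R).

Lemma integrableZ_EFin k f : m.-integrable A (EFin \o f) ->
  m.-integrable A (fun x => (k * f x)%:E).
Proof.
move=> fi; rewrite (_ : (fun x => _) = fun x => k%:E * (EFin \o f) x)%E.
  exact: integrableZl.
by apply/funext => x; rewrite EFinM.
Qed.

Lemma integrableD_EFin f g : m.-integrable A (EFin \o f) ->
  m.-integrable A (EFin \o g) -> m.-integrable A (fun x => (f x + g x)%:E).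
Proof. by move=> fi gi; apply: (integrableD mA fi gi). Qed.

Lemma integrableB_EFin f g : m.-integrable A (EFin \o f) ->
  m.-integrable A (EFin \o g) -> m.-integrable A (fun x => (f x - g x)%:E).
Proof. by move=> fi gi; apply: (integrableB mA fi gi). Qed.

Lemma integrable_norm_EFin f : m.-integrable A (EFin \o f) ->
  m.-integrable A (fun x => `|f x|%:E).
Proof. by move=> fi; apply: (integrable_abse fi). Qed.

Lemma integrableM_bounded f g C : measurable_fun A f ->
  (forall x, A x -> `|f x| <= C) -> m.-integrable A (EFin \o g) ->
  m.-integrable A (fun x => (f x * g x)%:E).
Proof.
move=> mf fC gi; have [mg _] := integrableP _ _ _ gi.
apply: (@le_integrable _ _ _ m _ mA _ (fun x => (C * g x)%:E)).
- apply/measurable_EFinP; apply: measurable_funM => //.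
  exact/measurable_EFinP.
- move=> x /fC h /=; rewrite lee_fin !normrM ler_wpM2r//.
  by rewrite (le_trans h)// ler_norm.
- exact: integrableZ_EFin.
Qed.

End real_integrable.

Lemma continuous_bounded_ball (R : realType) (M : R) (f : R -> R) : continuous f ->
  exists2 C : R, 0 < C & forall v, `|v| <= M -> `|f v| <= C.
Proof.
move=> cf; have [C [Cr CK]] := compact_bounded (continuous_compact
  (continuous_subspaceT cf) (@segment_compact R (- M) M)).
exists (`|C| + 1) => [|v]; first by rewrite ltr_wpDl.
rewrite ler_norml => vM.
by apply: (CK (`|C| + 1)); [rewrite (le_lt_trans (ler_norm C))// ltrDl|exists v; rewrite //= in_itv].
Qed.

Section step_derivative.
Context {R : realType}.
Implicit Types (x y a t : R).

Lemma elementary_stepR a t : elementary (fun x : R => step (a * (x - t))).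
Proof.
rewrite (_ : (fun x => _) = fun x => step (a * idfun x + - (a * t))); last first.
  by apply/funext => x; rewrite mulrBr.
by apply: elementary_step => x; exact: cvg_id.
Qed.

Lemma derivable_step y : derivable (@step R) y 1.
Proof.
have := elementary_diff (elementary_stepR 1 0) y.
rewrite (_ : (fun x : R => _) = step); first by move/derivable1_diffP.
by apply/funext => x; rewrite mul1r subr0.
Qed.

Lemma continuous_derive1_step : continuous (derive1 (@step R)).
Proof.
rewrite (_ : derive1 _ = 'D_(1 : R) (fun x : R => step (1 * (x - 0)))).
  move=> x; apply/differentiable_continuous/elementary_diff.
  exact/elementary_derive/elementary_stepR.
rewrite (_ : (fun x : R => _) = step); last first.
  by apply/funext => x; rewrite mul1r subr0.
by apply/funext => x; rewrite derive1E.
Qed.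

Lemma derive1_step_out y : (y < 0) || (1 < y) -> derive1 (@step R) y = 0.
Proof.
move=> /orP[y0|y1]; rewrite derive1E.
  rewrite (@near_eq_derive _ _ _ _ (cst (0:R))); first by rewrite derive_cst.
  by near=> z; rewrite step_eq0//; apply/ltW; near: z; exact: lt_nbhsl.
rewrite (@near_eq_derive _ _ _ _ (cst (1:R))); first by rewrite derive_cst.
by near=> z; rewrite step_eq1//; apply/ltW; near: z; exact: lt_nbhsr.
Unshelve. all: by end_near. Qed.

Lemma derive1_step_bounded : exists2 K : R, 0 < K & forall y, `|derive1 (@step R) y| <= K.
Proof.
have [C C0 CP] := continuous_bounded_ball 1 continuous_derive1_step.
exists C => // y; have [y0|y0] := ltP y 0; first by rewrite derive1_step_out ?y0// normr0 ltW.
have [y1|y1] := ltP 1 y; first by rewrite derive1_step_out ?y1 ?orbT// normr0 ltW.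
by apply: CP; rewrite ger0_norm.
Qed.

Lemma is_derive_stepR a t y :
  is_derive y 1 (fun x : R => step (a * (x - t))) (a * derive1 step (a * (y - t))).
Proof.
have dl : is_derive y 1 (fun x : R => a * (x - t)) a.
  rewrite (_ : (fun x => _) = a \*: (fun x : R => x - t)); last by [].
  apply: is_derive_eq; rewrite /GRing.scale/= subr0 mulr1//.
have ds : is_derive (a * (y - t)) 1 (@step R) (derive1 step (a * (y - t))).
  by rewrite derive1E; exact/derivableP/derivable_step.
by rewrite mulrC; exact: is_derive1_comp.
Qed.

End step_derivative.

(** * Derivative measures of BV functions: increments, Jordan parts, left limits *)

Section mollified_value.
Context {R : realType}.
Notation mu := (@lebesgue_measure R).

(** The derivative of the steep step is a unit mass carried by [t, t + 1/(n+1)]. It only sees values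
    of [f] to the right of t, so right-continuity is the regularity that matters. *)
Lemma mollified_value (f : R -> R) (T t : R) : 0 < t -> t < T ->
  mu.-integrable `]0, T[ (EFin \o f) -> f s @[s --> t^'+] --> f t ->
  (\int[mu]_(x in `]0%R, T[)
     (f x * derive1 (fun x : R => step (n.+1%:R * (x - t))) x))%R @[n --> \oo] --> f t.
Proof.
move=> t0 tT fi ft.
have [K K0 stepK] := @derive1_step_bounded R.
apply/cvgrPdist_le => e e0.
(* The mollifier is at most (n+1) K on an interval of length 1/(n+1), so an oscillation e / K of [f]
   there costs at most e. *)
have eK0 : 0 < e / K by rewrite divr_gt0.
move/cvgrPdist_le : ft => /(_ _ eK0)[d /= d0 dP].
near=> n.
pose h : R := n.+1%:R^-1.
have h0 : 0 < h by rewrite invr_gt0.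
have hd : h < d.
  by rewrite /h; near: n; exact: (near_infty_natSinv_lt (PosNum d0)).
have hT : t + h < T.
  rewrite addrC -ltrBrDr.
  rewrite /h; near: n; have Tt : 0 < T - t by rewrite subr_gt0.
  exact: (near_infty_natSinv_lt (PosNum Tt)).
set G := fun x : R => step (n.+1%:R * (x - t)).
have dG x : derive1 G x = n.+1%:R * derive1 step (n.+1%:R * (x - t)).
  by rewrite derive1E; have [_ ->] := is_derive_stepR n.+1%:R t x.
pose g (x : R) : R := derive1 G x.
have gE x : g x = n.+1%:R * derive1 step (n.+1%:R * (x - t)) by exact: dG.
have cdG : continuous g.
  rewrite (_ : g = fun x => n.+1%:R * derive1 step (n.+1%:R * (x - t))); last exact/funext.
  move=> x; apply: cvgM; first exact: cvg_cst.
  apply: continuous_comp; last exact: continuous_derive1_step.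
  apply: cvgM; first exact: cvg_cst.
  by apply: cvgB; [exact: cvg_id|exact: cvg_cst].
pose I : set R := `[t, t + h].
have mI : measurable I by exact: measurable_itv.
have muI : mu I = h%:E.
  by rewrite lebesgue_measure_itv/= lte_fin ltrDl h0 -EFinB addrAC subrr add0r.
have IT : I `<=` `]0, T[.
  move=> x; rewrite /I/= in_itv/= => /andP[tx xh]; rewrite in_itv/=.
  by rewrite (lt_le_trans t0)// (le_lt_trans xh).
have G0 x : ~ I x -> g x = 0.
  move=> /negP; rewrite /I/= in_itv/= negb_and -!ltNge => xI.
  rewrite gE derive1_step_out ?mulr0//.
  rewrite pmulr_rlt0// subr_lt0 -ltr_pdivrMl// mulr1.
  by rewrite ltrBrDl.
have fI : mu.-integrable I (EFin \o f) by apply: integrableS fi => //; exact: measurable_itv.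
have GI : mu.-integrable I (EFin \o g).
  apply: continuous_compact_integrable; first exact: segment_compact.
  exact: continuous_subspaceT.
have bG x : `|g x| <= n.+1%:R * K.
  by rewrite gE normrM ger0_norm// ler_wpM2l.
have mdG : measurable_fun I (g).
  by apply: measurable_funTS; exact: continuous_measurable_fun.
have bGI : [bounded g x | x in I].
  exists (n.+1%:R * K); split; first exact: num_real.
  by move=> M KM x _; exact: le_trans (bG x) (ltW KM).
have fGI : mu.-integrable I (EFin \o (fun x => f x * g x)).
  rewrite (_ : _ \o _ = ((EFin \o g) \* (EFin \o f))%E).
    exact: integrableMr.
  by apply/funext => x /=; rewrite EFinM muleC.
have -> : \int[mu]_(x in `]0%R, T[) (f x * derive1 G x) =
    \int[mu]_(x in I) (f x * g x).
  congr fine; apply: eq_integral_support => x.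
    by move=> _ Ix; rewrite -/(g x) G0// mulr0.
  by move=> /IT.
have tGI : mu.-integrable I (EFin \o (fun x => f t * g x)).
  exact: integrableZ_EFin.
have dGI : mu.-integrable I (EFin \o (fun x => f t * g x - f x * g x)).
  exact: integrableB_EFin.
have iG : \int[mu]_(x in I) g x = 1.
  rewrite /Rintegral (@continuous_FTC2 _ _ G); first last.
  - by [].
  - split.
    + by move=> x _; have [] := is_derive_stepR n.+1%:R t x.
    + apply: cvg_at_right_filter; apply/differentiable_continuous/derivable1_diffP.
      by have [] := is_derive_stepR n.+1%:R t t.
    + apply: cvg_at_left_filter; apply/differentiable_continuous/derivable1_diffP.
      by have [] := is_derive_stepR n.+1%:R t (t + h).
  - exact: continuous_subspaceT.
  - by rewrite ltrDl.
  rewrite /G subrr mulr0 (@step_eq0 _ 0)// addrAC subrr add0r divff// step_eq1//.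
  by rewrite /= subr0.
rewrite -[f t in leLHS]mulr1 -iG -RintegralZl// -RintegralB//.
apply: le_trans (le_normr_Rintegral _ _) _ => //.
have -> : e = \int[mu]_(x in I) (e / K * (n.+1%:R * K)).
  rewrite Rintegral_cst// -[fine _]/(fine (mu I)) muI /=.
  by rewrite /h; field; rewrite ?gt_eqF//= lt0r_neq0.
apply: le_Rintegral => //.
- exact: integrable_norm_EFin.
- have muIy : (mu I < +oo)%E by rewrite muI ltry.
  apply: measurable_bounded_integrable => //.
  exists (e / K * (n.+1%:R * K)); split; [exact: num_real|move=> M /ltW KM x _; apply: le_trans KM].
  by rewrite ger0_norm// !mulr_ge0// ?invr_ge0// ltW.
- move=> x Ix; rewrite -mulrBl normrM; apply: ler_pM => //.
  move: Ix; rewrite /I/= in_itv/= => /andP[tx xh].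
  have [->|xt] := eqVneq x t; first by rewrite subrr normr0 ltW.
  apply: dP; last by rewrite lt_neqAle eq_sym xt.
  rewrite /= distrC ger0_norm ?subr_ge0//.
  by apply: le_lt_trans hd; rewrite lerBlDl.
Unshelve. all: by end_near. Qed.

End mollified_value.

Section derivative_increment.
Context {R : realType}.
Notation mu := (@lebesgue_measure R).

Definition step_window (s t : R) (n : nat) (x : R) : R :=
  step (n.+1%:R * (x - s)) - step (n.+1%:R * (x - t)).

(** At x = t the step is 0 for every n, hence an interval open on the left. This convention makes
    the increments of a right-continuous function the measures of intervals ]s, t]. *)
Lemma step_dilation_cvg (t x : R) :
  step (n.+1%:R * (x - t)) @[n --> \oo] --> (\1_(`]t, +oo[) x : R).
Proof.
rewrite indicE mem_setE in_itv/= andbT ltNge; have [xt|tx] /= := leP x t.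
  apply: cvg_near_cst; apply: nearW => n.
  by rewrite step_eq0// pmulr_rle0// subr_le0.
have xt0 : 0 < x - t by rewrite subr_gt0.
apply: cvg_near_cst; near=> n.
rewrite step_eq1// -ler_pdivrMl// mulr1 ltW//.
by near: n; exact: (near_infty_natSinv_lt (PosNum xt0)).
Unshelve. all: by end_near. Qed.

Lemma step_window_cvg (s t x : R) : s <= t ->
  step_window s t n x @[n --> \oo] --> (\1_(`]s, t]) x : R).
Proof.
move=> st.
rewrite (_ : \1_(`]s, t]) x = \1_(`]s, +oo[) x - \1_(`]t, +oo[) x :> R).
  by apply: cvgB; exact: step_dilation_cvg.
rewrite !indicE !mem_setE !in_itv/= !andbT !ltNge.
have [xt|tx] := leP x t; have [xs|sx] := leP x s; rewrite ?subr0 ?subrr//.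
by move: (lt_le_trans tx xs); rewrite ltNge st.
Qed.

Lemma step_window_le1 (s t : R) n x : `|step_window s t n x| <= 1.
Proof.
rewrite /step_window ler_norml; have := step_ge0 (n.+1%:R * (x - s)).
have := step_le1 (n.+1%:R * (x - s)); have := step_ge0 (n.+1%:R * (x - t)).
have := step_le1 (n.+1%:R * (x - t)); lra.
Qed.

Lemma elementary_step_window s t n : elementary (step_window s t n).
Proof.
rewrite (_ : step_window _ _ _ = (fun x => step (n.+1%:R * (x - s))) +
    cst (-1) * (fun x => step (n.+1%:R * (x - t)))).
  apply: elementaryD; first exact: elementary_stepR.
  by apply: elementaryM; [exact: elementary_cst|exact: elementary_stepR].
by apply/funext => x; rewrite /step_window !fctE/= mulN1r.
Qed.

Lemma test_function_step_window (s t T : R) : 0 < s -> s <= t -> t < T ->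
  \forall n \near \oo, test_function `]0, T[ (step_window s t n).
Proof.
move=> s0 st tT; near=> n.
have hT : t + n.+1%:R^-1 < T.
  rewrite addrC -ltrBrDr; near: n; have Tt : 0 < T - t by rewrite subr_gt0.
  exact: (near_infty_natSinv_lt (PosNum Tt)).
have sub : closure [set p | step_window s t n p != 0] `<=` `[s, t + n.+1%:R^-1].
  rewrite [X in _ `<=` X](closure_id _).1; last exact: interval_closed.
  apply: closure_subset.
  move=> x /=; apply: contraNP => /negP; rewrite in_itv/= negb_and -!ltNge => /orP[xs|xt].
    rewrite /step_window !step_eq0 ?subrr//.
    + by rewrite pmulr_rle0// subr_le0 ltW// (lt_le_trans xs).
    + by rewrite pmulr_rle0// subr_le0 ltW.
  rewrite /step_window !step_eq1 ?subrr//.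
  + by rewrite -ler_pdivrMl// mulr1 lerBrDl ltW.
  + by rewrite -ler_pdivrMl// mulr1 lerBrDl ltW// (le_lt_trans _ xt)// lerD2r.
split; first exact/elementary_smooth/elementary_step_window.
  by apply: subclosed_compact sub; [exact: closed_closure|exact: segment_compact].
apply: subset_trans sub _ => x /=; rewrite !in_itv/= => /andP[sx xt].
by rewrite (lt_le_trans s0)//= (le_lt_trans xt).
Unshelve. all: by end_near. Qed.

Lemma integrable_mul_derive1_step (f : R -> R) T n s :
  mu.-integrable `]0, T[ (EFin \o f) ->
  mu.-integrable `]0, T[
    (EFin \o (fun x => f x * derive1 (fun x : R => step (n.+1%:R * (x - s))) x)).
Proof.
move=> fi; have [K K0 stepK] := @derive1_step_bounded R.
pose g (x : R) : R := n.+1%:R * derive1 step (n.+1%:R * (x - s)).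
rewrite (_ : EFin \o _ = fun x => (g x * f x)%:E); last first.
  apply/funext => x /=; rewrite mulrC; congr (_ * _)%:E.
  by rewrite derive1E; have [_ ->] := is_derive_stepR n.+1%:R s x.
apply: (@integrableM_bounded _ _ _ _ _ _ _ _ (n.+1%:R * K)) => //.
  apply: measurable_funTS; apply: continuous_measurable_fun => x.
  apply: cvgM; first exact: cvg_cst.
  apply: continuous_comp; last exact: continuous_derive1_step.
  apply: cvgM; first exact: cvg_cst.
  by apply: cvgB; [exact: cvg_id|exact: cvg_cst].
by move=> x _; rewrite normrM ger0_norm// ler_wpM2l.
Qed.

(** The distributional derivative is tested with [step_window]. The windows converge boundedly to
    the indicator of ]s, t], while their derivatives are approximate unit masses to the right of s
    and of t. *)
Lemma derivative_increment (f : R -> R) T nu s t :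
  mu.-integrable `]0, T[ (EFin \o f) -> derivative_measure T f nu ->
  f x @[x --> s^'+] --> f s -> f x @[x --> t^'+] --> f t ->
  0 < s -> s <= t -> t < T -> nu `]s, t] = (f t - f s)%:E.
Proof.
move=> fi [nuT nuf] fs ft s0 st tT.
have [P [N [H [mH PH NH nuE nuI]]]] := charge_integralP nu.
have mT : measurable (`]0, T[ : set R) by exact: measurable_itv.
have mst : measurable (`]s, t] : set R) by exact: measurable_itv.
have stT : `]s, t] `<=` `]0, T[.
  move=> x /=; rewrite !in_itv/= => /andP[sx xt].
  by rewrite (lt_trans s0)//= (le_lt_trans xt).
have mw n : measurable_fun (setT : set (measurableTypeR R)) (step_window s t n).
  apply: continuous_measurable_fun => x.
  exact/differentiable_continuous/elementary_diff/elementary_step_window.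
have lim_m (m : {finite_measure set (measurableTypeR R) -> \bar R}) :
    \int[m]_(x in `]0%R, T[) step_window s t n x @[n --> \oo] --> fine (m `]s, t]).
  rewrite (_ : fine _ = \int[m]_(x in `]0%R, T[) \1_(`]s, t]) x); last first.
    by rewrite /Rintegral integral_indic// setIidl.
  apply: (@bounded_cvg_Rintegral _ _ _ _ _ _ _ 1) => // [n|x _|n x _].
  - exact: measurable_funTS.
  - exact: step_window_cvg.
  - exact: step_window_le1.
have lim_f : \int[mu]_(x in `]0%R, T[)
     (f x * derive1 (fun x : R => step (n.+1%:R * (x - s))) x) -
   \int[mu]_(x in `]0%R, T[)
     (f x * derive1 (fun x : R => step (n.+1%:R * (x - t))) x) @[n --> \oo] --> f s - f t.
  apply: cvgB; apply: mollified_value => //.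
  - exact: le_lt_trans tT.
  - exact: lt_le_trans st.
have fin_m (m : {finite_measure set (measurableTypeR R) -> \bar R}) A : measurable A -> m A \is a fin_num.
  by move=> mA; exact: fin_num_measure.
rewrite nuE// -[P _]fineK ?fin_m// -[N _]fineK ?fin_m// -EFinB; congr EFin.
have lim1 : \int[P]_(x in `]0%R, T[) step_window s t n x -
    \int[N]_(x in `]0%R, T[) step_window s t n x @[n --> \oo] -->
    fine (P `]s, t]) - fine (N `]s, t]).
  by apply: cvgB; exact: lim_m.
suff lim2 : \int[P]_(x in `]0%R, T[) step_window s t n x -
    \int[N]_(x in `]0%R, T[) step_window s t n x @[n --> \oo] --> f t - f s.
  by rewrite -(cvg_lim _ lim1)// -(cvg_lim _ lim2).
rewrite -opprB; apply: cvg_trans (cvgN lim_f); apply: near_eq_cvg.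
near=> n.
have tw : test_function `]0, T[ (step_window s t n).
  by near: n; exact: test_function_step_window.
have Ds := integrable_mul_derive1_step n s fi.
have Dt := integrable_mul_derive1_step n t fi.
have wi (m : {finite_measure set (measurableTypeR R) -> \bar R}) :
    m.-integrable `]0, T[ (EFin \o step_window s t n).
  apply: (@bounded_integrable _ _ _ _ _ _ 1) => //.
    exact: measurable_funTS.
  by move=> x _; exact: step_window_le1.
have := congr1 fine (nuf _ tw); rewrite nuI fineB; try exact/integrable_fin_num/wi.
rewrite -/(Rintegral _ _ _) => ->; rewrite fineN; congr (- _).
rewrite -RintegralB; [|exact: mT|exact: Ds|exact: Dt].
congr fine; apply: eq_integral => x _; congr EFin.
rewrite -mulrBr; congr (_ * _); rewrite !derive1E -deriveB//.
- by have [] := is_derive_stepR n.+1%:R s x.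
- by have [] := is_derive_stepR n.+1%:R t x.
Unshelve. all: by end_near. Qed.

End derivative_increment.

Section indicator_limits.
Context d (X : measurableType d) (R : realType) (m : {finite_measure set X -> \bar R}).

Lemma indic_cvg_measure (A_ : nat -> set X) (A : set X) :
  (forall n, measurable (A_ n)) -> measurable A ->
  (forall x, (\1_(A_ n) x : R) @[n --> \oo] --> (\1_A x : R)) ->
  fine (m (A_ n)) @[n --> \oo] --> fine (m A).
Proof.
move=> mA_ mA Acvg.
have E B : measurable B -> fine (m B) = (\int[m]_(x in setT) \1_B x)%R.
  by move=> mB; rewrite /Rintegral integral_indic// setIT.
rewrite E//; under eq_fun do rewrite E//.
apply: (@bounded_cvg_Rintegral _ _ _ _ _ (fun n => \1_(A_ n)) _ 1) => // n x _.
by rewrite indicE; case: (_ \in _); rewrite ?normr1 ?normr0.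
Qed.

End indicator_limits.

(* P and N are the Jordan parts, for the Hahn set H, of the derivative of f. *)
Record bv_jordan (R : realType) (T : R) (f : R -> R)
    (P N : {finite_measure set (measurableTypeR R) -> \bar R}) (H : set R) : Prop := {
  bvj_T : 0 < T ;
  bvj_H : measurable (H : set (measurableTypeR R)) ;
  bvj_P : forall A : set (measurableTypeR R), measurable A -> P (A `\` H) = 0%E ;
  bvj_N : forall A : set (measurableTypeR R), measurable A -> N (A `&` H) = 0%E ;
  bvj_PT : P (~` `]0, T[) = 0%E ;
  bvj_NT : N (~` `]0, T[) = 0%E ;
  bvj_inc : forall s t, 0 <= s -> s <= t -> t < T ->
    f t - f s = fine (P `]s, t]) - fine (N `]s, t]) ;
  bvj_out : forall t, ~ `[0, T[ t -> f t = 0 }.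

Section bv_jordan_exists.
Context {R : realType}.

Lemma itv_oc_at_right_indic (t x : R) (s : R) (u : R^nat) :
  (forall n, s < u n) -> u @ \oo --> s ->
  (\1_(`]u n, t]) x : R) @[n --> \oo] --> (\1_(`]s, t]) x : R).
Proof.
move=> su us; rewrite indicE mem_setE in_itv/=.
under eq_fun do rewrite indicE mem_setE in_itv/=.
have [sx|xs] /= := ltP s x.
  apply: cvg_near_cst; near=> n.
  suff -> : u n < x by [].
  by near: n; exact: (cvgr_lt _ us).
apply: cvg_near_cst; apply: nearW => n.
by rewrite ltNge (le_trans xs (ltW (su n))).
Unshelve. all: by end_near. Qed.

Lemma itv_oc_at_left_indic (t x : R) (u : R^nat) :
  (forall n, u n < t) -> u @ \oo --> t ->
  (\1_(`]u n, t]) x : R) @[n --> \oo] --> (\1_([set t]) x : R).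
Proof.
move=> ut ucvg; under eq_fun do rewrite indicE mem_setE in_itv/=.
have [<-|xt] := eqVneq t x.
  rewrite indicE mem_set//; apply: cvg_near_cst; apply: nearW => n.
  by rewrite ut lexx.
rewrite indicE memNset/=; last by move=> tx; rewrite tx eqxx in xt.
have [tx|tx] := leP x t; last by under eq_fun do rewrite andbF; exact: cvg_cst.
apply: cvg_near_cst; near=> n.
suff /ltW : x < u n by rewrite leNgt => /negbTE ->.
near: n; apply: (cvgr_gt _ ucvg).
by rewrite lt_neqAle tx eq_sym xt.
Unshelve. all: by end_near. Qed.

(** [derivative_increment] yields the increments between positive times. The start 0 is reached by
    right-continuity. *)
Lemma bv_jordan_exists (T : R) (f : R -> R) (fBV : BV_rc T f) :
  0 < T -> (forall t, ~ `[0, T[ t -> f t = 0) ->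
  exists (P N : {finite_measure set (measurableTypeR R) -> \bar R}) (H : set R),
  [/\ bv_jordan T f P N H,
      forall A, measurable A -> derivative_of fBV A = (P A - N A)%E &
      forall A (g : R -> R), charge_integral (derivative_of fBV) A g =
        (\int[P]_(x in A) (g x)%:E - \int[N]_(x in A) (g x)%:E)%E].
Proof.
move=> T0 fout.
have [fi dm rc] : [/\ (@lebesgue_measure R).-integrable `]0, T[ (EFin \o f),
    derivative_measure T f (derivative_of fBV) &
    forall t, `[0, T[%classic t -> f s @[s --> t^'+] --> f t].
  by case: fBV => fi Df rc; split => //=; case: (cid Df).
have [P [N [H [mH PH NH DE DI]]]] := charge_integralP (derivative_of fBV).
exists P, N, H; split=> //.
have mT : measurable (`]0, T[ : set (measurableTypeR R)) by exact: measurable_itv.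
have Dset0 : derivative_of fBV set0 = 0%E by exact: charge0.
have inc0 s t : 0 < s -> s <= t -> t < T ->
    f t - f s = fine (P `]s, t]) - fine (N `]s, t]).
  move=> s0 st tT.
  have mst : measurable (`]s, t] : set (measurableTypeR R)) by exact: measurable_itv.
  rewrite -fineB ?fin_num_measure// -DE//.
  rewrite (derivative_increment fi dm _ _ s0 st tT)//.
  - by apply: rc; rewrite /= in_itv/= (ltW s0) (le_lt_trans st).
  - by apply: rc; rewrite /= in_itv/= tT andbT (le_trans (ltW s0)).
split => //.
- move=> A mA; rewrite PH; last exact: measurableD.
  by rewrite [X in derivative_of _ X](_ : _ = set0)//; apply/seteqP; split => // x [[_ nH] /nH].
- move=> A mA; rewrite NH; last exact: measurableI.
  rewrite [X in derivative_of _ X](_ : _ = set0) ?Dset0 ?oppe0//.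
  by apply/seteqP; split => // x [[_ ?]].
- rewrite PH; last exact: measurableC.
  rewrite dm.1; last by apply: measurableI => //; exact: measurableC.
  by rewrite [X in derivative_of _ X](_ : _ = set0)//; apply/seteqP; split => // x [[nT _] /nT].
- rewrite NH; last exact: measurableC.
  rewrite dm.1; last by apply: measurableD => //; exact: measurableC.
  rewrite [X in derivative_of _ X](_ : _ = set0) ?Dset0 ?oppe0//.
  by apply/seteqP; split => // x [[nT _] /nT].
- move=> s t; rewrite le_eqVlt => /predU1P[<-|]; last exact: inc0.
  rewrite le_eqVlt => /predU1P[<- _|t0 tT].
    by rewrite subrr set_itvoc0 !measure0 subrr.
  (* A window starting at 0 would not have its support inside (0, T), so the increment from 0 is the
     limit of the increments from t / (n+1). *)
  pose u n := t * n.+1%:R^-1.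
  have u0 n : 0 < u n by rewrite mulr_gt0 ?invr_gt0.
  have ut n : u n <= t by rewrite ger_pMr// invf_le1// ler1n.
  have ucvg : u @ \oo --> (0 : R).
    by rewrite -(mulr0 t); apply: cvgM; [exact: cvg_cst|exact: cvg_harmonic].
  have lim1 : f t - f (u n) @[n --> \oo] --> f t - f 0.
    apply: cvgB; first exact: cvg_cst.
    have /cvg_at_rightP := rc 0 (ltac:(by rewrite /= in_itv/= lexx T0)).
    by apply; split.
  have lim2 (m : {finite_measure set (measurableTypeR R) -> \bar R}) :
      fine (m `]u n, t]) @[n --> \oo] --> fine (m `]0, t]).
    apply: indic_cvg_measure => [n||x]; try exact: measurable_itv.
    exact: itv_oc_at_right_indic.
  have lim3 : fine (P `]u n, t]) - fine (N `]u n, t]) @[n --> \oo] -->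
    fine (P `]0, t]) - fine (N `]0, t]) by exact: cvgB.
  move: lim1; under eq_fun do rewrite inc0//.
  by move=> lim1; rewrite -(cvg_lim _ lim1)// -(cvg_lim _ lim3).
Qed.

End bv_jordan_exists.

Section bv_jordan_theory.
Context {R : realType} (T : R) (f : R -> R)
  (P N : {finite_measure set (measurableTypeR R) -> \bar R}) (H : set R).
Hypothesis fPN : bv_jordan T f P N H.

Definition bv_bound : R :=
  `|f 0| + (fine (P [set: measurableTypeR R]) + fine (N [set: measurableTypeR R])).

Let fine_le_setT (m : {finite_measure set (measurableTypeR R) -> \bar R}) A :
  measurable A -> 0 <= fine (m A) <= fine (m setT).
Proof.
move=> mA; rewrite fine_ge0//= fine_le ?fin_num_measure//.
by apply: le_measure => //; rewrite inE.
Qed.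

Lemma bv_boundP t : `|f t| <= bv_bound.
Proof.
have /andP[P0 _] := fine_le_setT P measurableT.
have /andP[N0 _] := fine_le_setT N measurableT.
have [/andP[t0 tT]|] := boolP (0 <= t < T).
  have mt : measurable (`]0, t] : set (measurableTypeR R)) by exact: measurable_itv.
  have := bvj_inc fPN (lexx 0) t0 tT => /eqP; rewrite subr_eq => /eqP ->.
  rewrite addrC (le_trans (ler_normD _ _))// lerD2l (le_trans (ler_normB _ _))//.
  have /andP[? ?] := fine_le_setT P mt; have /andP[? ?] := fine_le_setT N mt.
  by rewrite !ger0_norm// lerD.
move=> /negP tT; by rewrite (bvj_out fPN) ?normr0 ?addr_ge0// /= in_itv.
Qed.

(** On [0, T) the function is a constant plus a difference of two nondecreasing functions, the
    masses of ]0, t] under P and N. *)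
Lemma bv_measurable : measurable_fun [set: measurableTypeR R] (f : measurableTypeR R -> R).
Proof.
pose I : set (measurableTypeR R) := `[0, T[.
have mI : measurable I by exact: measurable_itv.
have nd (m : {finite_measure set (measurableTypeR R) -> \bar R}) :
    measurable_fun [set: measurableTypeR R] (fun t : measurableTypeR R => fine (m `]0, t])).
  apply: nondecreasing_measurable => // s t st.
  rewrite fine_le ?fin_num_measure//; try exact: measurable_itv.
  apply: le_measure; rewrite ?inE; try exact: measurable_itv.
  by move=> x /=; rewrite !in_itv/= => /andP[-> /le_trans]; apply.
rewrite (_ : f = fun t => \1_I t * (f 0 + (fine (P `]0, t]) - fine (N `]0, t])))).
  apply: measurable_funM; first exact: measurable_indic.
  apply: measurable_funD => //.
  by apply: measurable_funB; exact: nd.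
apply/funext => t; rewrite indicE; have [|/negP tI] := boolP (t \in I).
  rewrite inE /I/= in_itv/= => /andP[t0 tT].
  by rewrite mul1r -(bvj_inc fPN)// addrC subrK.
by rewrite mul0r (bvj_out fPN)// => tI'; apply: tI; rewrite inE.
Qed.

Lemma bv_right_cvg (t : R) (u : R^nat) : `[0, T[%classic t ->
  (forall n, t <= u n) -> u @ \oo --> t -> f (u n) @[n --> \oo] --> f t.
Proof.
rewrite /= in_itv/= => /andP[t0 tT] tu ut.
have lim2 (m : {finite_measure set (measurableTypeR R) -> \bar R}) :
    fine (m `]t, u n]) @[n --> \oo] --> fine (m set0).
  apply: indic_cvg_measure => [n||x]; try exact: measurable_itv; first by [].
  rewrite indic0; under eq_fun do rewrite indicE mem_setE in_itv/=.
  have [tx|] /= := ltP t x; last by move=> _; exact: cvg_cst.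
  apply: cvg_near_cst; near=> n.
  suff : u n < x by rewrite ltNge => /negbTE ->.
  by near: n; exact: (cvgr_lt _ ut).
have : f t + (fine (P `]t, u n]) - fine (N `]t, u n])) @[n --> \oo] -->
    f t + (fine (P set0) - fine (N set0)).
  by apply: cvgD; [exact: cvg_cst|exact: cvgB].
rewrite !measure0 subrr addr0; apply: cvg_trans; apply: near_eq_cvg; near=> n.
have uT : u n < T by near: n; exact: (cvgr_lt _ ut).
by rewrite -(bvj_inc fPN)// addrC subrK.
Unshelve. all: by end_near. Qed.

(** The left limit is read off the atom of the derivative at t. In this form it is defined at every
    t and equals [f t] wherever there is no atom, in particular outside (0, T). *)
Definition left_lim (t : R) : R := f t - (fine (P [set t]) - fine (N [set t])).

Lemma bv_left_cvg (t : R) (u : R^nat) : 0 < t -> t < T ->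
  (forall n, u n < t) -> u @ \oo --> t -> f (u n) @[n --> \oo] --> left_lim t.
Proof.
move=> t0 tT ut ucvg.
have lim2 (m : {finite_measure set (measurableTypeR R) -> \bar R}) :
    fine (m `]u n, t]) @[n --> \oo] --> fine (m [set t]).
  apply: indic_cvg_measure => [n||x]; try exact: measurable_itv.
    exact: measurable_set1.
  exact: itv_oc_at_left_indic.
have : f t - (fine (P `]u n, t]) - fine (N `]u n, t])) @[n --> \oo] --> left_lim t.
  by apply: cvgB; [exact: cvg_cst|exact: cvgB].
apply: cvg_trans; apply: near_eq_cvg; near=> n.
have u0 : 0 < u n by near: n; exact: (cvgr_gt _ ucvg).
have unt : u n < t by exact: ut.
by rewrite -(bvj_inc fPN) ?ltW// opprB addrC subrK.
Unshelve. all: by end_near. Qed.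

Lemma left_lim_out t : ~ `]0, T[%classic t -> left_lim t = f t.
Proof.
move=> tT; rewrite /left_lim.
have z (m : {finite_measure set (measurableTypeR R) -> \bar R}) :
    m (~` `]0, T[) = 0%E -> m [set t] = 0%E.
  apply: subset_measure0.
  - exact: measurable_set1.
  - by apply: measurableC; exact: measurable_itv.
  - by move=> _ ->.
by rewrite !z ?subrr ?subr0//; [exact: (bvj_NT fPN)|exact: (bvj_PT fPN)].
Qed.

Lemma left_lim_bound t : `|left_lim t| <= bv_bound.
Proof.
have [/andP[t0 tT]|tT] := boolP (0 < t < T); last first.
  by rewrite left_lim_out ?bv_boundP//=; apply/negP; rewrite in_itv.
pose u n := t - t * n.+1%:R^-1.
have u1 n : u n < t by rewrite ltrBlDr ltrDl mulr_gt0// invr_gt0.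
have ucvg : u @ \oo --> t.
  rewrite -[X in _ --> X]subr0 -(mulr0 t); apply: cvgB; first exact: cvg_cst.
  by apply: cvgM; [exact: cvg_cst|exact: cvg_harmonic].
have h : `|f (u n)| @[n --> \oo] --> `|left_lim t|.
  by apply: cvg_norm; exact: bv_left_cvg.
apply: (@cvgr_to_le _ _ _ _ (fun n => `|f (u n)|) _ _ h).
by apply: nearW => n; exact: bv_boundP.
Qed.

Lemma left_lim_measurable :
  measurable_fun [set: measurableTypeR R] (left_lim : measurableTypeR R -> R).
Proof.
pose I : set (measurableTypeR R) := `]0, T[.
have mI : measurable I by exact: measurable_itv.
pose u n (t : measurableTypeR R) : measurableTypeR R := t - t * n.+1%:R^-1.
pose g n (t : measurableTypeR R) : R := \1_I t * f (u n t) + \1_(~` I) t * f t.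
apply: (measurable_fun_cvg (h := g)) => [n|t _].
  apply: measurable_funD; apply: measurable_funM.
  - exact: measurable_indic.
  - apply: measurableT_comp; first exact: bv_measurable.
    apply: continuous_measurable_fun => x; apply: cvgB; first exact: cvg_id.
    by apply: cvgM; [exact: cvg_id|exact: cvg_cst].
  - by apply: measurable_indic; exact: measurableC.
  - exact: bv_measurable.
rewrite /g !indicE in_setC; have [|tI] := boolP (t \in I); last first.
  under eq_fun do rewrite mul0r add0r mul1r.
  rewrite left_lim_out; first exact: cvg_cst.
  by move=> tI'; move/negP: tI; apply; rewrite inE.
under eq_fun do rewrite mul1r mul0r addr0.
rewrite inE /I/= in_itv/= => /andP[t0 tT].
apply: bv_left_cvg => //.
  by move=> n; rewrite /u ltrBlDr ltrDl mulr_gt0// invr_gt0.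
rewrite -[X in _ --> X]subr0 -(mulr0 t); apply: cvgB; first exact: cvg_cst.
by apply: cvgM; [exact: cvg_cst|exact: cvg_harmonic].
Qed.

(** P and N are carried by complementary sets, so at most one of them charges t, and the sign of the
    jump tells which one. *)
Lemma bv_atom (t : R) :
  (0 <= f t - left_lim t -> P [set t] = (f t - left_lim t)%:E /\ N [set t] = 0%E) /\
  (f t - left_lim t <= 0 -> P [set t] = 0%E /\ N [set t] = (left_lim t - f t)%:E).
Proof.
have mt : measurable ([set t] : set (measurableTypeR R)) by exact: measurable_set1.
have PE : P [set t] = (fine (P [set t]))%:E by rewrite fineK ?fin_num_measure.
have NE : N [set t] = (fine (N [set t]))%:E by rewrite fineK ?fin_num_measure.
have P0 : 0 <= fine (P [set t]) by rewrite fine_ge0.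
have N0 : 0 <= fine (N [set t]) by rewrite fine_ge0.
have : fine (P [set t]) = 0 \/ fine (N [set t]) = 0.
  have [Ht|Ht] := pselect (H t).
    right; rewrite -[X in N X](_ : [set t] `&` H = _) ?(bvj_N fPN)//.
    by apply/seteqP; split => [x []//|x -> ].
  left; rewrite -[X in P X](_ : [set t] `\` H = _) ?(bvj_P fPN)//.
  by apply/seteqP; split => [x []//|x -> ].
rewrite PE NE /left_lim /=.
move: (fine _) (fine _) P0 N0 => p n p0 n0 [->|->].
  split; first by move=> h; split; congr EFin; lra.
  by move=> _; split; congr EFin; lra.
split; first by move=> h; split; congr EFin; lra.
by move=> h; split; congr EFin; lra.
Qed.

End bv_jordan_theory.

(** * Image and product measures; Lebesgue measure on the unit interval *)

Section finite_pushforward.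
Context d d' (Y : measurableType d) (X : measurableType d') (R : realType).

(** The restriction to the whole space, here and in [finite_product], leaves the values unchanged;
    it equips the measure with the structure of a finite measure. *)
Lemma finite_pushforward (m : {finite_measure set Y -> \bar R}) (q : Y -> X) :
  measurable_fun setT q ->
  exists m' : {finite_measure set X -> \bar R},
    (forall A, m' A = m (q @^-1` A)) /\
    forall h : X -> \bar R, measurable_fun setT h -> (forall x, 0 <= h x)%E ->
      (\int[m']_x h x = \int[m]_y h (q y))%E.
Proof.
move=> mq.
pose p : {measure set X -> \bar R} :=
  measure_function_pushforward__canonical__measure_function_Measure m mq.
have poo : (p setT < +oo)%E.
  by rewrite /p/= /pushforward preimage_setT -ge0_fin_numE// fin_num_measure.
have E A : mfrestr measurableT poo A = p A.
  by change (p (A `&` setT) = p A); rewrite setIT.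
exists (mfrestr measurableT poo); split => [A|h mh h0]; first exact: E.
rewrite (@eq_measure_integral _ _ _ _ p) => [|A mA _]; last exact: E.
exact: (ge0_integral_pushforward mq).
Qed.

End finite_pushforward.

Section finite_product.
Context d d' (Y : measurableType d) (X : measurableType d') (R : realType).

Lemma finite_product (m : {finite_measure set Y -> \bar R})
    (n : {finite_measure set X -> \bar R}) :
  exists p : {finite_measure set (Y * X)%type -> \bar R},
    (forall A, p A = (m \x n)%E A) /\
    forall h : Y * X -> \bar R, measurable_fun setT h -> (forall x, 0 <= h x)%E ->
      (\int[p]_x h x = \int[m]_y \int[n]_x h (y, x))%E.
Proof.
pose p : {measure set (Y * X)%type -> \bar R} := (m \x n)%E.
have poo : (p setT < +oo)%E.
  change ((m \x n)%E setT < +oo)%E; rewrite -setXTT product_measure1E// lte_mul_pinfty//.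
    by rewrite fin_num_measure.
  by rewrite -ge0_fin_numE// fin_num_measure.
have E A : mfrestr measurableT poo A = p A.
  by change (p (A `&` setT) = p A); rewrite setIT.
exists (mfrestr measurableT poo); split => [A|h mh h0]; first exact: E.
rewrite (@eq_measure_integral _ _ _ _ p) => [|A mA _]; last exact: E.
exact: fubini_tonelli1.
Qed.

End finite_product.

Section unit_interval.
Context {R : realType}.
Notation mu := (@lebesgue_measure R).

Let mI01 : measurable (`]0, 1[ : set (measurableTypeR R)).
Proof. exact: measurable_itv. Qed.

Let I01_lty : (mu `]0%R, 1%R[ < +oo)%E.
Proof. by rewrite lebesgue_measure_itv/= lte_fin ltr01 -EFinB ltry. Qed.

Definition unit_measure : {finite_measure set (measurableTypeR R) -> \bar R} :=
  mfrestr mI01 I01_lty.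

Lemma unit_measureE A : unit_measure A = mu (A `&` `]0, 1[).
Proof. by []. Qed.

Lemma unit_measureT : unit_measure setT = 1%E.
Proof.
by rewrite unit_measureE setTI lebesgue_measure_itv/= lte_fin ltr01 -EFinB subr0.
Qed.

Lemma integral_unit_measure (h : measurableTypeR R -> \bar R) :
  measurable_fun setT h -> (forall x, 0 <= h x)%E ->
  (\int[unit_measure]_x h x = \int[mu]_(x in `]0%R, 1%R[) h x)%E.
Proof.
move=> mh h0.
rewrite (@ge0_negligible_integral _ _ _ unit_measure setT (~` `]0, 1[))//; last 2 first.
- exact: measurableC.
- by rewrite -[LHS]/(mu (~` `]0, 1[ `&` `]0, 1[)) setICl measure0.
rewrite setTD setCK; apply: eq_measure_integral => A mA A01.
by rewrite -[LHS]/(mu (A `&` `]0, 1[)) setIidl.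
Qed.

Lemma unit_interval_slope (w W : R -> R) (a b : R) : continuous w ->
  (forall x : R, 0 <= w x) -> (forall x : R, is_derive x (1 : R) W (w x)) ->
  (\int[unit_measure]_t w ((1 - t) * a + t * b) * (b - a) = W b - W a)%R.
Proof.
move=> cw w0 dW.
pose l t := (1 - t) * a + t * b.
have dl t : is_derive (t : R) (1 : R) l (b - a).
  rewrite (_ : l = cst a + (b - a) \*: (id : R -> R)); last first.
    by apply/funext => x; rewrite -[RHS]/(a + (b - a) * x) /l; ring.
  by apply: is_derive_eq; rewrite add0r /GRing.scale/= mulr1.
have cl : continuous l.
  by move=> t; apply/differentiable_continuous/derivable1_diffP; have [] := dl t.
have dWl t : is_derive (t : R) (1 : R) (W \o l) (w (l t) * (b - a)).
  exact: is_derive1_comp.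
have cwl : continuous (fun t => w (l t)).
  by move=> t; apply: continuous_comp; [exact: cl|exact: cw].
have mwl : measurable_fun [set: measurableTypeR R] (fun t : measurableTypeR R => w (l t)).
  exact: continuous_measurable_fun.
rewrite /Rintegral integral_unit_measure//; last 2 first.
  by apply/measurable_EFinP.
  by move=> x; rewrite lee_fin.
rewrite -(@integral_itv_bndoo _ 0 1 _ true false); last first.
  by apply: measurable_funTS; apply/measurable_EFinP.
have iwl : mu.-integrable `[0, 1] (EFin \o (fun t => w (l t))).
  apply: continuous_compact_integrable; first exact: segment_compact.
  exact: continuous_subspaceT.
rewrite -/(Rintegral _ _ _) -RintegralZr//.
rewrite /Rintegral (@continuous_FTC2 _ _ (W \o l)).
- rewrite /= /l subrr subr0 !mul0r !mul1r add0r addr0 //.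
- exact: ltr01.
- apply: continuous_subspaceT => x; apply: cvgM; first exact: cwl.
  exact: cvg_cst.
- have cWl x : {for x, continuous (W \o l)}.
    by apply/differentiable_continuous/derivable1_diffP; have [] := dWl x.
  split; first by move=> x _; have [] := dWl x.
    by apply: cvg_at_right_filter; exact: cWl.
  by apply: cvg_at_left_filter; exact: cWl.
- by move=> x _; rewrite derive1E; have [_ ->] := dWl x.
Qed.

(** By uniqueness of Lebesgue measure only half-open intervals have to be checked; for j < 0 their
    preimages are half-open on the other side, with the same length. *)
Lemma lebesgue_measure_affine (a j : R) (A : set (measurableTypeR R)) : j != 0 ->
  measurable A ->
  (`|j|%:E * mu ((fun t : measurableTypeR R => (a + t * j)%R : measurableTypeR R) @^-1` A) = mu A)%E.
Proof.
move=> j0 mA.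
have ml : measurable_fun setT (fun t : measurableTypeR R => (a + t * j : measurableTypeR R)).
  apply: continuous_measurable_fun => x; apply: cvgD; first exact: cvg_cst.
  by apply: cvgM; [exact: cvg_id|exact: cvg_cst].
pose p : {measure set (measurableTypeR R) -> \bar R} :=
  measure_function_pushforward__canonical__measure_function_Measure mu ml.
pose q : {measure set (measurableTypeR R) -> \bar R} := mscale (NngNum (normr_ge0 j)) p.
rewrite [RHS](@lebesgue_measure_unique _ q)// => X [[x y] _ <-] /=.
rewrite /q /= /mscale /= /p /= /pushforward.
have [j_lt0|j_gt0|j_eq0] := ltgtP j 0; last by rewrite j_eq0 eqxx in j0.
  rewrite (_ : _ @^-1` _ = `[(y - a) / j, (x - a) / j[%classic); last first.
    apply/seteqP; split => t /=; rewrite !in_itv/= andbC ltr_ndivlMr// ler_ndivrMr//;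
    by rewrite ltrBlDl lerBrDl.
  rewrite !lebesgue_measure_itv/= !lte_fin ltr_nM2r ?invr_lt0// ltrD2r.
  case: ifPn => xy; last by rewrite mule0.
  by rewrite -!EFinB -EFinM (ltr0_norm j_lt0); congr EFin; field.
rewrite (_ : _ @^-1` _ = `](x - a) / j, (y - a) / j]%classic); last first.
  apply/seteqP; split => t /=; rewrite !in_itv/= ltr_pdivrMr// ler_pdivlMr//;
  by rewrite ltrBlDl lerBrDl.
rewrite !lebesgue_measure_itv/= !lte_fin ltr_pM2r ?invr_gt0// ltrD2r.
case: ifPn => xy; last by rewrite mule0.
by rewrite -!EFinB -EFinM (gtr0_norm j_gt0); congr EFin; field.
Qed.

End unit_interval.

(** * The one-dimensional Hausdorff measure on vertical fibers *)

Section hausdorff_fibers.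
Local Open Scope ereal_scope.
Context (R : realType) (d : nat).
Notation X := (R * 'rV[R]_d * R)%type.
Notation dist := (@Defs.edist R d).
Notation mu := (@lebesgue_measure R).

Lemma edist_fiber t x (v w : R) : dist (t, x, v) (t, x, w) = `|v - w|%R.
Proof.
rewrite /Defs.edist/= subrr expr0n/= add0r big1 => [|i _]; last by rewrite subrr expr0n.
by rewrite add0r sqrtr_sqr.
Qed.

Let sum_sqr_ge0 (x y : 'rV[R]_d) : (0 <= \sum_(i < d) (x ord0 i - y ord0 i) ^+ 2)%R.
Proof. by apply: sumr_ge0 => i _; exact: sqr_ge0. Qed.

Lemma edist_ge_time (p q : X) : (`|p.1.1 - q.1.1| <= dist p q)%R.
Proof.
rewrite -sqrtr_sqr ler_wsqrtr// -addrA lerDl addr_ge0//; exact: sqr_ge0.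
Qed.

Lemma diameter_ge0 (A : set X) : 0 <= diameter dist A.
Proof. by apply: ereal_sup_ubound; left. Qed.

Lemma diameter_ubound (A : set X) p q : A p -> A q -> (dist p q)%:E <= diameter dist A.
Proof. by move=> Ap Aq; apply: ereal_sup_ubound; right; exists p, q. Qed.

Lemma diameter_le (A : set X) (e : R) : (0 <= e)%R ->
  (forall p q, A p -> A q -> (dist p q <= e)%R) -> diameter dist A <= e%:E.
Proof.
move=> e0 Ae; apply: ge_ereal_sup => _ [->|[p [q [Ap Aq ->]]]]; rewrite lee_fin//.
exact: Ae.
Qed.

(** Giving infinite weight to sets of diameter above [delta] turns the restricted infimum into an
    outer measure generated by a weight. All sets are declared measurable in [gX], so that arbitrary
    covers are allowed. *)
Lemma hausdorff1_deltaW (delta : R) : sigma_subadditive (hausdorff1_delta dist delta).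
Proof.
pose gX := g_sigma_algebraType [set: set X].
have mT (A : set gX) : measurable A by exact: sub_sigma_algebra.
pose m (C : set gX) : \bar R :=
  if diameter dist C <= delta%:E then diameter dist C else +oo.
have m0 C : 0 <= m C by rewrite /m; case: ifP => // _; exact: diameter_ge0.
have E A : hausdorff1_delta dist delta A = mu_ext m A.
  apply/eqP; rewrite eq_le; apply/andP; split.
  - apply: le_ereal_inf_tmp => _ [C [_ AC] <-].
    have [Cd|] := pselect (forall n, diameter dist (C n) <= delta%:E).
      apply: ereal_inf_lbound; exists C; split => //.
      by apply: eq_eseriesr => n _; rewrite /m Cd.
    move=> /existsNP[n /negP Cn].
    rewrite (eseries_pinfty _ _ (_ : m (C n) = +oo)) ?leey//.
      by move=> k _; rewrite gt_eqF// (lt_le_trans _ (m0 _)).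
    by rewrite /m (negbTE Cn).
  - apply: le_ereal_inf_tmp => _ [C [AC Cd ->]].
    apply: ereal_inf_lbound; exists C; first by split.
    by apply: eq_eseriesr => n _; rewrite /m Cd.
move=> A; rewrite E; under eq_eseriesr do rewrite E.
exact: (@mu_ext_sigma_subadditive _ gX).
Qed.

Lemma hausdorff1_delta_le (delta : R) (A B : set X) : A `<=` B ->
  hausdorff1_delta dist delta A <= hausdorff1_delta dist delta B.
Proof.
move=> AB; apply: ereal_inf_le_tmp => _ [C [BC Cd ->]].
by exists C; split => //; exact: subset_trans BC.
Qed.

Definition fiber (t : R) (x : 'rV[R]_d) (Y : set R) : set X :=
  [set p | [/\ p.1.1 = t, p.1.2 = x & Y p.2]].

Lemma hausdorff1_delta_fiber_itv (delta : R) t x (a b : R) : (0 < delta)%R -> (a < b)%R ->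
  hausdorff1_delta dist delta (fiber t x `]a, b]) <= (b - a)%:E.
Proof.
move=> d0 ab.
(* The interval is cut into [N] equal pieces, enough for their length [h] to be at most [delta]. *)
pose N := (Num.bound ((b - a) / delta)).+1.
pose h : R := ((b - a) / N%:R)%R.
have N0 : (0 < N%:R :> R)%R by rewrite ltr0n.
have ba0 : (0 < b - a)%R by rewrite subr_gt0.
have h0 : (0 < h)%R by rewrite divr_gt0.
have hd : (h <= delta)%R.
  rewrite /h ler_pdivrMr// mulrC -ler_pdivrMr//.
  apply: (le_trans (ltW (archi_boundP _))); first by rewrite divr_ge0// ltW.
  by rewrite ler_nat.
have NS : N = N.-1.+1 by [].
clearbody N.
pose C n : set X := if (n < N)%N then fiber t x `[(a + n%:R * h)%R, (a + n.+1%:R * h)%R] else set0.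
have Ch n : (n < N)%N -> diameter dist (C n) <= h%:E.
  move=> nN; rewrite /C nN; apply: diameter_le; first exact: ltW.
  move=> [[t1 x1] v] [[t2 x2] w] [/= -> -> +] [/= -> -> +].
  rewrite !in_itv/= => /andP[v1 v2] /andP[w1 w2].
  rewrite edist_fiber ler_norml; move: v1 v2 w1 w2; rewrite -natr1 mulrDl mul1r; lra.
have C0 n : (N <= n)%N -> diameter dist (C n) = 0.
  move=> nN; apply/eqP; rewrite eq_le diameter_ge0 andbT /C ltnNge nN/=.
  by apply: diameter_le.
apply: (@le_trans _ _ (\sum_(0 <= n <oo) diameter dist (C n))).
  apply: ereal_inf_lbound; exists C; split => //.
    move=> [[t1 x1] v] [/= -> ->]; rewrite in_itv/= => /andP[av vb].
    pose k := Num.truncn ((v - a) / h)%R.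
    have va0 : (0 <= (v - a) / h)%R by rewrite divr_ge0 ?ltW// subr_gt0.
    have /andP[k1 k2] := truncn_itv va0.
    have [kN|Nk] := ltnP k N.
      exists k => //; rewrite /C kN; split => //=.
      rewrite in_itv/= -lerBrDl -ler_pdivlMr// k1/=.
      by rewrite -lerBlDl -ler_pdivrMr// ltW.
    (* The computed index reaches [N] only for v = b, which belongs to the last closed piece. *)
    have Nh : (a + N%:R * h = b)%R by rewrite /h mulrC divfK ?subrKC// gt_eqF.
    have NN : (N.-1 < N)%N by rewrite {2}NS.
    exists N.-1 => //; rewrite /C NN -NS; split => //=.
    have -> : v = b.
      apply/eqP; rewrite eq_le vb/= -Nh -lerBrDl -ler_pdivlMr//.
      by apply: le_trans k1; rewrite ler_nat.
    rewrite in_itv/= Nh lexx andbT -[X in (_ <= X)%R]Nh lerD2l ler_pM2r// ler_nat.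
    by rewrite leq_pred.
  move=> n; have [nN|nN] := ltnP n N; last by rewrite C0// lee_fin ltW.
  by apply: le_trans (Ch _ nN) _; rewrite lee_fin.
rewrite (@nneseries_split _ _ 0 N); last by move=> k _; exact: diameter_ge0.
rewrite add0n [X in _ + X]eseries0 ?adde0; last by move=> k Nk _; rewrite C0.
apply: (@le_trans _ _ (\sum_(0 <= i < N) h%:E)).
  by rewrite big_nat_cond [leRHS]big_nat_cond; apply: lee_sum => n /andP[/andP[_ nN] _]; exact: Ch.
rewrite sumEFin lee_fin big_const_nat iter_addr_0 subn0 -mulr_natl.
by rewrite /h mulrC divfK// gt_eqF.
Qed.

(** Lebesgue measure is itself the infimum of the total lengths of countable covers by half-open
    intervals, and each such interval costs at most its length. *)
Lemma hausdorff1_delta_fiber (delta : R) t x (Y : set R) : (0 < delta)%R ->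
  hausdorff1_delta dist delta (fiber t x Y) <= mu Y.
Proof.
move=> d0; apply: le_ereal_inf_tmp => _ [F [mF YF] <-].
apply: (@le_trans _ _ (\sum_(0 <= k <oo) hausdorff1_delta dist delta (fiber t x (F k)))).
  apply: le_trans (hausdorff1_deltaW _ _); apply: hausdorff1_delta_le.
  by move=> p [p1 p2 /YF[k _ Fk]]; exists k.
apply: lee_nneseries => [n _ _|n _].
  by apply: le_ereal_inf_tmp => _ [C [_ _ ->]]; apply: nneseries_ge0 => k _ _; exact: diameter_ge0.
have /ocitvP[->|[[a b] /= ab ->]] := mF n.
  rewrite [leRHS](_ : _ = 0); last exact: wlength0.
  apply: ereal_inf_lbound; exists (fun=> set0); split.
  - by move=> p [].
  - by move=> k; apply: diameter_le => //; exact: ltW.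
  - rewrite eseries0// => k _ _; apply/eqP; rewrite eq_le diameter_ge0 andbT.
    exact: diameter_le.
rewrite [leRHS](_ : _ = (b - a)%:E); last exact: (wlength_itv_bnd idfun false false (ltW ab)).
exact: hausdorff1_delta_fiber_itv.
Qed.

Context (t_ : nat -> R) (x_ : nat -> 'rV[R]_d) (Y_ : nat -> set R).
Hypothesis mY : forall n, measurable (Y_ n : set (measurableTypeR R)).
Hypothesis t_inj : forall n m, Y_ n !=set0 -> Y_ m !=set0 -> t_ n = t_ m -> n = m.

Let S := \bigcup_n fiber (t_ n) (x_ n) (Y_ n).

Lemma hausdorff1_fibers_le : hausdorff1 dist S <= \sum_(0 <= n <oo) mu (Y_ n).
Proof.
apply: ge_ereal_sup => _ [delta /= d0 <-].
apply: le_trans (hausdorff1_deltaW _ _) _; apply: lee_nneseries => [n _ _|n _].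
  by apply: le_ereal_inf_tmp => _ [C [_ _ ->]]; apply: nneseries_ge0 => k _ _; exact: diameter_ge0.
exact: hausdorff1_delta_fiber.
Qed.

(** Times are distinct among nonempty fibers only, since the indices without an atom will share a
    default time. The value 1 at equal times is a placeholder that keeps the minimum positive. *)
Let separation (n : nat) : exists2 delta : R, (0 < delta)%R &
  forall i j, (i < n)%N -> (j < n)%N -> Y_ i !=set0 -> Y_ j !=set0 ->
    i != j -> (delta < `|t_ i - t_ j|)%R.
Proof.
pose g (ij : 'I_n * 'I_n) : R :=
  (if t_ ij.1 == t_ ij.2 then 1 else `|t_ ij.1 - t_ ij.2|)%R.
pose delta : R := (\big[Order.min/1%R]_(ij : 'I_n * 'I_n) g ij / 2)%R.
have g0 ij : (0 < g ij)%R.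
  by rewrite /g; case: ifPn => // tij; rewrite normr_gt0 subr_eq0.
have m0 : (0 < \big[Order.min/1%R]_(ij : 'I_n * 'I_n) g ij)%R.
  by elim/big_ind : _ => // a b a0 b0; rewrite lt_min a0 b0.
exists delta => [|i j ni nj Yi Yj ij]; first by rewrite divr_gt0.
apply: (@lt_le_trans _ _ (g (Ordinal ni, Ordinal nj))).
  apply: (@lt_le_trans _ _ (\big[Order.min/1%R]_(ij : 'I_n * 'I_n) g ij)).
    by rewrite /delta ltr_pdivrMr// ltr_pMr// ltr1n.
  exact: bigmin_le_cond.
rewrite /g/=; case: ifPn => // /eqP tij.
by move: ij; rewrite (t_inj Yi Yj tij) eqxx.
Qed.

(** The interval from the infimum to the supremum of the section is no longer than the diameter. An
    empty section is covered by the empty set, so that a positive measure of [W] certifies that [C]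
    meets the fiber. *)
Let section_cover (C : set X) (delta : R) k : diameter dist C <= delta%:E ->
  exists W : set (measurableTypeR R), [/\ measurable W,
    forall v, Y_ k v -> C (t_ k, x_ k, v) -> W v,
    mu W <= diameter dist C &
    mu W != 0 -> exists2 v, Y_ k v & C (t_ k, x_ k, v)].
Proof.
move=> Cd; pose V := [set v | Y_ k v /\ C (t_ k, x_ k, v)].
have [[v0 [Yv0 Cv0]]|V0] := pselect (V !=set0); last first.
  exists set0; split => //.
  - by move=> v Yv Cv; apply: V0; exists v.
  - by rewrite measure0 diameter_ge0.
  - by rewrite measure0 eqxx.
have Df : diameter dist C \is a fin_num.
  by rewrite ge0_fin_numE ?diameter_ge0// (le_lt_trans Cd)// ltry.
have Vd v w : V v -> V w -> (v - w <= fine (diameter dist C))%R.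
  move=> [_ Cv] [_ Cw]; rewrite -lee_fin fineK//.
  apply: le_trans (diameter_ubound Cv Cw).
  by rewrite lee_fin edist_fiber ler_norm.
have V00 : V !=set0 by exists v0.
have Vub : has_ubound V.
  by exists (v0 + fine (diameter dist C))%R => v Vv; rewrite -lerBlDl; exact: Vd.
have Vlb : has_lbound V.
  by exists (v0 - fine (diameter dist C))%R => v Vv; rewrite lerBlDl -lerBlDr; exact: Vd.
exists `[inf V, sup V]; split.
- exact: measurable_itv.
- move=> v Yv Cv; by rewrite /= in_itv/= ge_inf ?ub_le_sup.
- rewrite lebesgue_measure_itv/=; case: ifPn => _; last exact: diameter_ge0.
  rewrite -EFinB -(fineK Df) lee_fin lerBlDr.
  apply: ge_sup => // v Vv; rewrite -lerBlDl.
  apply: lb_le_inf => // w Vw; rewrite lerBlDr -lerBlDl.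
  exact: Vd.
- by move=> _; exists v0.
Qed.

(* Finitely many fibers lie at a positive distance from each other, so a cover by
   sets of small diameter splits into covers of the single fibers. *)
Lemma hausdorff1_fibers_ge : \sum_(0 <= n <oo) mu (Y_ n) <= hausdorff1 dist S.
Proof.
apply: lime_le; first exact: is_cvg_nneseries.
apply: nearW => n.
have [delta d0 sep] := separation n.
apply: (@le_trans _ _ (hausdorff1_delta dist delta S)); last first.
  by apply: ereal_sup_ubound; exists delta.
apply: le_ereal_inf_tmp => _ [C [SC Cd ->]].
have [W' HW'] := choice (fun mk : nat * nat => section_cover mk.2 (Cd mk.1)).
pose W m k := W' (m, k).
have HW m k := HW' (m, k).
apply: (@le_trans _ _ (\sum_(0 <= k < n) \sum_(0 <= m <oo) mu (W m k))).
  apply: lee_sum => k _; apply: measure_sigma_subadditive => //.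
    by move=> m; have [] := HW m k.
  move=> v Yv; have [m _ Cm] : (\bigcup_m C m) (t_ k, x_ k, v).
    by apply: SC; exists k.
  by exists m => //; have [_ h _ _] := HW m k; exact: h.
rewrite -nneseries_sum_nat//; apply: lee_nneseries => [m _ _|m _].
  by apply: sume_ge0.
(* A set of diameter at most [delta] meets at most one of the first n fibers, so at most one term of
   the sum over k is nonzero. *)
have [/existsP[k /andP[kn Wk]]|] := boolP [exists k : 'I_n, true && (mu (W m k) != 0)].
  rewrite (bigD1_seq (k : nat)) ?mem_index_iota ?ltn_ord ?iota_uniq//=.
  rewrite big1_seq ?adde0; first by have [] := HW m k.
  move=> j /andP[jk]; rewrite mem_index_iota /= => jn.
  apply: contrapT => /eqP Wj.
  have [_ _ _ /(_ Wk)[v Yv Cv]] := HW m k; have [_ _ _ /(_ Wj)[w Yw Cw]] := HW m j.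
  have := sep _ _ jn (ltn_ord k) (ex_intro _ _ Yw) (ex_intro _ _ Yv) jk.
  rewrite ltNge => /negP; apply.
  rewrite -lee_fin; apply: le_trans (Cd m); apply: le_trans (diameter_ubound Cw Cv).
  by rewrite lee_fin; exact: (edist_ge_time (t_ j, x_ j, w) (t_ k, x_ k, v)).
rewrite negb_exists => /forallP W0.
rewrite big1_seq ?diameter_ge0// => j; rewrite mem_index_iota /= => jn.
by have := W0 (Ordinal jn); rewrite /= negbK => /eqP.
Qed.

Lemma hausdorff1_fibers : hausdorff1 dist S = \sum_(0 <= n <oo) mu (Y_ n).
Proof.
by apply/eqP; rewrite eq_le hausdorff1_fibers_le hausdorff1_fibers_ge.
Qed.

End hausdorff_fibers.

(** * Atoms of finite measures and integrals against set functions *)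

Section measure_atoms.
Context {R : realType} (m : {finite_measure set (measurableTypeR R) -> \bar R}).

(** Finite total mass leaves room for only finitely many atoms of mass at least 1/(n+1). *)
Lemma countable_atoms : countable [set t | m [set t] != 0%E].
Proof.
have m1 (t : R) : measurable ([set t] : set (measurableTypeR R)) by exact: measurable_set1.
rewrite (_ : [set _ | _] = \bigcup_n [set t | (n.+1%:R^-1%:E <= m [set t])%E]); last first.
  apply/seteqP; split => [t /= mt|t [n _ /=]].
    have fmt : 0 < fine (m [set t]).
      by rewrite fine_gt0// lt0e mt measure_ge0 -ge0_fin_numE ?fin_num_measure.
    have [n _ nP] := near_infty_natSinv_lt (PosNum fmt).
    exists n => //=; rewrite -[X in (_ <= X)%E]fineK ?fin_num_measure// lee_fin ltW//.
    by have /= := nP n (leqnn n).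
  by apply: contraTneq => ->; rewrite -ltNge lte_fin invr_gt0.
apply: bigcup_countable => // n _; apply: finite_set_countable.
apply: contrapT => inf.
have [B BA Bn] := infinite_set_fset (Num.bound (fine (m setT) * n.+1%:R)) inf.
have : (m [set` B] <= m setT)%E.
  apply: le_measure => //; apply: mem_set => //.
  by apply: countable_measurable => //; exact: countable_fset.
apply/negP; rewrite -ltNge.
rewrite (_ : [set` B] = \big[setU/set0]_(i <- B) [set i]); last first.
  by rewrite -bigcup_fset; apply/seteqP; split => [x Bx|x [y By ->]]//; exists x.
rewrite measure_fbigsetU//; last by apply/trivIsetP => i j _ _ /eqP ij; apply/seteqP; split => // x [/= -> ] /ij.
apply: (@lt_le_trans _ _ (\sum_(i <- B) n.+1%:R^-1%:E)%E).
  rewrite sumEFin.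
  rewrite big_const_seq count_predT iter_addr_0.
  rewrite -[X in (_ < X%:E)%E]mulr_natl -[X in (X < _)%E]fineK ?fin_num_measure//.
  rewrite lte_fin ltr_pdivlMr//.
  apply: (lt_le_trans (archi_boundP _)); first by rewrite mulr_ge0// fine_ge0.
  by rewrite ler_nat.
by rewrite big_seq [leRHS]big_seq; apply: lee_sum => // i Bi; exact: BA.
Qed.

Lemma countable_null (A : set R) : countable A ->
  (forall t, A t -> m [set t] = 0%E) -> m A = 0%E.
Proof.
move=> cA A0; have m1 (t : R) : measurable ([set t] : set (measurableTypeR R)).
  exact: measurable_set1.
have mA : measurable (A : set (measurableTypeR R)) by exact: countable_measurable.
have /countable_injP[i inj] := cA.
pose a n := [set t | A t /\ i t = n].
have aE n : a n = set0 \/ exists2 t, A t & a n = [set t].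
  have [[t [At it]]|an] := pselect (a n !=set0); last first.
    by left; apply/seteqP; split => // t at'; apply: an; exists t.
  right; exists t => //; apply/seteqP; split => [s [As is']|s ->]//.
  by apply: inj; [exact: mem_set|exact: mem_set|rewrite is' it].
have AE : A `<=` \bigcup_n a n by move=> t At; exists (i t).
apply/eqP; rewrite eq_le measure_ge0 andbT.
have ma n : measurable (a n : set (measurableTypeR R)) by have [->|[t _ ->]] := aE n.
apply: (le_trans (measure_sigma_subadditive m ma mA AE)).
rewrite eseries0// => n _ _ /=.
by have [->|[t At ->]] := aE n; rewrite ?measure0 ?A0.
Qed.

End measure_atoms.

Section integral_set_function.
Local Open Scope ereal_scope.
Context d (Y : measurableType d) (R : realType).
Import HBNNSimple.

(* The library states this for measures only; the Hausdorff measure is not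
   known to be one. *)
Lemma eq_integral_set_function (m1 m2 : set Y -> \bar R) (D : set Y) (h : Y -> \bar R) :
  (forall A, measurable A -> A `<=` D -> m1 A = m2 A) ->
  \int[m1]_(x in D) h x = \int[m2]_(x in D) h x.
Proof.
move=> m12; rewrite /integral.
suff E g : (forall x, ~ D x -> g x <= 0) ->
    [set sintegral m1 k | k in [set k : {nnsfun Y >-> R} | forall x, (k x)%:E <= g x]] =
    [set sintegral m2 k | k in [set k : {nnsfun Y >-> R} | forall x, (k x)%:E <= g x]].
  rewrite (E (_ ^\+)%E) ?(E (_ ^\-)%E)// => x Dx.
    by rewrite funenegE patchE memNset// oppe0 maxxx.
  by rewrite funeposE patchE memNset// maxxx.
move=> gD.
have eqs (k : {nnsfun Y >-> R}) : (forall x, (k x)%:E <= g x) ->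
    sintegral m1 k = sintegral m2 k.
  move=> kg; apply: eq_fsbigr => r _.
  have [->|r0] := eqVneq r 0%R; first by rewrite !mul0e.
  rewrite m12// => x /= kx; apply: contrapT => /gD gx0.
  have := le_trans (kg x) gx0; rewrite kx lee_fin => r_le0.
  by move: r0; rewrite eq_le r_le0 -kx fun_ge0.
by apply/seteqP; split => _ [k kg <-] /=; exists k => //; rewrite eqs.
Qed.

End integral_set_function.

(** * The production of a curve as a difference of two finite measures *)

Section lift.
Context {R : realType} (d : nat) (T : R) (f : R -> R)
  (P N : {finite_measure set (measurableTypeR R) -> \bar R}) (H : set R).
Hypothesis fPN : bv_jordan T f P N H.
Context (c : R -> 'rV[R]_d).
Hypothesis mc : measurable_fun [set: measurableTypeR R] (c : measurableTypeR R -> 'rV[R]_d).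
Notation X := (R * 'rV[R]_d * R)%type.
Notation RR := (measurableTypeR R * measurableTypeR R)%type.

Definition lift_level (s t : R) : R := (1 - t) * left_lim f P N s + t * f s.

(* The graph of the curve, with its jumps filled in by vertical segments
   parametrized by p.2 in (0,1). *)
Definition lift_point (p : RR) : X := (p.1, c p.1, lift_level p.1 p.2).

Lemma measurable_lift_point : measurable_fun setT lift_point.
Proof.
apply: measurable_fun_pair => /=.
  apply: measurable_fun_pair => /=; first exact: measurable_fst.
  exact: (measurableT_comp mc measurable_fst).
rewrite /lift_level; apply: measurable_funD; apply: measurable_funM.
- by apply: measurable_funB => //; exact: measurable_snd.
- exact: (measurableT_comp (left_lim_measurable fPN) measurable_fst).
- exact: measurable_snd.
- exact: (measurableT_comp (bv_measurable fPN) measurable_fst).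
Qed.

Lemma lift_exists (m : {finite_measure set (measurableTypeR R) -> \bar R}) :
  exists M : {finite_measure set X -> \bar R}, forall h : X -> \bar R,
    measurable_fun setT h -> (forall p, 0 <= h p)%E ->
    (\int[M]_p h p = \int[m]_s \int[unit_measure]_t h (lift_point (s, t)))%E.
Proof.
have [p [_ pI]] := finite_product m unit_measure.
have [M [_ MI]] := finite_pushforward p measurable_lift_point.
exists M => h mh h0; rewrite MI// pI//.
exact: measurableT_comp mh measurable_lift_point.
Qed.

Section jump_part.
Local Open Scope ereal_scope.
Context (m : {finite_measure set (measurableTypeR R) -> \bar R})
  (M : {finite_measure set X -> \bar R}).
Notation mu := (@lebesgue_measure R).
Hypothesis m_atom : forall t, m [set t] != 0 ->
  m [set t] = `|f t - left_lim f P N t|%:E.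
Hypothesis ME : forall h : X -> \bar R,
  measurable_fun setT h -> (forall p, 0 <= h p)%E ->
  (\int[M]_p h p = \int[m]_s \int[unit_measure]_t h (lift_point (s, t)))%E.

Let K : set R := [set t | m [set t] != 0].

Let mK : measurable (K : set (measurableTypeR R)).
Proof.
by apply: countable_measurable; [exact: measurable_set1|exact: countable_atoms].
Qed.

Definition jumps : set X := [set p | [/\ m [set p.1.1] != 0, c p.1.1 = p.1.2 &
  (Order.min (left_lim f P N p.1.1) (f p.1.1) < p.2 <
   Order.max (left_lim f P N p.1.1) (f p.1.1))%R]].

Let jump_neq0 t : K t -> (f t - left_lim f P N t)%R != 0%R.
Proof.
by move=> Kt; move: (Kt); rewrite /K/= m_atom//; apply: contra => /eqP ->; rewrite normr0.
Qed.

Let level_between s t : K s -> (jumps (lift_point (s, t)) <-> `]0%R, 1%R[%classic t).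
Proof.
move=> Ks; have := jump_neq0 Ks; rewrite /jumps /lift_point /= /lift_level in_itv/=.
move: (left_lim _ _ _ s) (f s) => a b; rewrite subr_eq0 => ba.
split.
  move=> [_ _]; have [ab|ab|ab] := ltgtP a b; last by rewrite ab eqxx in ba.
    by move=> /andP[h1 h2]; apply/andP; split; nra.
  by move=> /andP[h1 h2]; apply/andP; split; nra.
move=> /andP[h1 h2]; split => //.
have [ab|ab|ab] := ltgtP a b; last by rewrite ab eqxx in ba.
  by apply/andP; split; nra.
by apply/andP; split; nra.
Qed.

Let lift_measure (S : set X) : measurable S ->
  M S = \int[m]_s unit_measure [set t | S (lift_point (s, t))].
Proof.
move=> mS; transitivity (\int[M]_p (\1_S p)%:E).
  by rewrite integral_indic// setIT.
rewrite ME; last 2 first.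
- by apply/measurable_EFinP; exact: measurable_indic.
- by move=> p; rewrite lee_fin.
apply: eq_integral => s _.
rewrite (_ : (fun t => _) = fun t => (\1_[set t | S (lift_point (s, t))] t)%:E)//.
rewrite integral_indic ?setIT//.
have ml : measurable_fun setT (fun t : measurableTypeR R => lift_point (s, t)).
  apply: (measurableT_comp measurable_lift_point); exact: measurable_pair1.
by rewrite -[X in measurable X]setTI; exact: ml.
Qed.

(** Over an atom the segment is parametrized affinely by (0, 1), and the mass of the atom, the
    absolute value of the jump, is exactly the Jacobian. Hence both sides give Lebesgue measure on
    each fiber, and the atoms being countable both are sums over the fibers. *)
Lemma jumps_fibers_measure (S : set X) : measurable S -> S `<=` jumps ->
  M S = hausdorff1 (@Defs.edist R d) S.
Proof.
move=> mS SJ.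
have /countable_injP[i inj] := countable_atoms m.
pose a n := [set t | K t /\ i t = n].
have a1 n t : K t -> i t = n -> a n = [set t].
  move=> Kt it; apply/seteqP; split => [s [Ks is']|s ->]//.
  by apply: inj; [exact: mem_set|exact: mem_set|rewrite is' it].
(* Indices without an atom receive the default time 0, and [Y n] is then empty. *)
pose t_ n := xget 0%R (a n).
pose Y n := [set v | a n (t_ n) /\ S (t_ n, c (t_ n), v)].
have aE n t : a n t -> t_ n = t.
  by move=> at'; rewrite /t_; case: xgetP => [s -> [Ks is']|/(_ t)//];
     case: at' => Kt it; apply: inj; [exact: mem_set|exact: mem_set|rewrite is' it].
have SE : S = \bigcup_n fiber (t_ n) (c (t_ n)) (Y n).
  apply/seteqP; split => [[[t x] v] Sp|[[t x] v] [n _ [/= -> -> [_ ]]]]//.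
  have [/= Kt cx _] := SJ _ Sp.
  have at' : a (i t) t by [].
  exists (i t) => //; split => /=; rewrite ?(aE _ _ at')//.
  by rewrite /Y /= (aE _ _ at') cx; split.
have mY n : measurable (Y n : set (measurableTypeR R)).
  have [an|an] := pselect (a n (t_ n)).
    rewrite (_ : Y n = xsection S (t_ n, c (t_ n))).
      exact: measurable_xsection.
    apply/seteqP; split => w; rewrite /Y /xsection /=.
      by move=> [_ Sw]; exact: mem_set.
    by move=> /set_mem Sw; split.
  rewrite (_ : Y n = set0)//; apply/seteqP; split => // v [].
  by [].
rewrite [in RHS]SE hausdorff1_fibers//; last first.
  move=> n k [v [[_ nE] _]] [w [[_ kE] _]] tt.
  exact: etrans (esym nE) (etrans (congr1 i tt) kE).
rewrite lift_measure//.
pose phi s := unit_measure [set t | S (lift_point (s, t))].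
have phi0 s : ~ K s -> phi s = 0.
  move=> nKs; rewrite /phi (_ : [set _ | _] = set0) ?measure0//.
  by apply/seteqP; split => // t /SJ[].
rewrite -/phi (_ : (\int[m]_s phi s) = \int[m]_(s in \bigcup_n a n) phi s); last first.
  apply: eq_integral_support => s; last by move=> _ /(_ I).
  by move=> _ ns; apply: phi0 => Ks; apply: ns; exists (i s).
have phi_ge0 s : 0 <= phi s by exact: measure_ge0.
have ma n : measurable (a n : set (measurableTypeR R)).
  have [[t [Kt it]]|an] := pselect (a n !=set0).
    by rewrite (a1 n t)//; exact: measurable_set1.
  by rewrite (_ : a n = set0)//; apply/seteqP; split => // t at'; apply: an; exists t.
rewrite ge0_integral_bigcup//=; last 2 first.
- apply: measurable_funTS.
  have mLS : measurable (lift_point @^-1` S).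
    by rewrite -[X in measurable X]setTI; exact: measurable_lift_point.
  have := measurable_fun_xsection unit_measure mLS.
  congr (measurable_fun _ _); apply/funext => s /=; rewrite /phi; congr (unit_measure _).
  by apply/seteqP; split => t; rewrite /xsection /=; [exact: set_mem|exact: mem_set].
- apply/trivIsetP => n k _ _ nk; apply/seteqP; split => // t [[_ it] [_ it']].
  by move: nk; rewrite -it it' eqxx.
apply: eq_eseriesr => n _.
have [[t [Kt it]]|an] := pselect (a n !=set0); last first.
  rewrite (_ : a n = set0); last by apply/seteqP; split => // t at'; apply: an; exists t.
  rewrite integral_set0 (_ : Y n = set0) ?measure0//.
  by apply/seteqP; split => // v [at' _]; apply: an; exists (t_ n).
have tn : t_ n = t by exact: aE.
rewrite (a1 n t)//.
rewrite (eq_integral (cst (phi t))); last by move=> s /set_mem ->.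
rewrite integral_cst/=; last exact: measurable_set1.
rewrite m_atom// muleC -[RHS](@lebesgue_measure_affine _ (left_lim f P N t) (f t - left_lim f P N t))//; last exact: jump_neq0.
congr (_ * _); rewrite /phi.
change (mu ([set t0 | S (lift_point (t, t0))] `&` `]0%R, 1%R[) = mu ((fun t0 => left_lim f P N t + t0 * (f t - left_lim f P N t))%R @^-1` Y n)).
congr (mu _); apply/seteqP; split => [s [Ss s01]|s /=].
  rewrite /= /Y tn; split => //.
  by move: Ss; rewrite /lift_point /lift_level /=; congr (S (_, _)); ring.
rewrite /Y tn => -[_ Ss].
have Ss' : S (lift_point (t, s)).
  by move: Ss; rewrite /lift_point /lift_level /=; congr (S (_, _)); ring.
by split => //; apply/(level_between s Kt); exact: SJ.
Qed.

Lemma measurable_jumps : measurable jumps.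
Proof.
have mt : measurable_fun setT (fun p : X => p.1.1 : measurableTypeR R).
  exact: (measurableT_comp measurable_fst measurable_fst).
have mv : measurable_fun setT (fun p : X => p.2 : measurableTypeR R).
  exact: measurable_snd.
have ml : measurable_fun setT (fun p : X => left_lim f P N p.1.1).
  exact: measurableT_comp (left_lim_measurable fPN) mt.
have mf : measurable_fun setT (fun p : X => f p.1.1).
  exact: measurableT_comp (bv_measurable fPN) mt.
have mci i : measurable_fun setT (fun p : X => c p.1.1 ord0 i - p.1.2 ord0 i)%R.
  apply: measurable_funB.
    exact: (measurableT_comp (measurable_rV_coord i) (measurableT_comp mc mt)).
  apply: (measurableT_comp (measurable_rV_coord i)).
  exact: (measurableT_comp measurable_snd measurable_fst).
have pos (h : X -> R) : measurable_fun setT h -> measurable [set p | (0 < h p)%R].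
  move=> mh; rewrite -[X in measurable X]setTI.
  have := mh measurableT `]0%R, +oo[%classic (measurable_itv _).
  by congr (measurable _); congr (_ `&` _); apply/seteqP; split => p /=; rewrite in_itv/= andbT.
rewrite (_ : jumps = ((fun p : X => p.1.1 : measurableTypeR R) @^-1` K) `&`
   (\bigcap_(i in [set: 'I_d]) ((fun p : X => c p.1.1 ord0 i - p.1.2 ord0 i)%R @^-1` [set 0%R])) `&`
   ([set p : X | (0 < p.2 - Order.min (left_lim f P N p.1.1) (f p.1.1))%R] `&`
    [set p : X | (0 < Order.max (left_lim f P N p.1.1) (f p.1.1) - p.2)%R])).
  apply: measurableI; first apply: measurableI.
  - by rewrite -[X in measurable X]setTI; exact: mt.
  - apply: fin_bigcap_measurable => // i _.
    rewrite -[X in measurable X]setTI; apply: (mci i measurableT).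
    exact: measurable_set1.
  - apply: measurableI; apply: pos; apply: measurable_funB => //.
      exact: measurable_minr.
    exact: measurable_maxr.
apply/seteqP; split => [[[t x] v] [/= Kt cx /andP[h1 h2]]|[[t x] v] [[/= Kt cx] []]].
  split; first split => //.
    by move=> i _ /=; rewrite cx subrr.
  by split => /=; rewrite subr_gt0.
rewrite !subr_gt0 => h1 h2; split => //=; last by rewrite h1 h2.
by apply/rowP => i; apply/eqP; rewrite -subr_eq0; apply/eqP/cx.
Qed.

(** [A] may exceed the atoms of [m], so that one set, the atoms of the signed derivative, can serve
    for both P and N. Off [A] the lift ignores its parameter and gives the graph. Inside [A] only
    atoms of [m] carry mass, and over them every parameter in (0, 1) gives a point of [jumps]. *)
Lemma lift_split (A : set R) (B : set X) (h : X -> \bar R) :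
  countable A -> K `<=` A -> (forall s, ~ A s -> left_lim f P N s = f s) ->
  measurable B -> measurable_fun setT h -> (forall p, 0 <= h p) ->
  \int[M]_(p in B) h p =
    \int[m]_(s in [set s | B (s, c s, f s)] `\` A) h (s, c s, f s) +
    \int[hausdorff1 (@Defs.edist R d)]_(p in B `&` jumps) h p.
Proof.
move=> cA KA Af mB mh h0.
have mA : measurable (A : set (measurableTypeR R)).
  by apply: countable_measurable => //; exact: measurable_set1.
have mBJ : measurable (B `&` jumps) by apply: measurableI => //; exact: measurable_jumps.
have -> : \int[hausdorff1 (@Defs.edist R d)]_(p in B `&` jumps) h p =
    \int[M]_(p in B `&` jumps) h p.
  apply: eq_integral_set_function => S mS SBJ; rewrite jumps_fibers_measure//.
  exact: subset_trans SBJ (@subIsetr _ _ _).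
have rest_meas D : measurable D -> measurable_fun setT (h \_ D).
  by move=> mD; apply/(measurable_restrict _ mD measurableT); rewrite setTI; exact: measurable_funTS.
have rest_ge0 D p : 0 <= (h \_ D) p by apply: erestrict_ge0.
pose k D s := \int[unit_measure]_t (h \_ D) (lift_point (s, t)).
have mk D : measurable D -> measurable_fun setT (k D).
  move=> mD; apply: (@measurable_fun_fubini_tonelli_F _ _ _ _ _ unit_measure (fun p => (h \_ D) (lift_point p))).
    by apply: measurableT_comp measurable_lift_point; exact: rest_meas.
  by move=> p; exact: rest_ge0.
have k_ge0 D s : 0 <= k D s by apply: integral_ge0 => t _; exact: rest_ge0.
have kE D : measurable D -> \int[M]_(p in D) h p = \int[m]_s k D s.
  by move=> mD; rewrite integral_mkcond ME//; exact: rest_meas.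
rewrite kE// kE//.
have mCA : measurable (~` A : set (measurableTypeR R)) by exact: measurableC.
have mkT : measurable_fun (~` A `|` A) (k B) by apply: measurable_funTS; exact: mk.
have disjA : [disjoint ~` A & A] by rewrite disj_set_sym; exact/disj_setPCl.
rewrite -(setvU A) (ge0_integral_setU m mCA mA mkT (fun s _ => k_ge0 B s) disjA).
congr (_ + _).
  rewrite setDE setIC integral_mkcondr; apply: eq_integral => s /set_mem As.
  have ls t : lift_point (s, t) = (s, c s, f s).
    by rewrite /lift_point /lift_level /= Af//; congr (_, _); ring.
  rewrite /k; under eq_integral do rewrite ls.
  have -> r : \int[unit_measure]__ r = r.
    transitivity (r * unit_measure setT); first exact: (integral_cst _ measurableT).
    by rewrite unit_measureT mule1.
  by rewrite !patchE; congr (if _ then _ else _); apply/idP/idP => /set_mem ?; apply/mem_set.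
have kKJ s : K s -> k B s = k (B `&` jumps) s.
  move=> Ks; rewrite /k !integral_unit_measure//; last 2 first.
  - apply: measurableT_comp; first exact: rest_meas.
    by apply: (measurableT_comp measurable_lift_point); exact: measurable_pair1.
  - apply: measurableT_comp; first exact: rest_meas.
    by apply: (measurableT_comp measurable_lift_point); exact: measurable_pair1.
  apply: eq_integral => t /set_mem t01.
  rewrite !patchE; congr (if _ then _ else _).
  apply/idP/idP => /set_mem Bt; apply/mem_set; last by case: Bt.
  by split => //; apply/(level_between t Ks).
have kJ0 s : ~ K s -> k (B `&` jumps) s = 0.
  move=> nK; rewrite /k integral0_eq// => t _; rewrite patchE memNset//.
  by move=> [_ []].
transitivity (\int[m]_(s in K) k B s).
  have -> : K = A `\` (A `\` K) by rewrite setDD setIidr.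
  apply: ge0_negligible_integral => //.
  - by apply: measurableD => //; exact: mK.
  - by apply: measurable_funTS; exact: mk.
  - apply: countable_null; first exact: sub_countable (subset_card_le (@subDsetl _ _ _)) cA.
    by move=> t [_ /negP/negPn/eqP].
transitivity (\int[m]_(s in K) k (B `&` jumps) s).
  by apply: eq_integral => s /set_mem; exact: kKJ.
rewrite setvU; apply: eq_integral_support => //.
- by move=> s _ /(_ I).
- by move=> s _ ns; exact: kJ0.
Qed.

End jump_part.

End lift.

Section lift_bounds.
Local Open Scope ereal_scope.
Context {R : realType} (d : nat) (T : R) (f : R -> R)
  (P N : {finite_measure set (measurableTypeR R) -> \bar R}) (H : set R).
Hypothesis fPN : bv_jordan T f P N H.
Context (c : R -> 'rV[R]_d).
Hypothesis mc : measurable_fun [set: measurableTypeR R] (c : measurableTypeR R -> 'rV[R]_d).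
Notation X := (R * 'rV[R]_d * R)%type.

Lemma lift_level_bound (s t : R) : `]0%R, 1%R[%classic t ->
  (`|lift_level f P N s t| <= bv_bound f P N)%R.
Proof.
rewrite /= in_itv/= => /andP[t0 t1].
have := left_lim_bound fPN s; have := bv_boundP fPN s.
rewrite /lift_level !ler_norml => /andP[a1 a2] /andP[b1 b2].
by apply/andP; split; nra.
Qed.

Lemma lift_integral_le (m : {finite_measure set (measurableTypeR R) -> \bar R})
    (M : {finite_measure set X -> \bar R}) (h : X -> \bar R) (C : R) (B : set X) :
  (forall k : X -> \bar R, measurable_fun setT k -> (forall p, 0 <= k p) ->
    \int[M]_p k p = \int[m]_s \int[unit_measure]_t k (lift_point f P N c (s, t))) ->
  measurable B -> measurable_fun setT h -> (forall p, 0 <= h p) ->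
  (forall s t, `]0%R, 1%R[%classic t -> h (lift_point f P N c (s, t)) <= C%:E) ->
  \int[M]_(p in B) h p <= C%:E * m setT.
Proof.
move=> ME mB mh h0 hC.
apply: (@le_trans _ _ (\int[M]_p h p)).
  by apply: ge0_subset_integral.
rewrite ME// -integral_cst//.
have mhl : measurable_fun setT (h \o lift_point f P N c).
  exact: measurableT_comp mh (measurable_lift_point fPN mc).
apply: ge0_le_integral => //.
- by move=> s _; exact: integral_ge0.
- apply: (@measurable_fun_fubini_tonelli_F _ _ _ _ _ unit_measure (h \o lift_point f P N c)) => // p; exact: h0.
move=> s _; rewrite integral_unit_measure//; last exact: (measurableT_comp mhl (measurable_pair1 _)).
apply: (@le_trans _ _ (\int[lebesgue_measure]_(t in `]0%R, 1%R[) C%:E)).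
  apply: ge0_le_integral => //.
  - apply: measurable_funTS; exact: (measurableT_comp mhl (measurable_pair1 _)).
  - by move=> t t01; apply: le_trans (hC s t t01).
rewrite integral_cst//=.
by rewrite lebesgue_measure_itv/= lte_fin ltr01 -EFinB subr0 mule1.
Qed.

End lift_bounds.

Section smooth_real.
Context {R : realType}.

Lemma smooth_derive1 (eta : R -> R) : smooth eta -> smooth (derive1 eta).
Proof.
move=> se vs; have := se (rcons vs (1 : R)).
rewrite foldr_rcons (_ : 'D_1 eta = derive1 eta)//.
by apply/funext => x; rewrite derive1E.
Qed.

Lemma smooth_continuous (eta : R -> R) : smooth eta -> continuous eta.
Proof. by move=> /(_ [::])[]. Qed.

Lemma smooth_is_derive (eta : R -> R) : smooth eta ->
  forall x : R, is_derive x (1 : R) eta (derive1 eta x).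
Proof. by move=> /(_ [::])[_ de] x; rewrite derive1E; exact/derivableP. Qed.

End smooth_real.

(** This regroups the diffuse and the jump contributions by Jordan part; finiteness of the two sums
    excludes oo - oo. *)
Lemma fin_num_addeBACA {R : numDomainType} (a b c e : \bar R) :
  (a + b)%E \is a fin_num -> (c + e)%E \is a fin_num ->
  ((a - c) + (b - e) = (a + b) - (c + e))%E.
Proof.
by rewrite !fin_numD => /andP[a1 b1] /andP[c1 e1]; rewrite fin_num_oppeD// addeACA.
Qed.

Section curve_lift.
Local Open Scope ereal_scope.
Context {R : realType} (d : nat) (T : R).
Hypothesis T0 : (0 < T)%R.
Notation X := (R * 'rV[R]_d * R)%type.
Implicit Types (g : curve T d).

Definition position g (t : R) : 'rV[R]_d := (g t).1.
Definition level g (t : R) : R := (g t).2.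

Lemma position_out g t : ~ `[0%R, T[%classic t -> position g t = 0%R.
Proof. by move=> tT; rewrite /position curve_outside. Qed.

Lemma level_out g t : ~ `[0%R, T[%classic t -> level g t = 0%R.
Proof. by move=> tT; rewrite /level curve_outside. Qed.

Lemma measurable_position g :
  measurable_fun [set: measurableTypeR R] (position g : measurableTypeR R -> 'rV[R]_d).
Proof.
apply: measurable_fun_rVP => i.
have [P [N [H [h _ _]]]] := bv_jordan_exists (curve_BV1 g i) T0
  (fun t tT => etrans (congr1 (fun x : 'rV[R]_d * R => x.1 ord0 i) (curve_outside g tT))
     (mxE _ _ _ _)).
exact: (bv_measurable h).
Qed.

Definition lift_formula (f : R -> R) P N (c : R -> 'rV[R]_d)
    (m : {finite_measure set (measurableTypeR R) -> \bar R})
    (M : {finite_measure set X -> \bar R}) :=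
  forall k : X -> \bar R, measurable_fun setT k -> (forall p, 0 <= k p) ->
    \int[M]_p k p = \int[m]_s \int[unit_measure]_t k (lift_point f P N c (s, t)).

(** P and N being mutually singular, none of their atoms cancel in the signed derivative: its atoms
    are the discontinuities of [level g], the upward jumps lying over the atoms of P and the
    downward ones over those of N. The measures obtained depend neither on the entropy nor on the
    set. *)
Lemma curve_production_lift g :
  exists (P N : {finite_measure set (measurableTypeR R) -> \bar R}) (H : set R)
    (Mp Mn : {finite_measure set X -> \bar R}),
  [/\ bv_jordan T (level g) P N H,
      lift_formula (level g) P N (position g) P Mp,
      lift_formula (level g) P N (position g) N Mn &
      forall (eta : R -> R) (B : set X), smooth eta ->
        (forall v : R, (0 <= derive1n 2 eta v)%R) -> measurable B ->
        [/\ \int[Mp]_(p in B) (derive1n 2 eta p.2)%:E \is a fin_num,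
            \int[Mn]_(p in B) (derive1n 2 eta p.2)%:E \is a fin_num &
            curve_production eta g B =
              \int[Mp]_(p in B) (derive1n 2 eta p.2)%:E -
              \int[Mn]_(p in B) (derive1n 2 eta p.2)%:E]].
Proof.
have [P [N [H [fPN DE DI]]]] := bv_jordan_exists (curve_BV2 g) T0 (@level_out g).
have mc := measurable_position g.
have [Mp MpE] := lift_exists fPN mc P.
have [Mn MnE] := lift_exists fPN mc N.
exists P, N, H, Mp, Mn; split => // eta B seta eta0 mB.
set w := derive1n 2 eta.
have cw : continuous w by exact/smooth_continuous/smooth_derive1/smooth_derive1.
pose h (p : X) : \bar R := (w p.2)%:E.
have mh : measurable_fun setT h.
  apply/measurable_EFinP; apply: (measurableT_comp (continuous_measurable_fun cw)).
  exact: measurable_snd.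
have h0 p : 0 <= h p by rewrite lee_fin; exact: eta0.
pose b := bv_bound (level g) P N.
have [C wC] : exists C : R, forall v : R, (`|v| <= b)%R -> (w v <= C)%R.
  have [C _ CP] := continuous_bounded_ball b cw.
  by exists C => v /CP; exact: le_trans (ler_norm _).
have hC s t : `]0%R, 1%R[%classic t -> h (lift_point (level g) P N (position g) (s, t)) <= C%:E.
  by move=> t01; rewrite lee_fin; apply: wC; exact: (lift_level_bound fPN).
have fin m M : lift_formula (level g) P N (position g) m M ->
    \int[M]_(p in B) h p \is a fin_num.
  move=> ME; rewrite ge0_fin_numE ?integral_ge0//.
  apply: (le_lt_trans (lift_integral_le fPN mc ME mB mh h0 hC)).
  by rewrite -ge0_fin_numE ?fin_numM ?fin_num_measure// mule_ge0// ?lee_fin ?(le_trans _ (wC 0%R _)) ?normr0 ?(le_trans _ (bv_boundP fPN 0%R)).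
split; [exact: fin MpE|exact: fin MnE|].
pose A := atoms (derivative_of (curve_BV2 g)).
have m1 (t : R) : measurable ([set t] : set (measurableTypeR R)) by exact: measurable_set1.
have Dt t : (fine (P [set t]) - fine (N [set t]) = level g t - left_lim (level g) P N t)%R.
  by rewrite /left_lim; ring.
have AE t : A t <-> level g t != left_lim (level g) P N t.
  rewrite /A /atoms /= DE// -[P _]fineK ?fin_num_measure// -[N _]fineK ?fin_num_measure//.
  by rewrite -EFinB eqe Dt subr_eq0.
have P_pos t : P [set t] != 0 -> (left_lim (level g) P N t < level g t)%R /\
    P [set t] = (level g t - left_lim (level g) P N t)%:E.
  move=> Pt; have [h1 h2] := bv_atom fPN t; rewrite -subr_gt0.
  by have [/h2[P0]|fl] := leP (level g t - left_lim (level g) P N t)%R 0%R;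
    [rewrite P0 eqxx in Pt|split => //; case: (h1 (ltW fl))].
have N_pos t : N [set t] != 0 -> (level g t < left_lim (level g) P N t)%R /\
    N [set t] = (left_lim (level g) P N t - level g t)%:E.
  move=> Nt; have [h1 h2] := bv_atom fPN t; rewrite -subr_lt0.
  by have [/h1[_ N0]|fl] := leP 0%R (level g t - left_lim (level g) P N t)%R;
    [rewrite N0 eqxx in Nt|split => //; case: (h2 (ltW fl))].
have PA : [set t | P [set t] != 0] `<=` A.
  by move=> t /P_pos[+ _]; move=> lt; apply/AE; rewrite gt_eqF.
have NA : [set t | N [set t] != 0] `<=` A.
  by move=> t /N_pos[+ _]; move=> lt; apply/AE; rewrite lt_eqF.
have cA : countable A.
  have cPN : countable (\bigcup_(b in [set: bool])
      (if b then [set t | P [set t] != 0] else [set t | N [set t] != 0])).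
    by apply: bigcup_countable => // -[] _; exact: countable_atoms.
  apply: sub_countable cPN; apply: subset_card_le => t /AE; rewrite -subr_eq0 -Dt => h0'.
  have [P0|] := eqVneq (P [set t]) 0; last by exists true.
  exists false => //=; apply: contra h0' => /eqP N0; rewrite P0 N0 /= subrr; exact: eqxx.
have Af s : ~ A s -> left_lim (level g) P N s = level g s.
  by move=> /AE/negP/negPn/eqP.
have P_atom t : P [set t] != 0 -> P [set t] = `|level g t - left_lim (level g) P N t|%:E.
  by move=> /P_pos[lt ->]; rewrite gtr0_norm// subr_gt0.
have N_atom t : N [set t] != 0 -> N [set t] = `|level g t - left_lim (level g) P N t|%:E.
  by move=> /N_pos[lt ->]; rewrite distrC gtr0_norm// subr_gt0.
have in0T (m : {finite_measure set (measurableTypeR R) -> \bar R}) t :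
    m (~` `]0%R, T[) = 0 -> m [set t] != 0 -> `]0%R, T[%classic t.
  move=> m0; apply: contraPP => tT; apply/negP/negPn/eqP; apply: subset_measure0 m0 => //.
    by apply: measurableC; exact: measurable_itv.
  by move=> _ ->.
have leftE t : `]0%R, T[%classic t -> left_value g t = left_lim (level g) P N t.
  rewrite /= in_itv/= => /andP[t0 tT]; apply: cvg_lim => //; apply/cvg_at_leftP => u [ut ucvg].
  exact: (bv_left_cvg fPN t0 tT ut ucvg).
have rightE t : `]0%R, T[%classic t -> right_value g t = level g t.
  move=> /= /itvP tT; apply: cvg_lim => //; have [_ _ rc] := curve_BV2 g.
  by apply: rc; rewrite /= in_itv/= !tT.
have upE : jump_up g = jumps (level g) P N (position g) P.
  apply/seteqP; split => [p [tT gp lt /andP[]]|p [mp gp]].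
    rewrite leftE// rightE// in lt *; move=> v1 v2.
    have Pt : P [set p.1.1] != 0.
      have dl : (0 < level g p.1.1 - left_lim (level g) P N p.1.1)%R by rewrite subr_gt0.
      by have [-> _] := (bv_atom fPN p.1.1).1 (ltW dl); rewrite eqe gt_eqF.
    by split => //; rewrite (min_idPl (ltW lt)) (max_idPr (ltW lt)) v1.
  have [lt _] := P_pos _ mp; have tT := in0T _ _ (bvj_PT fPN) mp.
  rewrite (min_idPl (ltW lt)) (max_idPr (ltW lt)) => v12.
  by split => //; rewrite leftE// rightE.
have downE : jump_down g = jumps (level g) P N (position g) N.
  apply/seteqP; split => [p [tT gp lt /andP[]]|p [mp gp]].
    rewrite leftE// rightE// in lt *; move=> v1 v2.
    have Pt : N [set p.1.1] != 0.
      have dl : (level g p.1.1 - left_lim (level g) P N p.1.1 < 0)%R by rewrite subr_lt0.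
      by have [_ ->] := (bv_atom fPN p.1.1).2 (ltW dl); rewrite eqe gt_eqF// subr_gt0.
    by split => //; rewrite (min_idPr (ltW lt)) (max_idPl (ltW lt)) v1.
  have [lt _] := N_pos _ mp; have tT := in0T _ _ (bvj_NT fPN) mp.
  rewrite (min_idPr (ltW lt)) (max_idPl (ltW lt)) => v12.
  by split => //; rewrite leftE// rightE.
have Pp := lift_split fPN mc P_atom MpE cA PA Af mB mh h0.
have Nn := lift_split fPN mc N_atom MnE cA NA Af mB mh h0.
have finP := fin _ _ MpE; have finN := fin _ _ MnE.
rewrite Pp in finP *; rewrite Nn in finN *.
rewrite /curve_production /pushforward DI -upE -downE -/A.
rewrite -upE in finP; rewrite -downE in finN.
exact: (fin_num_addeBACA finP finN).
Qed.

End curve_lift.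

Section slope.
Context {R : realType} (w : R -> R).
Hypotheses (cw : continuous w) (w0 : forall x : R, 0 <= w x).

(* The mean of w over [a, b], which makes sense also for a = b. *)
Definition slope (a b : R) : R := (\int[unit_measure]_t w ((1 - t) * a + t * b))%R.

Let I01 : set (measurableTypeR R) := `]0, 1[.

Let mw a b : measurable_fun [set: measurableTypeR R]
  (fun t : measurableTypeR R => w ((1 - t) * a + t * b)).
Proof.
apply: continuous_measurable_fun => t; apply: continuous_comp; last exact: cw.
apply: cvgD; apply: cvgM; try exact: cvg_cst; last exact: cvg_id.
by apply: cvgB; [exact: cvg_cst|exact: cvg_id].
Qed.

Lemma slope_integrable a b : unit_measure.-integrable setT
  (EFin \o (fun t : measurableTypeR R => w ((1 - t) * a + t * b))).
Proof.
apply/integrableP; split; first by apply/measurable_EFinP; exact: mw.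
under eq_integral do rewrite /= ger0_norm//.
rewrite integral_unit_measure//; last 2 first.
- by apply/measurable_EFinP; exact: mw.
- by move=> t; rewrite lee_fin.
have /integrableP[_] : lebesgue_measure.-integrable `]0%R, 1%R[ (EFin \o (fun t : R => w ((1 - t) * a + t * b))).
  suff iw : lebesgue_measure.-integrable `[0%R, 1%R] (EFin \o (fun t : R => w ((1 - t) * a + t * b))).
    by apply: integrableS iw => //; exact: subset_itv_oo_cc.
  apply: continuous_compact_integrable; first exact: segment_compact.
  apply: continuous_subspaceT => t; apply: continuous_comp; last exact: cw.
  apply: cvgD; apply: cvgM; try exact: cvg_cst; last exact: cvg_id.
  by apply: cvgB; [exact: cvg_cst|exact: cvg_id].
by under eq_integral do rewrite /= ger0_norm//.
Qed.

Lemma slope_increment (W : R -> R) a b : (forall x : R, is_derive x (1 : R) W (w x)) ->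
  slope a b * (b - a) = W b - W a.
Proof. by move=> dW; exact: unit_interval_slope. Qed.

Lemma slope_ge0 a b : 0 <= slope a b.
Proof. by apply: Rintegral_ge0. Qed.

(** For t in (0, 1) the integrand is evaluated at convex combinations of a and b, which inherit the
    bounds on a and b. *)
Let slopeE a b : slope a b = (\int[unit_measure]_(t in I01) w ((1 - t) * a + t * b))%R.
Proof.
rewrite /slope /Rintegral (@ge0_negligible_integral _ _ _ unit_measure setT (~` I01))//.
- by rewrite setTD setCK.
- by apply: measurableC; exact: measurable_itv.
- by apply/measurable_EFinP; exact: mw.
- by move=> t _; rewrite lee_fin.
- rewrite /=; transitivity (@lebesgue_measure R (~` I01 `&` I01)); first by [].
  by rewrite setICl measure0.
Qed.

Let seg_bound (M a b t : R) : `|a| <= M -> `|b| <= M -> I01 t ->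
  `|(1 - t) * a + t * b| <= M.
Proof.
rewrite /I01 /= in_itv/= !ler_norml => /andP[a1 a2] /andP[b1 b2] /andP[t0 t1].
by apply/andP; split; nra.
Qed.

Lemma slope_le (M C a b : R) : (forall v, `|v| <= M -> w v <= C) ->
  `|a| <= M -> `|b| <= M -> slope a b <= C.
Proof.
move=> wC aM bM; rewrite slopeE.
have mI : measurable I01 by exact: measurable_itv.
have -> : C = (\int[unit_measure]_(t in I01) C)%R.
  rewrite Rintegral_cst//.
  transitivity (C * fine (@lebesgue_measure R (I01 `&` I01)))%R; last by [].
  by rewrite setIid lebesgue_measure_itv/= lte_fin ltr01 -EFinB subr0 mulr1.
apply: le_Rintegral => //.
- apply: (@bounded_integrable _ _ _ _ _ _ C) => //.
    exact: measurable_funTS.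
  by move=> t It; rewrite ger0_norm//; apply: wC; exact: seg_bound.
- exact: (@bounded_integrable _ _ _ _ _ _ `|C|).
- by move=> t It; apply: wC; exact: seg_bound.
Qed.

Lemma slope_cvg (M : R) (u v : R^nat) (a b : R) : (forall n, `|u n| <= M) ->
  (forall n, `|v n| <= M) -> u @ \oo --> a -> v @ \oo --> b ->
  slope (u n) (v n) @[n --> \oo] --> slope a b.
Proof.
move=> uM vM ua vb; under eq_fun do rewrite slopeE; rewrite slopeE.
have [K _ KP] := continuous_bounded_ball M cw.
apply: (@bounded_cvg_Rintegral _ _ _ _ I01 (fun n t => w ((1 - t) * u n + t * v n)) _ K) => //.
- exact: measurable_itv.
- by move=> n; apply: measurable_funTS; exact: mw.
- move=> t It; apply: continuous_cvg; first exact: cw.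
  by apply: cvgD; apply: cvgM => //; exact: cvg_cst.
- by move=> n t It; apply: KP; exact: seg_bound.
Qed.

End slope.

(** * Riemann sums *)

Section grid.
Context {R : realType} (T : R).
Hypothesis T0 : 0 < T.

(** The sums use the indices up to [n] only, whose points stay below T: curves are set to 0 from T
    on, and a grid reaching T would record a jump there. *)
Definition grid (n i : nat) : R := i%:R * T / n.+1%:R.

Lemma grid_ge0 n i : 0 <= grid n i.
Proof. by rewrite /grid divr_ge0// mulr_ge0// ltW. Qed.

Lemma grid_ltT n i : (i <= n)%N -> grid n i < T.
Proof.
by move=> ni; rewrite /grid ltr_pdivrMr// mulrC ltr_pM2l// ltr_nat ltnS.
Qed.

Lemma grid_lt n i j : (grid n i < grid n j) = (i < j)%N.
Proof. by rewrite /grid ltr_pM2r ?invr_gt0// ltr_pM2r// ltr_nat. Qed.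

Lemma grid_le n i j : (grid n i <= grid n j) = (i <= j)%N.
Proof. by rewrite leNgt grid_lt -leqNgt. Qed.

Lemma grid_step n i : grid n i.+1 - grid n i = T / n.+1%:R.
Proof. by rewrite /grid -[i.+1]addn1 natrD; field; rewrite addrC natr1 pnatr_eq0. Qed.

(** Cells are open on the left and closed on the right. Left endpoints thus approach s strictly from
    below, giving the left limit, and right endpoints from above or at s, giving the
    right-continuous value. *)
Lemma grid_cell (s : R) : 0 < s ->
  exists k : nat -> nat, forall n, grid n (k n) < s <= grid n (k n).+1.
Proof.
move=> s0; suff /choice[k kP] : forall n, exists k, is_true (grid n k < s <= grid n k.+1) by exists k.
move=> n.
pose P k := s <= grid n k.
have exP : exists k, P k.
  exists (Num.truncn (s * n.+1%:R / T)).+1.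
  rewrite /P /grid ler_pdivlMr// -ler_pdivrMr//; apply/ltW.
  by apply: truncnS_gt.
have := ex_minnP exP; case: ex_minnP => m Pm mP _.
case: m Pm mP => [|m] Pm mP; first by move: Pm; rewrite /P /grid mul0r mul0r leNgt s0.
exists m; rewrite [X in _ && X]Pm andbT ltNge; apply/negP => /mP.
by rewrite ltnn.
Qed.


Lemma grid_cell_cvgl (s : R) (k : nat -> nat) :
  (forall n, grid n (k n) < s <= grid n (k n).+1) -> grid n (k n) @[n --> \oo] --> s.
Proof.
move=> ks.
apply: (@squeeze_cvgr _ _ _ _ (fun n => s - T / n.+1%:R) (fun=> s)).
- apply: nearW => n; have /andP[k1 k2] := ks n; have := grid_step n (k n).
  by move=> e; rewrite -e (ltW k1) andbT; lra.
- rewrite -[X in _ --> X]subr0 -(mulr0 T); apply: cvgB; first exact: cvg_cst.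
  by apply: cvgM; [exact: cvg_cst|exact: cvg_harmonic].
- exact: cvg_cst.
Qed.

Lemma grid_cell_cvgr (s : R) (k : nat -> nat) :
  (forall n, grid n (k n) < s <= grid n (k n).+1) -> grid n (k n).+1 @[n --> \oo] --> s.
Proof.
move=> ks.
apply: (@squeeze_cvgr _ _ _ _ (fun=> s) (fun n => s + T / n.+1%:R)).
- apply: nearW => n; have /andP[k1 k2] := ks n; have := grid_step n (k n).
  by move=> e; rewrite -e k2/=; lra.
- exact: cvg_cst.
- rewrite -[X in _ --> X]addr0 -(mulr0 T); apply: cvgD; first exact: cvg_cst.
  by apply: cvgM; [exact: cvg_cst|exact: cvg_harmonic].
Qed.

Lemma grid_cell_lt (s : R) (k : nat -> nat) : s < T ->
  (forall n, grid n (k n) < s <= grid n (k n).+1) -> \forall n \near \oo, (k n < n)%N.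
Proof.
move=> sT ks.
have h : grid n (k n).+1 @[n --> \oo] --> s by exact: grid_cell_cvgr.
have h2 : T / n.+1%:R @[n --> \oo] --> (0 : R).
  by rewrite -(mulr0 T); apply: cvgM; [exact: cvg_cst|exact: cvg_harmonic].
near=> n.
have : grid n (k n).+1 + T / n.+1%:R < T.
  near: n; apply: (@cvgr_lt _ _ _ _ _ s) => //.
  by rewrite -[X in _ --> X]addr0; exact: cvgD.
rewrite -(grid_step n (k n).+1) addrC subrK.
rewrite /grid ltr_pdivrMr// mulrC ltr_pM2l// ltr_nat => /ltnW.
Unshelve. all: by end_near. Qed.

Definition step_function (a : nat -> R) (n : nat) (s : measurableTypeR R) : R :=
  \sum_(i < n) a i * \1_(`]grid n i, grid n i.+1] : set R) s.

Lemma measurable_step_function a n : measurable_fun setT (step_function a n).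
Proof.
rewrite /step_function; apply: measurable_sum => i; exact: measurable_funM.
Qed.

Lemma step_function_cell a n k (s : R) : grid n k < s <= grid n k.+1 ->
  step_function a n s = if (k < n)%N then a k else 0.
Proof.
move=> /andP[ks sk].
have out i : i != k -> \1_(`]grid n i, grid n i.+1] : set R) s = 0 :> R.
  move=> ik; rewrite indicE memNset //= in_itv/= => /andP[is' si].
  have : (i < k.+1)%N by rewrite -(grid_lt n) (lt_le_trans is').
  have : (k < i.+1)%N by rewrite -(grid_lt n) (lt_le_trans ks).
  by rewrite !ltnS => ki ik'; move: ik; rewrite eqn_leq ki ik'.
rewrite /step_function; case: ifPn => kn.
  rewrite (bigD1 (Ordinal kn))//= [X in _ + X]big1 ?addr0 => [|i ik].
    by rewrite indicE mem_set ?mulr1//= in_itv/= ks.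
  by rewrite out ?mulr0//; apply: contra ik => /eqP ik; exact/eqP/val_inj.
rewrite big1// => i _; rewrite out ?mulr0//.
by apply: contraNneq kn => <-.
Qed.

Lemma step_function_out a n s : ~ `]0%R, T[%classic s -> step_function a n s = 0.
Proof.
move=> sT; rewrite /step_function big1// => i _; rewrite indicE memNset ?mulr0//.
rewrite /= in_itv/= => /andP[s1 s2]; apply: sT; rewrite /= in_itv/=.
by rewrite (le_lt_trans (grid_ge0 n i) s1) (le_lt_trans s2)// grid_ltT.
Qed.

Lemma step_function_le a n C s : 0 <= C -> (forall i, `|a i| <= C) -> `|step_function a n s| <= C.
Proof.
move=> C0 aC; have [|/step_function_out ->] := pselect (`]0%R, T[%classic s); last by rewrite normr0.
rewrite /= in_itv/= => /andP[s0 _]; have [k kP] := grid_cell s0.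
by rewrite (step_function_cell _ (kP n)); case: ifP; rewrite ?normr0.
Qed.

Lemma step_function_cvg (a : nat -> nat -> R) (s l : R) : 0 < s -> s < T ->
  (forall k : nat -> nat, (forall n, grid n (k n) < s <= grid n (k n).+1) ->
    a n (k n) @[n --> \oo] --> l) ->
  step_function (a n) n s @[n --> \oo] --> l.
Proof.
move=> s0 sT al; have [k kP] := grid_cell s0.
apply: cvg_trans (al k kP); apply: near_eq_cvg; near=> n.
by rewrite (step_function_cell _ (kP n)) ifT//; near: n; exact: grid_cell_lt kP.
Unshelve. all: by end_near. Qed.

End grid.

Section riemann_sums.
Context {R : realType} (T : R) (f : R -> R)
  (P N : {finite_measure set (measurableTypeR R) -> \bar R}) (H : set R).
Hypothesis fPN : bv_jordan T f P N H.
Context (w : R -> R).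
Hypotheses (cw : continuous w) (w0 : forall x : R, 0 <= w x).
Context (psi : R -> R) (K : R).
Hypotheses (psiK : forall t, `|psi t| <= K)
  (psi_rc : forall s (u : R^nat), 0 < s -> s < T -> (forall n, s <= u n) ->
     u @ \oo --> s -> psi (u n) @[n --> \oo] --> psi s).

(* The last factors multiply to the increment of a primitive of w. *)
Definition riemann_sum (n : nat) : R :=
  \sum_(i < n) psi (grid T n i.+1) * (slope w (f (grid T n i)) (f (grid T n i.+1)) *
    (f (grid T n i.+1) - f (grid T n i))).

Let a n (i : nat) := psi (grid T n i.+1) * slope w (f (grid T n i)) (f (grid T n i.+1)).

Let cell n i : set (measurableTypeR R) := `]grid T n i, grid T n i.+1].

Let stepfun n := step_function T (a n) n.

Let M := bv_bound f P N.

Let wC : exists2 C : R, 0 <= C & forall v : R, `|v| <= M -> w v <= C.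
Proof.
have [C C0 CP] := continuous_bounded_ball M cw.
by exists C => [|v /CP]; [exact: ltW|exact: le_trans (ler_norm _)].
Qed.

(** The increment of [f] over a cell is the difference of its masses under P and N, so each sum is
    an integral of a step function against both. At s the two endpoint values tend to the left limit
    and to the value, so that [slope] tends to the mean of [w] over the jump, or to [w] itself at a
    point of continuity; convergence is bounded. *)
Lemma riemann_sum_cvg : riemann_sum n @[n --> \oo] -->
  (\int[P]_(s in `]0%R, T[) (psi s * slope w (left_lim f P N s) (f s)) -
   \int[N]_(s in `]0%R, T[) (psi s * slope w (left_lim f P N s) (f s)))%R.
Proof.
have T0 := bvj_T fPN.
have mstep n : measurable_fun [set: measurableTypeR R] (stepfun n) by exact: measurable_step_function.
have mT : measurable (`]0, T[ : set (measurableTypeR R)) by exact: measurable_itv.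
have sumE (m : {finite_measure set (measurableTypeR R) -> \bar R}) n :
    (\int[m]_(s in `]0%R, T[) stepfun n s = \sum_(i < n) a n i * fine (m (cell n i)))%R.
  have -> : (\int[m]_(s in `]0%R, T[) stepfun n s = \int[m]_s stepfun n s)%R.
    rewrite [LHS]Rintegral_mkcond; apply: eq_Rintegral => s _; rewrite patchE.
    by case: ifPn => // /negP sT; rewrite /stepfun step_function_out// => h; apply: sT; exact: mem_set.
  have inti i : m.-integrable setT (EFin \o (fun s => a n i * \1_(cell n i) s)).
    apply: (@bounded_integrable _ _ _ _ _ _ `|a n i|) => //.
      by apply: measurable_funM => //; apply: measurable_indic; exact: measurable_itv.
    move=> s _; rewrite normrM ler_piMr// indicE; case: (_ \in _); rewrite ?normr1 ?normr0//.
  have Ei i : (\int[m]_s (a n i * \1_(cell n i) s) = a n i * fine (m (cell n i)))%R.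
    rewrite RintegralZl//; last first.
      apply: (@bounded_integrable _ _ _ _ _ _ 1) => //.
        by apply: measurable_indic; exact: measurable_itv.
      by move=> s _; rewrite indicE; case: (_ \in _); rewrite ?normr1 ?normr0.
    have mc : measurable (cell n i) by exact: measurable_itv.
    by rewrite /Rintegral integral_indic// setIT.
  rewrite /Rintegral /stepfun /step_function.
  under eq_integral do rewrite -sumEFin.
  rewrite (@integral_sum _ _ _ m setT measurableT 'I_n (fun i s => (a n i * \1_(cell n i) s)%:E))//; last by move=> i; exact: inti.
  rewrite (eq_bigr (fun i : 'I_n => (a n i * fine (m (cell n i)))%:E)) ?sumEFin//.
  move=> i _; rewrite -Ei /Rintegral fineK//; apply: integrable_fin_num => //; exact: inti.
have sum_increment n : riemann_sum n =
    (\int[P]_(s in `]0%R, T[) stepfun n s - \int[N]_(s in `]0%R, T[) stepfun n s)%R.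
  rewrite !sumE -sumrB; apply: eq_bigr => i _.
  rewrite -mulrBr /a -mulrA; congr (_ * (_ * _)).
  apply: (bvj_inc fPN); first exact: grid_ge0.
    by rewrite grid_le.
  by rewrite grid_ltT.
have [C C0 CM] := wC.
have Kge0 : 0 <= K by exact: le_trans (psiK 0).
rewrite (_ : riemann_sum = fun n => (\int[P]_(s in `]0%R, T[) stepfun n s -
   \int[N]_(s in `]0%R, T[) stepfun n s)%R); last exact/funext.
have lim (m : {finite_measure set (measurableTypeR R) -> \bar R}) :
    (\int[m]_(s in `]0%R, T[) stepfun n s @[n --> \oo] -->
     \int[m]_(s in `]0%R, T[) (psi s * slope w (left_lim f P N s) (f s)))%R.
  apply: (@bounded_cvg_Rintegral _ _ _ _ _ stepfun _ (K * C)) => //.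
  - by move=> n; apply: measurable_funTS.
  - move=> s; rewrite /= in_itv/= => /andP[s0 sT].
    apply: step_function_cvg => // k kP; apply: cvgM.
      apply: psi_rc => //; last exact: grid_cell_cvgr.
      by move=> n; have /andP[] := kP n.
    apply: (@slope_cvg _ _ cw w0 M) => [n|n||].
    + exact: (bv_boundP fPN).
    + exact: (bv_boundP fPN).
    + apply: (bv_left_cvg fPN) => //; last exact: grid_cell_cvgl.
      by move=> n; have /andP[] := kP n.
    + apply: (bv_right_cvg fPN); last exact: grid_cell_cvgr.
        by rewrite /= in_itv/= (ltW s0).
      by move=> n; have /andP[] := kP n.
  - move=> n s _; apply: step_function_le => // [|i]; first exact: mulr_ge0.
    rewrite normrM ler_pM// ger0_norm; last exact: slope_ge0.
    by apply: (slope_le cw w0 CM); exact: (bv_boundP fPN).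
exact: cvgB.
Qed.

End riemann_sums.

(** * Masses of the Jordan parts are bounded by variation sums along grids *)

Section continuous_approximation.
Context {R : realType} (m : {finite_measure set (measurableTypeR R) -> \bar R}).

Definition unit_continuous (psi : R -> R) :=
  continuous psi /\ forall x, 0 <= psi x <= 1.

Let approximable (A : set (measurableTypeR R)) := measurable A /\
  forall e, 0 < e -> exists2 psi : R -> R, unit_continuous psi &
    (\int[m]_x `|psi x - \1_A x| < e)%R.

Let measurable_uc psi : unit_continuous psi ->
  measurable_fun [set: measurableTypeR R] (psi : measurableTypeR R -> R).
Proof. by move=> [cp _]; exact: continuous_measurable_fun. Qed.

Let indic01 (A : set R) x : 0 <= (\1_A x : R) <= 1.
Proof. by rewrite indicE; case: (_ \in _); rewrite ?ler01 ?lexx. Qed.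

Let integrable_diff (f g : R -> R) :
  measurable_fun [set: measurableTypeR R] (f : measurableTypeR R -> R) ->
  measurable_fun [set: measurableTypeR R] (g : measurableTypeR R -> R) ->
  (forall x, 0 <= f x <= 1) -> (forall x, 0 <= g x <= 1) ->
  m.-integrable setT (EFin \o (fun x => `|f x - g x|)).
Proof.
move=> mf mg f1 g1; apply: (@bounded_integrable _ _ _ _ _ _ 1) => //.
  by apply: (measurableT_comp (@normr_measurable _ _)); exact: measurable_funB.
move=> x _; rewrite normr_id ler_norml.
have /andP[] := f1 x; have /andP[] := g1 x => a b c e; apply/andP; split; lra.
Qed.

Let approximable_lim (A : set (measurableTypeR R)) (g : nat -> R -> R) : measurable A ->
  (forall n, measurable_fun [set: measurableTypeR R] (g n : measurableTypeR R -> R)) ->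
  (forall n x, 0 <= g n x <= 1) ->
  (forall n e, 0 < e -> exists2 psi : R -> R, unit_continuous psi &
    (\int[m]_x `|psi x - g n x| < e)%R) ->
  (forall x, g n x @[n --> \oo] --> (\1_A x : R)) -> approximable A.
Proof.
move=> mA mg g1 ag gA; split => // e e0.
have mI : measurable_fun [set: measurableTypeR R] (\1_A : measurableTypeR R -> R).
  exact: measurable_indic.
have lim0 : (\int[m]_x `|g n x - \1_A x| @[n --> \oo] --> \int[m]_(x in setT) (cst 0 x : R))%R.
  apply: (@bounded_cvg_Rintegral _ _ _ m setT (fun n x => `|g n x - \1_A x|) (cst 0) 1) => //.
  - by move=> n; apply: (measurableT_comp (@normr_measurable _ _)); exact: measurable_funB.
  - move=> x _; rewrite [cst 0 x](_ : _ = `|\1_A x - \1_A x : R|); last by rewrite subrr normr0.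
    by apply: cvg_norm; apply: cvgB; [exact: gA|exact: cvg_cst].
  - move=> n x _; rewrite normr_id ler_norml.
    have /andP[] := g1 n x; have /andP[] := indic01 A x => a b c h; apply/andP; split; lra.
rewrite Rintegral_cst// mul0r in lim0.
have e2 : 0 < e / 2 by rewrite divr_gt0.
have [n ne] : exists n, (\int[m]_x `|g n x - \1_A x| < e / 2)%R.
  have /cvgr_lt/(_ _ e2) [n _ nP] := lim0.
  by exists n; exact: (nP n (leqnn n)).
have [psi cpsi psie] := ag n _ e2.
exists psi => //; rewrite [e]splitr; apply: le_lt_trans (ltrD psie ne).
have [cp p1] := cpsi.
have mp := measurable_uc cpsi.
rewrite -RintegralD//; try exact: integrable_diff.
apply: le_Rintegral => //; first exact: integrable_diff.
  by apply: integrableD_EFin => //; exact: integrable_diff.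
by move=> x _; rewrite (le_trans _ (ler_normD _ _))// addrA subrK.
Qed.

Let approximableE A : approximable A -> forall e, 0 < e ->
  exists2 psi : R -> R, unit_continuous psi & (\int[m]_x `|psi x - \1_A x| < e)%R.
Proof. by case. Qed.

Let approximableU A B : approximable A -> approximable B -> approximable (A `|` B).
Proof.
move=> [mA aA] [mB aB]; split; first exact: measurableU.
move=> e e0; have e2 : 0 < e / 2 by rewrite divr_gt0.
have [p [cp p1] pe] := aA _ e2; have [q [cq q1] qe] := aB _ e2.
have uc : unit_continuous (fun x => Num.max (p x) (q x)).
  split => [x|x]; first by apply: continuous_max; [exact: cp|exact: cq].
  have /andP[p0 pp] := p1 x; have /andP[q0 qq] := q1 x.
  by rewrite le_max p0 ge_max pp qq.
exists (fun x => Num.max (p x) (q x)) => //.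
have mI C : measurable C -> measurable_fun [set: measurableTypeR R] (\1_C : measurableTypeR R -> R).
  by move=> mC; exact: measurable_indic.
have mp : measurable_fun [set: measurableTypeR R] (p : measurableTypeR R -> R).
  exact: measurable_uc.
have mq : measurable_fun [set: measurableTypeR R] (q : measurableTypeR R -> R).
  exact: measurable_uc.
rewrite [e]splitr; apply: le_lt_trans (ltrD pe qe).
have iA := integrable_diff mp (mI _ mA) p1 (indic01 A).
have iB := integrable_diff mq (mI _ mB) q1 (indic01 B).
rewrite -RintegralD//; apply: le_Rintegral => //.
- apply: integrable_diff => //; first exact: measurable_uc.
  by apply: mI; exact: measurableU.
  by have [] := uc.
- exact: integrableD_EFin.
move=> x _; have /andP[p0 pp] := p1 x; have /andP[q0 qq] := q1 x.
rewrite !indicE in_setU; case: (x \in A); case: (x \in B) => /=;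
  rewrite ?subr0 ?(distrC _ 1) !ger0_norm ?subr_ge0 ?ge_max ?pp ?qq ?le_max ?p0 ?q0//;
  rewrite ?lerBlDr; case: (leP (p x) (q x)); lra.
Qed.

(** The approximable sets form a sigma-algebra containing the half-open intervals: complements by 1
    - psi, finite unions by maxima, and countable unions as limits of finite ones. *)
Lemma continuous_approximation (A : set (measurableTypeR R)) : measurable A ->
  forall e, 0 < e -> exists2 psi : R -> R, unit_continuous psi &
    (\int[m]_x `|psi x - \1_A x| < e)%R.
Proof.
move=> mA; apply: approximableE; move: A mA.
have a0 : approximable set0.
  split => // e e0; exists (cst 0); first by split; [move=> x; exact: cvg_cst|move=> x; rewrite lexx ler01].
  under eq_Rintegral do rewrite indic0 subrr normr0.
  by rewrite Rintegral_cst// mul0r.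
apply: smallest_sub.
- split => // [A [mA aA]|F aF].
    split => [|e e0]; first by rewrite setTD; exact: measurableC.
    have [p [cp p1] pe] := aA _ e0; exists (fun x => 1 - p x).
      split => x; first by apply: cvgB; [exact: cvg_cst|exact: cp].
      by have /andP[] := p1 x; move=> a b; apply/andP; split; lra.
    rewrite (_ : (\int[m]_x _)%R = (\int[m]_x `|p x - \1_A x|)%R)//.
    apply: eq_Rintegral => x _; rewrite setTD !indicE in_setC.
    by case: (x \in A); rewrite /= ?subr0 -1?normrN ?opprB; congr (`| _ |); ring.
  pose G n := \big[setU/set0]_(i < n) F i.
  have aG n : approximable (G n).
    rewrite /G; elim: n => [|n IH]; first by rewrite big_ord0.
    by rewrite big_ord_recr; exact: approximableU.
  apply: (@approximable_lim _ (fun n => \1_(G n))).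
  - by apply: bigcup_measurable => n _; have [] := aF n.
  - by move=> n; apply: measurable_indic; have [] := aG n.
  - by move=> n x; exact: indic01.
  - by move=> n; have [] := aG n.
  - move=> x; rewrite indicE; have [/set_mem[n _ Fn]|nF] := boolP (x \in _).
      apply: cvg_near_cst; near=> k; rewrite indicE mem_set//.
      rewrite /G -bigcup_mkord; exists n => //=.
      by near: k; exact: nbhs_infty_gt.
    apply: cvg_near_cst; apply: nearW => k; rewrite indicE memNset//.
    rewrite /G -bigcup_mkord => -[n _ Fn].
    by move/negP: nF; apply; apply: mem_set; exists n.
move=> _ [[a b] _ <-] /=.
(* A product instead of the difference in [step_window]: it stays in [0, 1] even when b < a. *)
pose psi n (x : R) : R := step (n.+1%:R * (x - a)) * (1 - step (n.+1%:R * (x - b))).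
have cstep c n : continuous (fun x : R => step (n.+1%:R * (x - c)) : R).
  by move=> x; exact/differentiable_continuous/elementary_diff/elementary_stepR.
have psi_uc n : unit_continuous (psi n).
  split => x.
    by apply: cvgM; [exact: cstep|apply: cvgB; [exact: cvg_cst|exact: cstep]].
  have := step_ge0 (n.+1%:R * (x - a)); have := step_le1 (n.+1%:R * (x - a)).
  have := step_ge0 (n.+1%:R * (x - b)); have := step_le1 (n.+1%:R * (x - b)).
  by rewrite /psi => ? ? ? ?; apply/andP; split; nra.
apply: (@approximable_lim _ psi).
- exact: measurable_itv.
- by move=> n; exact: measurable_uc.
- by move=> n; have [] := psi_uc n.
- move=> n e e0; exists (psi n) => //.
  under eq_Rintegral do rewrite subrr normr0.
  by rewrite Rintegral_cst// mul0r.
move=> x; rewrite (_ : \1_(`]a, b]) x = \1_(`]a, +oo[) x * (1 - \1_(`]b, +oo[) x) :> R).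
  apply: cvgM; first exact: step_dilation_cvg.
  by apply: cvgB; [exact: cvg_cst|exact: step_dilation_cvg].
rewrite !indicE !mem_setE !in_itv/= !andbT leNgt.
by case: (a < x) => /=; case: (b < x) => /=; ring.
Unshelve. all: by end_near. Qed.

End continuous_approximation.

(* Sums over a fixed sequence of grids, unlike Tot_Var, are measurable functions of
   the curve. *)
Definition variation_sum (R : realType) (T : R) (f : R -> R) (n : nat) : R :=
  \sum_(i < n) `|f (grid T n i.+1) - f (grid T n i)|.

Lemma variation_sum_le_Tot_Var (R : realType) (T : R) (f : R -> R) n : 0 < T ->
  ((variation_sum T f n)%:E <= Tot_Var T f)%E.
Proof.
move=> T0; pose b := grid T n n.
pose s := mkseq (fun i => grid T n i.+1) n.
have nthE i : (i <= n)%N -> nth b (0 :: s) i = grid T n i.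
  case: i => [|i] ni; first by rewrite /grid !mul0r.
  by rewrite /= nth_mkseq.
have ps : itv_partition 0 b s.
  split; last first.
    by rewrite (last_nth b) size_mkseq nthE.
  apply/(pathP b) => i; rewrite size_mkseq => ni.
  by rewrite nthE 1?ltnW// nth_mkseq// grid_lt.
apply: (@le_trans _ _ (total_variation 0 b f)); last first.
  apply: ereal_sup_ubound; exists b => //=.
  by rewrite in_itv/= grid_ge0 ?grid_ltT.
apply: ereal_sup_ubound; exists (variation 0 b f s); first by exists s.
congr EFin; rewrite /variation size_mkseq big_mkord; apply: eq_bigr => i _.
by rewrite /= -[nth b s i]/(nth b (0 :: s) i.+1) !nthE// ltnW.
Qed.

Section variation.
Context {R : realType} (T : R) (f : R -> R)
  (P N : {finite_measure set (measurableTypeR R) -> \bar R}) (H : set R).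
Hypothesis fPN : bv_jordan T f P N H.

(** With the constant weight 1 every [slope] is 1, and since |psi| <= 1 the Riemann sums are bounded
    by the variation sums. *)
Lemma continuous_pairing_le (psi : R -> R) (B : R) : unit_continuous psi ->
  (forall n, variation_sum T f n <= B) ->
  `|\int[P]_x psi x - \int[N]_x psi x|%R <= B.
Proof.
move=> [cp p1] VB.
have slope1 a b : slope (cst 1) a b = 1 :> R.
  rewrite /slope (_ : (\int[unit_measure]__ _)%R = (\int[unit_measure]_(t in setT) (1 : R))%R)//.
  by rewrite Rintegral_cst// mul1r -[RHS]/(fine (1%E : \bar R)) -unit_measureT.
have psiK t : `|psi t| <= 1 by have /andP[p0 pl1] := p1 t; rewrite ger0_norm.
have prc (s : R) (u : R^nat) : 0 < s -> s < T -> (forall n, s <= u n) ->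
  u @ \oo --> s -> psi (u n) @[n --> \oo] --> psi s.
  by move=> _ _ _ us; apply: continuous_cvg => //; exact: cp.
have := @riemann_sum_cvg _ _ _ _ _ _ fPN (cst 1) _ _ psi 1 psiK _.
move=> /(_ (fun x => cvg_cst _) (fun=> ler01)).
move=> /(_ prc).
have mI : measurable (`]0, T[ : set (measurableTypeR R)) by exact: measurable_itv.
have E (m : {finite_measure set (measurableTypeR R) -> \bar R}) : m (~` `]0, T[) = 0%E ->
    (\int[m]_(s in `]0%R, T[) (psi s * slope (cst 1) (left_lim f P N s) (f s)) =
    \int[m]_s psi s)%R.
  move=> m0; under eq_Rintegral do rewrite slope1 mulr1.
  rewrite /Rintegral (@negligible_integral _ _ _ m setT (~` `]0, T[))//.
  - by rewrite setTD setCK.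
  - exact: measurableC.
  - apply: (@bounded_integrable _ _ _ _ _ _ 1) => //.
    exact: continuous_measurable_fun.
rewrite (E _ (bvj_PT fPN)) (E _ (bvj_NT fPN)) => /cvg_norm h.
apply: (cvgr_to_le h); apply: nearW => n; apply: le_trans (VB n).
rewrite /riemann_sum (le_trans (ler_norm_sum _ _ _))//; apply: ler_sum => i _.
by rewrite slope1 mul1r normrM ler_piMl.
Qed.

(** The pairing bound, extended from continuous functions to indicators, is applied to the Hahn set
    and to its complement, where only P, respectively only N, contributes. *)
Lemma jordan_variation_le (B : R) : (forall n, variation_sum T f n <= B) ->
  fine (P setT) <= B /\ fine (N setT) <= B.
Proof.
move=> VB.
(* Approximating in mean for the sum of P and N controls the error for both at once. *)
have [m mE mI] : exists2 m : {finite_measure set (measurableTypeR R) -> \bar R},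
    forall A, m A = (P A + N A)%E & forall h : measurableTypeR R -> \bar R,
      measurable_fun setT h -> (forall x, 0 <= h x)%E ->
      (\int[m]_x h x = \int[P]_x h x + \int[N]_x h x)%E.
  pose m0 : {measure set (measurableTypeR R) -> \bar R} := measure_add P N.
  have m0oo : (m0 setT < +oo)%E.
    have -> : m0 setT = (P setT + N setT)%E by exact: measure_addE.
    by rewrite lte_add_pinfty// -ge0_fin_numE// fin_num_measure.
  have E A : mfrestr measurableT m0oo A = m0 A.
    by change (m0 (A `&` setT) = m0 A); rewrite setIT.
  exists (mfrestr measurableT m0oo) => [A|h mh h0]; first by apply: etrans (E A) _; exact: measure_addE.
  rewrite (@eq_measure_integral _ _ _ _ m0) => [|A mA _]; last exact: E.
  exact: ge0_integral_measure_add.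
have key (A : set (measurableTypeR R)) (e : R) : measurable A -> 0 < e ->
    `|fine (P A) - fine (N A)| <= B + e.
  move=> mA e0; have [psi ucp psie] := continuous_approximation m mA e0.
  have [cp p1] := ucp.
  have mp : measurable_fun [set: measurableTypeR R] (psi : measurableTypeR R -> R).
    exact: continuous_measurable_fun.
  have mi : measurable_fun [set: measurableTypeR R] (\1_A : measurableTypeR R -> R).
    exact: measurable_indic.
  have i1 x : 0 <= (\1_A x : R) <= 1 by rewrite indicE; case: (_ \in _); rewrite ?ler01 ?lexx.
  have bnd x : `|psi x - \1_A x| <= 1.
    by rewrite ler_norml; have /andP[? ?] := p1 x; have /andP[? ?] := i1 x; apply/andP; split; lra.
  have intd (n : {finite_measure set (measurableTypeR R) -> \bar R}) :
      n.-integrable setT (EFin \o (fun x => psi x - \1_A x)).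
    apply: (@bounded_integrable _ _ _ _ _ _ 1) => //.
    exact: measurable_funB.
  have E (n : {finite_measure set (measurableTypeR R) -> \bar R}) :
      `|\int[n]_x psi x - fine (n A)|%R <= (\int[n]_x `|psi x - \1_A x|)%R.
    have -> : fine (n A) = (\int[n]_x \1_A x)%R.
      by rewrite /Rintegral integral_indic// setIT.
    rewrite -RintegralB//; first by apply: le_normr_Rintegral => //; exact: intd.
    - apply: (@bounded_integrable _ _ _ _ _ _ 1) => // x _.
      by have /andP[p0 pl1] := p1 x; rewrite ger0_norm.
    - apply: (@bounded_integrable _ _ _ _ _ _ 1) => // x _.
      by have /andP[p0 pl1] := i1 x; rewrite ger0_norm.
  have sumE : (\int[m]_x `|psi x - \1_A x| =
      \int[P]_x `|psi x - \1_A x| + \int[N]_x `|psi x - \1_A x|)%R.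
    rewrite /Rintegral mI.
    - by rewrite fineD//; apply: integrable_fin_num => //; apply: integrable_norm_EFin => //; exact: intd.
    - apply/measurable_EFinP; apply: (measurableT_comp (@normr_measurable _ _)).
      exact: measurable_funB.
    - by move=> x; rewrite lee_fin.
  have := continuous_pairing_le ucp VB.
  have := E P; have := E N; move: psie; rewrite sumE.
  by rewrite !ler_norml => ? /andP[? ?] /andP[? ?] /andP[? ?]; apply/andP; split; lra.
have mH : measurable (H : set (measurableTypeR R)) by exact: bvj_H fPN.
have splitH (n : {finite_measure set (measurableTypeR R) -> \bar R}) :
    n setT = (n H + n (~` H))%E.
  by rewrite -measureU ?setUv ?setICr//; exact: measurableC.
have NH : N H = 0%E by have := bvj_N fPN measurableT; rewrite setTI.
have PH : P (~` H) = 0%E by have := bvj_P fPN measurableT; rewrite setTD.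
split; apply/ler_addgt0Pr => e e0.
  have := key H e mH e0; rewrite NH subr0 splitH PH adde0.
  by apply: le_trans; exact: ler_norm.
have := key (~` H) e (measurableC mH) e0.
rewrite PH sub0r normrN splitH NH add0e.
by apply: le_trans; exact: ler_norm.
Qed.

End variation.

Lemma measurable_fun_open_rays d (X : measurableType d) (R : realType) (f : X -> R) :
  (forall a, measurable (f @^-1` `]a, +oo[)) -> measurable_fun setT f.
Proof.
move=> mf; apply: (measurability _ (RGenOInfty.measurableE R)) => //.
by move=> _ [_ [a ->] <-]; rewrite setTI; exact: mf.
Qed.

Lemma coord_norm_le (R : realType) m n (x : 'M[R]_(m, n)) i j : `|x i j| <= `|x|.
Proof.
rewrite [leRHS]mx_normrE; exact: (le_bigmax _ (fun ij => `|x ij.1 ij.2|) (i, j)).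
Qed.

(** * Measurability in the curve *)

Section curve_measurability.
Context {R : realType} (d : nat) (T : R).
Hypothesis T0 : 0 < T.
Notation mu := (@lebesgue_measure R).

Lemma curve_open_measurable (A : set (curve T d)) :
  curve_open A -> measurable (A : set (Gamma T d)).
Proof. exact: sub_sigma_algebra. Qed.

(** The singleton of t is compact, so uniform convergence on compact sets makes the evaluation at t
    continuous. *)
Lemma measurable_position_at (t : R) i :
  measurable_fun setT (fun g : Gamma T d => position g t ord0 i).
Proof.
have [tT|tT] := pselect (`[0, T[%classic t); last first.
  rewrite (_ : (fun g => _) = cst 0)//.
  by apply/funext => g; rewrite position_out// mxE.
apply: measurable_fun_open_rays => a; apply: curve_open_measurable => g /=.
rewrite in_itv/= andbT => ga.
exists [set t], (position g t ord0 i - a); split.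
- exact: compact_set1.
- by move=> _ ->.
- by rewrite subr_gt0.
move=> h [/(_ t erefl) ht _] /=; rewrite in_itv/= andbT.
have := le_lt_trans (coord_norm_le ((h t).1 - (g t).1) ord0 i) ht.
by rewrite !mxE ltr_norml /position => /andP[]; lra.
Qed.

Lemma level_integrable (g : curve T d) : mu.-integrable `]0, T[ (EFin \o level g).
Proof. by have [] := curve_BV2 g. Qed.

Lemma level_right_cvg (g : curve T d) t : `[0, T[%classic t ->
  level g s @[s --> t^'+] --> level g t.
Proof. by have [_ _] := curve_BV2 g; exact. Qed.

Lemma measurable_level_pairing (b : R -> R) (K : R) :
  measurable_fun `]0, T[ (b : measurableTypeR R -> R) -> (forall s, `|b s| <= K) ->
  measurable_fun setT (fun g : Gamma T d => (\int[mu]_(s in `]0%R, T[) (level g s * b s))%R).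
Proof.
move=> mb bK.
have mI : measurable (`]0, T[ : set (measurableTypeR R)) by exact: measurable_itv.
have K0 : 0 <= K by exact: le_trans (bK 0).
have int (g : curve T d) : mu.-integrable `]0, T[ (EFin \o (fun s => level g s * b s)).
  rewrite (_ : _ \o _ = fun s => (b s * level g s)%:E); last by apply/funext => s /=; rewrite mulrC.
  by apply: (integrableM_bounded mI mb (fun s _ => bK s)); exact: level_integrable.
apply: measurable_fun_open_rays => a; apply: curve_open_measurable => g /=.
rewrite in_itv/= andbT => ga.
set e := (\int[mu]_(s in `]0%R, T[) (level g s * b s))%R - a.
have e0 : 0 < e by rewrite subr_gt0.
(* Only the L^1 distance of the levels matters, so the compact set is empty; K + 1 keeps the radius
   meaningful when K = 0. *)
exists set0, (e / (K + 1)); split => //; first exact: compact0.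
  by rewrite divr_gt0// ltr_wpDl.
move=> h [_ hg] /=; rewrite in_itv/= andbT.
have idiff : mu.-integrable `]0, T[ (EFin \o (fun s => level h s - level g s)).
  by apply: integrableB_EFin => //; exact: level_integrable.
have inorm := integrable_norm_EFin idiff.
have {}hg : (\int[mu]_(s in `]0%R, T[) `|level h s - level g s| < e / (K + 1))%R.
  rewrite -lte_fin /Rintegral fineK//; apply: integrable_fin_num => //.
suff : `|\int[mu]_(s in `]0%R, T[) (level h s * b s) -
         \int[mu]_(s in `]0%R, T[) (level g s * b s)|%R < e.
  by rewrite ltr_norml /e => /andP[]; lra.
rewrite -RintegralB//.
have -> : (\int[mu]_(s in `]0%R, T[) (level h s * b s - level g s * b s) =
    \int[mu]_(s in `]0%R, T[) (b s * (level h s - level g s)))%R.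
  by apply: eq_Rintegral => s _; ring.
have ib : mu.-integrable `]0, T[ (EFin \o (fun s => b s * (level h s - level g s))).
  exact: (integrableM_bounded mI mb (fun s _ => bK s)).
apply: le_lt_trans (le_normr_Rintegral mI ib) _.
apply: (@le_lt_trans _ _ (K * \int[mu]_(s in `]0%R, T[) `|level h s - level g s|)%R).
  rewrite -RintegralZl//; apply: le_Rintegral => //.
  - exact: integrable_norm_EFin.
  - exact: integrableZ_EFin.
  - by move=> s _; rewrite normrM ler_wpM2r.
apply: (@le_lt_trans _ _ (K * (e / (K + 1)))).
  by rewrite ler_wpM2l// ltW.
by rewrite mulrCA -{2}[e]mulr1 ltr_pM2l// ltr_pdivrMr ?mul1r ?ltrDl ?ltr_wpDl.
Qed.

(** Evaluation at a time is not continuous for the L^1 topology, but it is a limit of averages over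
    intervals to the right of that time, which are measurable by [measurable_level_pairing]. *)
Lemma measurable_level_at (t : R) : measurable_fun setT (fun g : Gamma T d => level g t).
Proof.
have pos (s : R) : 0 < s -> s < T -> measurable_fun setT (fun g : Gamma T d => level g s).
  move=> s0 sT; have [K K0 stepK] := @derive1_step_bounded R.
  apply: (measurable_fun_cvg (h := fun n (g : Gamma T d) => (\int[mu]_(x in `]0%R, T[)
     (level g x * derive1 (fun x : R => step (n.+1%:R * (x - s))) x))%R)) => [n|g _].
    have E x : derive1 (fun x : R => step (n.+1%:R * (x - s))) x =
        n.+1%:R * derive1 step (n.+1%:R * (x - s)) :> R.
      by rewrite derive1E; have [_ ->] := is_derive_stepR n.+1%:R s x.
    apply: (@measurable_level_pairing _ (n.+1%:R * K)) => [|x].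
      rewrite (_ : derive1 _ = fun x => n.+1%:R * derive1 step (n.+1%:R * (x - s))); last exact/funext.
      apply: measurable_funTS; apply: measurable_funM => //.
      apply: continuous_measurable_fun => x; apply: continuous_comp; last exact: continuous_derive1_step.
      by apply: cvgM; [exact: cvg_cst|apply: cvgB; [exact: cvg_id|exact: cvg_cst]].
    by rewrite E normrM ger0_norm// ler_wpM2l.
  apply: mollified_value => //; first exact: level_integrable.
  by apply: level_right_cvg; rewrite /= in_itv/= (ltW s0).
have [/andP[t0 tT]|tT] := boolP (0 <= t < T); last first.
  rewrite (_ : (fun g => _) = cst 0)//.
  by apply/funext => g; rewrite level_out// /= in_itv/=; exact/negP.
move: t0; rewrite le_eqVlt => /predU1P[<-|]; last by move=> /pos; apply.
(* The value at 0 is the limit along these times. The denominator n + 2 keeps all of them below T,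
   where averaging is available. *)
pose u n : R := T / n.+2%:R.
have uT n : u n < T by rewrite /u ltr_pdivrMr// ltr_pMr// ltr1n.
have u0 n : 0 < u n by rewrite divr_gt0.
apply: (measurable_fun_cvg (h := fun n (g : Gamma T d) => level g (u n))) => [n|g _].
  exact: pos.
have l0 : `[0, T[%classic (0 : R) by rewrite /= in_itv/= lexx T0.
have /cvg_at_rightP := level_right_cvg (g := g) l0; apply; split => //.
rewrite -(mulr0 T); apply: cvgM; first exact: cvg_cst.
by have := @cvg_harmonic R; rewrite -cvg_shiftS.
Qed.

(** Right-continuity makes [F] the limit of functions that sample it at the right endpoint of the
    cell containing the time. The cells are closed on the left here, so that the endpoint lies
    strictly to the right of that time. *)
Lemma measurable_evaluation_coordinate (F : curve T d -> R -> R) :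
  (forall g t, ~ `[0, T[%classic t -> F g t = 0) ->
  (forall g t, `[0, T[%classic t -> F g s @[s --> t^'+] --> F g t) ->
  (forall t, measurable_fun setT (fun g : Gamma T d => F g t)) ->
  measurable_fun setT (fun p : Gamma T d * measurableTypeR R => F p.1 p.2).
Proof.
move=> Fout Frc mF.
pose cell n i : set (measurableTypeR R) := `[grid T n i, grid T n i.+1[.
pose h n (p : Gamma T d * measurableTypeR R) : R :=
  \sum_(i < n.+1) \1_(cell n i) p.2 * F p.1 (grid T n i.+1).
apply: (measurable_fun_cvg (h := h)) => [n|[g s] _].
  apply: measurable_sum => i; apply: measurable_funM.
    apply: (measurableT_comp _ measurable_snd); apply: measurable_indic.
    exact: measurable_itv.
  exact: (measurableT_comp (mF _) measurable_fst).
have [/andP[s0 sT]|sT] := boolP (0 <= s < T); last first.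
  rewrite [F _ _]Fout; last by rewrite /= in_itv/=; exact/negP.
  apply: cvg_near_cst; apply: nearW => n; rewrite /h big1// => i _ /=.
  rewrite indicE memNset ?mul0r// /cell /= in_itv/= => /andP[s1 s2].
  move/negP: sT; apply; rewrite (le_trans (grid_ge0 T0 n i))//=.
  rewrite (lt_le_trans s2)// (le_trans (y := grid T n n.+1)) ?grid_le//.
  by rewrite /grid mulrAC divff ?mul1r// pnatr_eq0.
pose k n := Num.truncn (s * n.+1%:R / T).
have kP n : grid T n (k n) <= s < grid T n (k n).+1.
  have x0 : 0 <= s * n.+1%:R / T by rewrite divr_ge0 ?mulr_ge0// ltW.
  have /andP[k1 k2] := truncn_itv x0.
  rewrite /grid ler_pdivrMr// ltr_pdivlMr//.
  by rewrite -ler_pdivlMr// k1/= -ltr_pdivrMr.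
have kn n : (k n < n.+1)%N.
  rewrite -(grid_lt T0 n); have /andP[k1 _] := kP n; apply: le_lt_trans k1 _.
  by rewrite /grid mulrAC divff ?mul1r// pnatr_eq0.
have hE n : h n (g, s) = F g (grid T n (k n).+1).
  rewrite /h (bigD1 (Ordinal (kn n)))//= [X in _ + X]big1 ?addr0 => [|i ik].
    by rewrite indicE mem_set ?mul1r// /cell/= in_itv/= kP.
  rewrite indicE memNset ?mul0r// /cell /= in_itv/= => /andP[s1 s2].
  have /andP[k1 k2] := kP n.
  have : (i < (k n).+1)%N by rewrite -(grid_lt T0 n) (le_lt_trans s1).
  have : (k n < i.+1)%N by rewrite -(grid_lt T0 n) (le_lt_trans k1).
  rewrite !ltnS => a b; move/negP: ik; apply; apply/eqP/val_inj => /=.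
  by apply/eqP; rewrite eqn_leq a b.
under eq_fun do rewrite hE.
have lT : `[0, T[%classic s by rewrite /= in_itv/= s0.
have /cvg_at_rightP := Frc g s lT; apply; split => [n|]; first by have /andP[] := kP n.
apply: (@squeeze_cvgr _ _ _ _ (fun=> s) (fun n => s + T / n.+1%:R)).
- apply: nearW => n; have /andP[k1 k2] := kP n; have := grid_step T n (k n).
  by move=> e; rewrite -e (ltW k2)/=; lra.
- exact: cvg_cst.
- rewrite -[X in _ --> X]addr0 -(mulr0 T); apply: cvgD; first exact: cvg_cst.
  by apply: cvgM; [exact: cvg_cst|exact: cvg_harmonic].
Qed.

Lemma measurable_level_evaluation :
  measurable_fun setT (fun p : Gamma T d * measurableTypeR R => level p.1 p.2).
Proof.
apply: measurable_evaluation_coordinate => [g t|g t|t]; first exact: level_out.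
  exact: level_right_cvg.
exact: measurable_level_at.
Qed.

Lemma measurable_position_evaluation :
  measurable_fun setT (fun p : Gamma T d * measurableTypeR R => position p.1 p.2).
Proof.
apply: measurable_fun_rVP => i.
apply: (@measurable_evaluation_coordinate (fun g t => position g t ord0 i)) => [g t|g t|t].
- by move=> tT; rewrite position_out// mxE.
- by have [_ _] := curve_BV1 g i; exact.
- exact: measurable_position_at.
Qed.

End curve_measurability.

Lemma position_lipschitz {R : realType} (d : nat) (T : R) (g : curve T d) :
  exists2 K : R, 0 < K & forall s t, `[0, T[%classic s -> `[0, T[%classic t ->
    `|position g s - position g t| <= K * `|s - t|.
Proof.
have [K K0 gK] := pinfty_ex_gt0 (curve_lipschitz g).
by exists K => // s t sT tT; exact: (gK (s, t)).
Qed.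

Lemma position_right_cvg {R : realType} (d : nat) (T : R) (g : curve T d) s (u : R^nat) :
  0 < s -> s < T -> (forall n, s <= u n) ->
  u @ \oo --> s -> position g (u n) @[n --> \oo] --> position g s.
Proof.
move=> s0 sT su us; have [K K0 gK] := position_lipschitz g.
apply/cvgrPdist_le => e e0; near=> n.
apply: le_trans (gK _ _ _ _) _; rewrite /= ?in_itv/= ?(ltW s0)//.
  rewrite (le_trans (ltW s0) (su n))/=; near: n.
  by apply: (@cvgr_lt _ _ _ _ _ s).
rewrite -ler_pdivlMl// mulrC; near: n.
by apply: (@cvgrPdist_le _ _ _ _ _ _ _).1 => //; rewrite divr_gt0.
Unshelve. all: by end_near. Qed.

(** * Limits of Riemann sums as integrals against the lifted measures *)

Section pairing.
Context {R : realType} (d : nat) (T : R).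
Hypothesis T0 : 0 < T.
Context (g : curve T d) (P N : {finite_measure set (measurableTypeR R) -> \bar R}) (H : set R).
Hypothesis fPN : bv_jordan T (level g) P N H.
Notation X := (R * 'rV[R]_d * R)%type.
Context (phi : R * 'rV[R]_d -> R) (w : R -> R).
Hypotheses (cphi : continuous phi) (mphi : measurable_fun setT phi)
  (phi01 : forall p, 0 <= phi p <= 1).
Hypotheses (cw : continuous w) (w0 : forall x : R, 0 <= w x).

Let mc := measurable_position T0 g.

Let density s := phi (s, position g s) * slope w (left_lim (level g) P N s) (level g s).

Lemma measurable_pairing : measurable_fun setT (fun p : X => (phi p.1 * w p.2)%:E).
Proof.
apply/measurable_EFinP; apply: measurable_funM; first exact: (measurableT_comp mphi).
exact: (measurableT_comp (continuous_measurable_fun cw)).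
Qed.

Lemma pairing_ge0 (p : X) : (0 <= (phi p.1 * w p.2)%:E)%E.
Proof. by rewrite lee_fin mulr_ge0//; have /andP[] := phi01 p.1. Qed.

(** The test function does not see the parameter of the vertical segments. Integrating it out
    replaces the weight by its mean between the left limit and the value, which is the density in
    the limit of the Riemann sums. *)
Lemma lift_pairing (m : {finite_measure set (measurableTypeR R) -> \bar R})
    (M : {finite_measure set X -> \bar R}) :
  lift_formula (level g) P N (position g) m M -> m (~` `]0, T[) = 0%E ->
  (\int[M]_p (phi p.1 * w p.2)%:E = (\int[m]_(s in `]0%R, T[) density s)%R%:E)%E.
Proof.
move=> ME m0; rewrite ME; [|exact: measurable_pairing|exact: pairing_ge0].
have mI : measurable (`]0, T[ : set (measurableTypeR R)) by exact: measurable_itv.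
have [C wC] : exists C : R, forall v : R, `|v| <= bv_bound (level g) P N -> w v <= C.
  have [C _ CP] := continuous_bounded_ball (bv_bound (level g) P N) cw.
  by exists C => v /CP; exact: le_trans (ler_norm _).
have slopeC s : slope w (left_lim (level g) P N s) (level g s) <= C.
  by apply: (slope_le cw w0 wC); [exact: (left_lim_bound fPN)|exact: (bv_boundP fPN)].
have dens0 s : 0 <= density s.
  by rewrite mulr_ge0// ?slope_ge0//; have /andP[] := phi01 (s, position g s).
have E s : (\int[unit_measure]_t
    (phi (lift_point (level g) P N (position g) (s, t)).1 *
     w (lift_point (level g) P N (position g) (s, t)).2)%:E = (density s)%:E)%E.
  have int : unit_measure.-integrable setT
      (fun t => (w (lift_level (level g) P N s t))%:E).
    exact: slope_integrable.
  rewrite /= /density EFinM /slope /Rintegral fineK; last exact: integrable_fin_num.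
  by rewrite -integralZl//; under eq_integral do rewrite EFinM.
under eq_integral do rewrite E.
have mdens : measurable_fun [set: measurableTypeR R] (density : measurableTypeR R -> R).
  apply/measurable_EFinP; rewrite (_ : EFin \o _ = (fun s => \int[unit_measure]_t
    (phi (lift_point (level g) P N (position g) (s, t)).1 *
     w (lift_point (level g) P N (position g) (s, t)).2)%:E)%E); last by apply/funext => s; rewrite E.
  apply: (@measurable_fun_fubini_tonelli_F _ _ _ _ _ unit_measure
    (fun q => (phi (lift_point (level g) P N (position g) q).1 *
      w (lift_point (level g) P N (position g) q).2)%:E)) => [|q].
    exact: (measurableT_comp measurable_pairing (measurable_lift_point fPN mc)).
  exact: pairing_ge0.
have int : m.-integrable setT (EFin \o density).
  apply: (@bounded_integrable _ _ _ _ _ _ C) => // s _.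
  have /andP[p0 p1] := phi01 (s, position g s).
  rewrite ger0_norm// /density (le_trans _ (slopeC s))// ler_piMl//.
  exact: slope_ge0.
rewrite (@negligible_integral _ _ _ m setT (~` `]0, T[))//; last exact: measurableC.
rewrite setTD setCK /Rintegral fineK//; apply: integrable_fin_num => //.
exact: integrableS int.
Qed.

Lemma pairing_cvg (Mp Mn : {finite_measure set X -> \bar R}) :
  lift_formula (level g) P N (position g) P Mp ->
  lift_formula (level g) P N (position g) N Mn ->
  riemann_sum T (level g) w (fun t => phi (t, position g t)) n @[n --> \oo] -->
  fine (\int[Mp]_p (phi p.1 * w p.2)%:E)%E - fine (\int[Mn]_p (phi p.1 * w p.2)%:E)%E.
Proof.
move=> MpE MnE; rewrite (lift_pairing MpE (bvj_PT fPN)) (lift_pairing MnE (bvj_NT fPN)).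
apply: (@riemann_sum_cvg _ _ _ _ _ _ fPN w cw w0 (fun t => phi (t, position g t)) 1).
  by move=> t; have /andP[p0 p1] := phi01 (t, position g t); rewrite ger0_norm.
move=> s u s0 sT su us.
have cp := position_right_cvg (g := g) s0 sT su us.
have h : (u n, position g (u n)) @[n --> \oo] --> (s, position g s) by exact: cvg_pair us cp.
exact: cvg_comp _ _ h (@cphi (s, position g s)).
Qed.

End pairing.

(** * A pi-system generating the Borel sets of (t, x, v) *)

Section product_limits.
Context {R : realType} (d : nat).
Notation Z := (R * 'rV[R]_d)%type.
Notation X := (R * 'rV[R]_d * R)%type.

Lemma coordinates_sum (p : Z) :
  p = p.1 *: (1, 0) + \sum_(i < d) p.2 ord0 i *: (0, delta_mx ord0 i).
Proof.
case: p => t x /=; apply/eqP; rewrite xpair_eqE; apply/andP; split; apply/eqP.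
  have -> : (\sum_(i < d) x ord0 i *: ((0, delta_mx ord0 i) : Z)).1 =
      \sum_(i < d) (0 : R).
    by rewrite (raddf_sum (@fst R 'rV[R]_d)); apply: eq_bigr => i _; rewrite /= scaler0.
  by rewrite big1// addr0 -[RHS]/(t * 1) mulr1.
have -> : (\sum_(i < d) x ord0 i *: ((0, delta_mx ord0 i) : Z)).2 =
    \sum_(i < d) x ord0 i *: delta_mx ord0 i.
  by rewrite (raddf_sum (@snd R 'rV[R]_d)).
by rewrite -row_sum_delta (_ : (t *: (1, 0)).2 = t *: 0)// scaler0 add0r.
Qed.

(** Measurability refers to the sigma-algebra generated by the coordinates, hence an induction on
    the construction in place of an appeal to continuity; a linear form is a combination of
    coordinates. *)
Lemma measurable_elementary (f : Z -> R) : elementary f -> measurable_fun setT f.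
Proof.
elim=> [c|{}f g _ mf _ mg|{}f g _ mf _ mg|{}f f0 _ mf|n l c cl].
- exact: measurable_cst.
- exact: measurable_funD.
- exact: measurable_funM.
- apply: measurable_fun_open_rays => a.
  have ray (h : Z -> R) c : measurable_fun setT h -> measurable [set p | c < h p].
    move=> mh; rewrite -[X in measurable X]setTI.
    have -> : [set p | c < h p] = h @^-1` `]c, +oo[.
      by apply/seteqP; split => p /=; rewrite in_itv/= andbT.
    by apply: mh => //; exact: measurable_itv.
  (* The condition 1 / f > a is cleared of its denominator according to the sign of f. *)
  rewrite (_ : _ @^-1` _ = ([set p | 0 < f p] `&` [set p | -1 < - (a * f p)]) `|`
      ([set p | 0 < - f p] `&` [set p | 1 < a * f p])).
    apply: measurableU; apply: measurableI; apply: ray => //.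
    - by apply: measurable_funN; apply: measurable_funM.
    - exact: measurable_funN.
    - exact: measurable_funM.
  apply/seteqP; split => p /=; rewrite in_itv/= andbT ltrN2 oppr_gt0.
    have [fp|fp|/eqP] := ltgtP (f p) 0; last by rewrite (negbTE (f0 p)).
      by rewrite -ltr_ndivlMr// mul1r => ?; right.
    by rewrite -ltr_pdivlMr// mul1r => ?; left.
  by move=> [[fp]|[fp]]; [rewrite -ltr_pdivlMr// mul1r|rewrite -ltr_ndivlMr// mul1r].
- apply: (measurableT_comp (f := flat n)).
    apply: continuous_measurable_fun => x.
    by apply/differentiable_continuous/derivable1_diffP; have [] := is_derive_flat n x.
  apply: measurable_funD => //.
  rewrite (_ : (l : Z -> R) = fun p => p.1 * l (1, 0) + \sum_(i < d) p.2 ord0 i * l (0, delta_mx ord0 i)).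
    apply: measurable_funD; first by apply: measurable_funM => //; exact: measurable_fst.
    apply: measurable_sum => i; apply: measurable_funM => //.
    exact: (measurableT_comp (measurable_rV_coord i) measurable_snd).
  apply/funext => -[t x] /=.
  rewrite [X in l X](coordinates_sum (t, x)) linearD linearZ linear_sum/=; congr (_ + _).
  by apply: eq_bigr => i _; rewrite linearZ.
Qed.

Definition unit_elementary (a : Z -> R) := elementary a /\ forall p, 0 <= a p <= 1.

(** The two factors play different roles: the first is sampled along the curve in the Riemann sums,
    while the second is absorbed into the weight, which becomes k times the second derivative of the
    entropy and so needs only continuity. *)
Definition product_limit (B : set X) := exists (a : nat -> Z -> R) (k : nat -> R -> R),
  [/\ forall n, unit_elementary (a n), forall n, unit_continuous (k n) &
      forall p, a n p.1 * k n p.2 @[n --> \oo] --> (\1_B p : R)].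

Lemma unit_elementary1 : unit_elementary (cst 1).
Proof. by split=> [|p]; [exact: elementary_cst|rewrite ler01 lexx]. Qed.

Lemma unit_continuous1 : unit_continuous (cst (1 : R)).
Proof. by split=> [x|p]; [exact: cvg_cst|rewrite ler01 lexx]. Qed.

Lemma unit_elementaryM (a b : Z -> R) : unit_elementary a -> unit_elementary b ->
  unit_elementary (a * b).
Proof.
move=> [ea a1] [eb b1]; split; first exact: elementaryM.
move=> p; have /andP[x y] := a1 p; have /andP[z t] := b1 p.
by rewrite [(a * b) p]/(a p * b p) mulr_ge0// mulr_ile1.
Qed.

Lemma unit_continuousM (a b : R -> R) : unit_continuous a -> unit_continuous b ->
  unit_continuous (a * b).
Proof.
move=> [ca a1] [cb b1]; split=> [x|p]; first by apply: cvgM; [exact: ca|exact: cb].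
have /andP[x y] := a1 p; have /andP[z t] := b1 p.
by rewrite [(a * b) p]/(a p * b p) mulr_ge0// mulr_ile1.
Qed.

Lemma product_limit_setI : setI_closed product_limit.
Proof.
move=> A B [a [k [ea ck akA]]] [b [l [eb cl blB]]].
exists (fun n => a n * b n), (fun n => k n * l n); split => [n|n|p].
- exact: unit_elementaryM.
- exact: unit_continuousM.
- rewrite indicI [X in _ --> X](_ : _ = (\1_A p : R) * \1_B p)//.
  rewrite (_ : (fun n => _) = fun n => (a n p.1 * k n p.2) * (b n p.1 * l n p.2)).
    exact: cvgM.
  by apply/funext => n; rewrite -[(a n * b n) _]/(a n p.1 * b n p.1) -[(k n * l n) _]/(k n p.2 * l n p.2); ring.
Qed.

Lemma unit_elementary_step (l : {linear Z -> R}) (a c : R) : continuous l ->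
  unit_elementary (fun p => step (a * l p + c)).
Proof.
by move=> cl; split=> [|p]; [exact: elementary_step|rewrite step_ge0 step_le1].
Qed.

Lemma product_limit_linear_ray (l : {linear Z -> R}) (c : R) : continuous l ->
  product_limit [set p | c < l p.1].
Proof.
move=> cl; exists (fun n p => step (n.+1%:R * (l p - c))), (fun=> cst 1).
split => [n|n|p]; last 1 first.
- under eq_fun do rewrite mulr1.
  have := step_dilation_cvg (t := c) (x := l p.1).
  rewrite indicE mem_setE in_itv/= andbT => h; rewrite indicE.
  rewrite (_ : (_ \in _) = (c < l p.1))//; apply/idP/idP => [/set_mem|h']//.
  exact/mem_set.
- rewrite (_ : (fun p => _) = fun p => step (n.+1%:R * l p + - (n.+1%:R * c))).
    exact: unit_elementary_step.
  by apply/funext => p; rewrite mulrBr.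
- exact: unit_continuous1.
Qed.

Lemma product_limit_level_ray (c : R) : product_limit [set p : X | c < p.2].
Proof.
exists (fun=> cst 1), (fun n v => step (n.+1%:R * (v - c))).
split => [n|n|p]; first exact: unit_elementary1.
- split => [x|x]; last by rewrite step_ge0 step_le1.
  exact/differentiable_continuous/elementary_diff/elementary_stepR.
- under eq_fun do rewrite mul1r.
  have := step_dilation_cvg (t := c) (x := p.2).
  rewrite indicE mem_setE in_itv/= andbT => h; rewrite indicE.
  rewrite (_ : (_ \in _) = (c < p.2))//; apply/idP/idP => [/set_mem|h']//.
  exact/mem_set.
Qed.

Lemma time_linear_exists : exists2 l : {linear Z -> R}, continuous l & forall p, l p = p.1.
Proof.
exists (HB.pack_for {linear Z -> R} (@fst R 'rV[R]_d)) => //.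
by move=> p; exact: cvg_fst.
Qed.

Lemma coordinate_linear_exists (i : 'I_d) :
  exists2 l : {linear Z -> R}, continuous l & forall p, l p = p.2 ord0 i.
Proof.
pose f (p : Z) : R := p.2 ord0 i.
have lin : linear f.
  by move=> k p q; rewrite /f !mxE.
pose lM := GRing.isLinear.Build R Z R _ f lin.
pose l : {linear Z -> R} := HB.pack f lM.
exists l => //.
move=> p /=.
apply: (continuous_comp (f := snd) (g := fun x : 'rV[R]_d => x ord0 i)).
  exact: cvg_snd.
exact: coord_continuous.
Qed.

(** Rays in each coordinate belong to the system, so the identity is measurable from the
    sigma-algebra it generates. Conversely, the indicator of a member is a limit of measurable
    functions. *)
Lemma measurable_product_limit_generated : @measurable _ X = <<s product_limit >>.
Proof.
apply/seteqP; split.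
  pose Y := g_sigma_algebraType product_limit.
  have ray (f : Y -> R) : (forall c, product_limit [set p | c < f p]) -> measurable_fun setT f.
    move=> nf; apply: measurable_fun_open_rays => c.
    rewrite (_ : _ @^-1` _ = [set p | c < f p]); first exact: sub_sigma_algebra.
    by apply/seteqP; split => p /=; rewrite in_itv/= andbT.
  have mid : measurable_fun setT (fun p : Y => p : X).
    rewrite (_ : (fun p => _) = fun p : Y => ((p.1.1, p.1.2), p.2)); last first.
      by apply/funext => -[[]].
    apply: measurable_fun_pair; last by apply: ray => c; exact: product_limit_level_ray.
    apply: measurable_fun_pair.
      apply: ray => c; have [l cl lE] := time_linear_exists.
      have := product_limit_linear_ray c cl.
      by rewrite (_ : [set p : X | c < l p.1] = [set p : X | c < p.1.1])//;
        apply/seteqP; split => p /=; rewrite lE.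
    apply: measurable_fun_rVP => i; apply: ray => c.
    have [l cl lE] := coordinate_linear_exists i.
    have := product_limit_linear_ray c cl.
    by rewrite (_ : [set p : X | c < l p.1] = [set p : X | c < p.1.2 ord0 i])//;
      apply/seteqP; split => p /=; rewrite lE.
  by move=> B mB; have := mid measurableT B mB; rewrite setTI.
apply: smallest_sub; first exact: sigma_algebra_measurable.
move=> B [a [k [ea ck akB]]].
have mB : measurable_fun setT (\1_B : X -> R).
  apply: (measurable_fun_cvg (h := fun n (p : X) => a n p.1 * k n p.2)) => [n|p _]; last exact: akB.
  apply: measurable_funM.
    by apply: (measurableT_comp _ measurable_fst); apply: measurable_elementary; have [] := ea n.
  apply: (measurableT_comp _ measurable_snd).
  by apply: continuous_measurable_fun; have [] := ck n.
have -> : B = \1_B @^-1` [set (1 : R)].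
  apply/seteqP; split => p /=; rewrite indicE; first by move=> Bp; rewrite mem_set.
  by case: (boolP (p \in B)) => [/set_mem//|_ /eqP]; rewrite eq_sym oner_eq0.
by rewrite -[X in measurable X]setTI; exact: mB.
Qed.

End product_limits.

(** * The production of a curve: signed measure in the set, measurable in the curve *)

Section production_charge.
Context {R : realType} (d : nat) (T : R).
Hypothesis T0 : 0 < T.
Notation Z := (R * 'rV[R]_d)%type.
Notation X := (R * 'rV[R]_d * R)%type.
Context (eta : R -> R).
Hypotheses (seta : smooth eta) (eta0 : forall v : R, 0 <= derive1n 2 eta v).

Let w := derive1n 2 eta.

Let cw : continuous w.
Proof. exact/smooth_continuous/smooth_derive1/smooth_derive1. Qed.

Let mw : measurable_fun setT (fun p : X => (w p.2)%:E).
Proof.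
apply/measurable_EFinP; apply: (measurableT_comp (continuous_measurable_fun cw)).
exact: measurable_snd.
Qed.

(** The bound M can be the same for almost all curves, unlike [bv_bound]; this makes the estimate of
    the production uniform. *)
Let left_lim_itv (g : curve T d) P N H M s : bv_jordan T (level g) P N H ->
  (forall t, level g t <= M) -> 0 <= left_lim (level g) P N s <= M.
Proof.
move=> fPN lM; have l0 t : 0 <= level g t by exact: curve_ge0.
have [/andP[s0 sT]|sT] := boolP (0 < s < T); last first.
  by rewrite (left_lim_out fPN) ?l0 ?lM//=; apply/negP; rewrite in_itv.
have u1 n : s - s * n.+1%:R^-1 < s by rewrite ltrBlDr ltrDl mulr_gt0// invr_gt0.
have ucvg : s - s * n.+1%:R^-1 @[n --> \oo] --> s.
  rewrite -[X in _ --> X]subr0 -(mulr0 s); apply: cvgB; first exact: cvg_cst.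
  by apply: cvgM; [exact: cvg_cst|exact: cvg_harmonic].
have h := bv_left_cvg fPN s0 sT u1 ucvg.
by apply/andP; split; [apply: (cvgr_to_ge h)|apply: (cvgr_to_le h)]; exact: nearW.
Qed.

Let integrable_w (m : {finite_measure set X -> \bar R}) :
  (\int[m]_p (w p.2)%:E)%E \is a fin_num ->
  m.-integrable setT (fun p : X => (w p.2)%:E).
Proof.
move=> fin; apply/integrableP; split => //.
under eq_integral do rewrite gee0_abs ?lee_fin ?eta0//.
by rewrite -ge0_fin_numE// integral_ge0// => p _; rewrite lee_fin eta0.
Qed.

Let pairing_lim (m : {finite_measure set X -> \bar R}) B (a : nat -> Z -> R)
    (k : nat -> R -> R) :
  (\int[m]_p (w p.2)%:E)%E \is a fin_num -> measurable B ->
  (forall n, unit_elementary (a n)) -> (forall n, unit_continuous (k n)) ->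
  (forall p, a n p.1 * k n p.2 @[n --> \oo] --> (\1_B p : R)) ->
  fine (\int[m]_p (a n p.1 * (k n * w) p.2)%:E)%E @[n --> \oo] -->
  fine (\int[m]_(p in B) (w p.2)%:E)%E.
Proof.
move=> fin mB ea ck akB.
have ma n : measurable_fun setT (fun p : X => a n p.1).
  by apply: (measurableT_comp _ measurable_fst); apply: measurable_elementary; have [] := ea n.
have mk n : measurable_fun setT (fun p : X => k n p.2).
  apply: (measurableT_comp _ measurable_snd).
  by apply: continuous_measurable_fun; have [] := ck n.
have mw' : measurable_fun setT (fun p : X => w p.2) by exact/measurable_EFinP.
have iw := integrable_w fin.
have mf_ n : measurable_fun setT (fun p : X => (a n p.1 * (k n * w) p.2)%:E).
  apply/measurable_EFinP; apply: measurable_funM => //.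
  rewrite (_ : (fun p => _) = fun p : X => k n p.2 * w p.2)//.
  exact: measurable_funM.
have mf : measurable_fun setT (fun p : X => (\1_B p * w p.2)%:E).
  by apply/measurable_EFinP; apply: measurable_funM.
have f_f : {ae m, forall p : X, setT p -> (a n p.1 * (k n * w) p.2)%:E @[n --> \oo] -->
    (\1_B p * w p.2)%:E}.
  apply: aeW => p _; apply: cvg_EFin; first exact: nearW.
  rewrite (_ : _ \o _ = fun n => (a n p.1 * k n p.2) * w p.2); last first.
    by apply/funext => n /=; rewrite -[(k n * w) _]/(k n p.2 * w p.2) mulrA.
  by apply: cvgM; [exact: akB|exact: cvg_cst].
have f_g : {ae m, forall (p : X) n, setT p -> (`|(a n p.1 * (k n * w) p.2)%:E| <= (w p.2)%:E)%E}.
  apply: aeW => p n _; rewrite -[(k n * w) _]/(k n p.2 * w p.2) mulrA.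
  have [_ a1] := ea n; have [_ k1] := ck n.
  have /andP[a0 al1] := a1 p.1; have /andP[k0 kl1] := k1 p.2.
  by rewrite gee0_abs lee_fin ?mulr_ge0 ?eta0// ler_piMl ?eta0// mulr_ile1.
have [ilim _ h] := dominated_convergence measurableT mf_ mf f_f iw f_g.
have -> : (\int[m]_(p in B) (w p.2)%:E = \int[m]_p (\1_B p * w p.2)%:E)%E.
  rewrite integral_mkcond; apply: eq_integral => p _; rewrite patchE indicE.
  by case: (p \in B); rewrite ?mul1r ?mul0r.
apply: fine_cvg; rewrite fineK; last exact: integrable_fin_num.
exact: h.
Qed.

(** These clauses sum up what is used later of the lifts of a curve. In the bound, each Jordan part
    contributes one term C V. The last two clauses write the production as an iterated limit of
    Riemann sums, in which the chosen Jordan parts no longer appear. *)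
Lemma curve_production_charge (g : curve T d) :
  exists nu : {charge set X -> \bar R},
  [/\ forall B, measurable B -> curve_production eta g B = nu B,
      forall (M C V : R), (forall t, level g t <= M) ->
        (forall v, 0 <= v <= M -> w v <= C) ->
        (forall n, variation_sum T (level g) n <= V) ->
        forall B, measurable B -> `|fine (nu B)| <= C * V + C * V,
      forall (a : Z -> R) (k : R -> R), unit_elementary a -> unit_continuous k ->
        cvgn (riemann_sum T (level g) (k * w) (fun t => a (t, position g t))) &
      forall B (a : nat -> Z -> R) (k : nat -> R -> R), measurable B ->
        (forall n, unit_elementary (a n)) -> (forall n, unit_continuous (k n)) ->
        (forall p, a n p.1 * k n p.2 @[n --> \oo] --> (\1_B p : R)) ->
        limn (riemann_sum T (level g) (k n * w) (fun t => a n (t, position g t)))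
          @[n --> \oo] --> fine (nu B)].
Proof.
have [P [N [H [Mp [Mn [fPN MpE MnE CPE]]]]]] := curve_production_lift T0 g.
have [finP finN _] := CPE eta setT seta eta0 measurableT.
pose nup : {charge set X -> \bar R} := induced_charge (integrable_w finP).
pose nun : {charge set X -> \bar R} := induced_charge (integrable_w finN).
pose nu : {charge set X -> \bar R} := cadd nup (copp nun).
exists nu; split => [B mB|M C V lM wC VV B mB|a k ea ck|B a k mB ea ck akB].
- by have [_ _ ->] := CPE eta B seta eta0 mB.
- have mh : measurable_fun setT (fun p : X => (w p.2)%:E) by [].
  have w0 (p : X) : (0 <= (w p.2)%:E)%E by rewrite lee_fin eta0.
  have hC s t : `]0%R, 1%R[%classic t ->
      ((w (lift_point (level g) P N (position g) (s, t)).2)%:E <= C%:E)%E.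
    rewrite /= in_itv/= => /andP[t0 t1]; rewrite lee_fin; apply: wC.
    have /andP[l0 l1] := left_lim_itv s fPN lM.
    have f0 : 0 <= level g s by exact: curve_ge0.
    by have := lM s; rewrite /lift_level/= => ?; apply/andP; split; nra.
  have M0 : 0 <= M by exact: le_trans (curve_ge0 g 0) (lM 0).
  have C0 : 0 <= C by apply: le_trans (eta0 0) (wC 0 _); rewrite lexx.
  have [PV NV] := jordan_variation_le fPN VV.
  have bnd m M' : lift_formula (level g) P N (position g) m M' -> fine (m setT) <= V ->
      0 <= fine (\int[M']_(p in B) (w p.2)%:E)%E <= C * V.
    move=> ME mV.
    have := lift_integral_le fPN (measurable_position T0 g) ME mB mh w0 hC.
    rewrite -[m setT]fineK ?fin_num_measure// -EFinM => h.
    rewrite fine_ge0 ?integral_ge0//= -lee_fin fineK; last first.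
      by rewrite ge0_fin_numE ?integral_ge0//; exact: le_lt_trans h (ltry _).
    by apply: le_trans h _; rewrite lee_fin ler_wpM2l.
  have [fP fN _] := CPE eta B seta eta0 mB.
  rewrite -[fine (nu B)]/(fine (\int[Mp]_(p in B) (w p.2)%:E - \int[Mn]_(p in B) (w p.2)%:E)%E) fineB//.
  have /andP[? ?] := bnd _ _ MpE PV; have /andP[? ?] := bnd _ _ MnE NV.
  by rewrite ler_norml; apply/andP; split; nra.
- have [ela a1] := ea; have [ca k1] := ck.
  apply/cvg_ex; eexists.
  apply: (pairing_cvg T0 fPN _ _ a1 _ _ MpE MnE).
  + by move=> p; exact/differentiable_continuous/elementary_diff.
  + exact: measurable_elementary.
  + by move=> x; apply: cvgM; [exact: ca|exact: cw].
  + by move=> x; rewrite mulr_ge0 ?eta0//; have /andP[] := k1 x.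
have lE n : limn (riemann_sum T (level g) (k n * w) (fun t => a n (t, position g t))) =
    fine (\int[Mp]_p (a n p.1 * (k n * w) p.2)%:E)%E -
    fine (\int[Mn]_p (a n p.1 * (k n * w) p.2)%:E)%E.
  have [ela a1] := ea n; have [ca k1] := ck n.
  apply: cvg_lim => //; apply: (pairing_cvg T0 fPN _ _ a1 _ _ MpE MnE).
  + by move=> p; exact/differentiable_continuous/elementary_diff.
  + exact: measurable_elementary.
  + by move=> x; apply: cvgM; [exact: ca|exact: cw].
  + by move=> x; rewrite mulr_ge0 ?eta0//; have /andP[] := k1 x.
under eq_fun do rewrite lE.
have [fP fN _] := CPE eta B seta eta0 mB.
rewrite -[fine (nu B)]/(fine (\int[Mp]_(p in B) (w p.2)%:E - \int[Mn]_(p in B) (w p.2)%:E)%E) fineB//.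
by apply: cvgB; exact: pairing_lim.
Qed.

Lemma measurable_riemann_sum (a : Z -> R) (k : R -> R) n : unit_elementary a ->
  unit_continuous k -> measurable_fun setT
    (fun g : Gamma T d => riemann_sum T (level g) (k * w) (fun t => a (t, position g t)) n).
Proof.
move=> [ela _] [ck k1]; rewrite /riemann_sum; apply: measurable_sum => i.
have ml t : measurable_fun setT (fun g : Gamma T d => level g t) by exact: measurable_level_at.
apply: measurable_funM.
  apply: (measurableT_comp (measurable_elementary ela)).
  apply: measurable_fun_pair => //; apply: measurable_fun_rVP => j.
  exact: measurable_position_at.
apply: measurable_funM; last exact: measurable_funB.
have ckw : continuous (k * w) by move=> x; apply: cvgM; [exact: ck|exact: cw].
have kw0 x : 0 <= (k * w) x by rewrite mulr_ge0 ?eta0//; have /andP[] := k1 x.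
apply: (measurableT_comp (f := fine)) => //.
apply: (@measurable_fun_fubini_tonelli_F _ _ (Gamma T d) (measurableTypeR R) R unit_measure
  (fun q => ((k * w) ((1 - q.2) * level (q.1 : Gamma T d) (grid T n i) + q.2 * level (q.1 : Gamma T d) (grid T n i.+1)))%:E)).
  apply/measurable_EFinP; apply: (measurableT_comp (continuous_measurable_fun ckw)).
  apply: measurable_funD; apply: measurable_funM.
  - by apply: measurable_funB => //; exact: measurable_snd.
  - exact: (measurableT_comp (ml _) measurable_fst).
  - exact: measurable_snd.
  - exact: (measurableT_comp (ml _) measurable_fst).
by move=> q; rewrite lee_fin.
Qed.

(** On [product_limit] sets the production is an iterated limit of Riemann sums, each measurable in
    the curve. Additivity in the set for every fixed curve then carries measurability through the
    Dynkin induction. *)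
Lemma measurable_curve_production B : measurable B ->
  measurable_fun setT (fun g : Gamma T d => curve_production eta g B).
Proof.
have niceP A : product_limit A -> measurable_fun setT (fun g : Gamma T d => curve_production eta g A).
  move=> nA; have mA : measurable A.
    by rewrite measurable_product_limit_generated; exact: sub_sigma_algebra.
  have [a [k [ea ck akA]]] := nA.
  rewrite (_ : (fun g => _) = EFin \o (fun g : Gamma T d => fine (curve_production eta g A))).
    apply/measurable_EFinP.
    apply: (measurable_fun_cvg (h := fun n (g : Gamma T d) =>
      limn (riemann_sum T (level g) (k n * w) (fun t => a n (t, position g t))))) => [n|g _].
      apply: (measurable_fun_cvg (h := fun m (g : Gamma T d) =>
        riemann_sum T (level g) (k n * w) (fun t => a n (t, position g t)) m)) => [m|g _].
        exact: measurable_riemann_sum.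
      by have [nu [_ _ h _]] := curve_production_charge g; exact: h.
    by have [nu [-> // _ _ h]] := curve_production_charge g; exact: h.
  apply/funext => g /=; have [nu [-> // _ _ _]] := curve_production_charge g.
  by rewrite fineK//; exact: fin_num_measure.
have IT : measurable_fun setT (fun g : Gamma T d => curve_production eta g setT).
  apply: niceP; exists (fun=> cst 1), (fun=> cst 1); split => [n|n|p].
  - exact: unit_elementary1.
  - exact: unit_continuous1.
  - by rewrite indicT mulr1; exact: cvg_cst.
rewrite [X in X B -> _]measurable_product_limit_generated.
apply: (@dynkin_induction _ X (@product_limit R d) (fun B => measurable_fun setT
  (fun g : Gamma T d => curve_production eta g B))).
- exact: measurable_product_limit_generated.
- exact: product_limit_setI.
- exact: IT.
- exact: niceP.
- move=> S mS IS.
  rewrite (_ : (fun g => _) = fun g : Gamma T d => (curve_production eta g setT - curve_production eta g S)%E).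
    exact: emeasurable_funB.
  apply/funext => g; have [nu [CE _ _ _]] := curve_production_charge g.
  rewrite !CE//; last exact: measurableC.
  by rewrite -setTD chargeD// setTI.
- move=> F mF tF IF.
  apply: (emeasurable_fun_cvg (fun n (g : Gamma T d) => (\sum_(0 <= i < n) curve_production eta g (F i))%E)).
    by move=> n; apply: emeasurable_sum => i _; exact: IF.
  move=> g _; have [nu [CE _ _ _]] := curve_production_charge g.
  rewrite CE; last exact: bigcup_measurable.
  under eq_fun do under eq_bigr do rewrite CE//.
  by apply: charge_semi_sigma_additive => //; exact: bigcup_measurable.
Qed.

End production_charge.

(** * The balance along a characteristic curve *)

Section lipschitz_FTC.
Context {R : realType}.
Notation mu := (@lebesgue_measure R).

Let itv_fin (a b : R) : (mu `]a, b[ < +oo)%E.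
Proof. by rewrite lebesgue_measure_itv/=; case: ifP => _; rewrite ?ltry// -EFinB ltry. Qed.

Lemma integral_derivative_C1 (G g : R -> R) (a b : R) : a < b -> continuous g ->
  (forall x : R, a <= x <= b -> is_derive x (1 : R) G (g x)) ->
  (\int[mu]_(x in `]a, b[) g x)%R = G b - G a.
Proof.
move=> ab cg dG.
have cG (x : R) : a <= x <= b -> {for x, continuous G}.
  by move=> xab; apply/differentiable_continuous/derivable1_diffP; have [] := dG _ xab.
have mg : measurable_fun [set: measurableTypeR R] (g : measurableTypeR R -> R).
  exact: continuous_measurable_fun.
rewrite /Rintegral -(@integral_itv_bndoo _ a b _ true false); last first.
  by apply: measurable_funTS; apply/measurable_EFinP.
rewrite (@continuous_FTC2 _ g G)//.
- exact: continuous_subspaceT.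
- split.
  + by move=> x; rewrite in_itv/= => /andP[ax xb]; have [] := dG x; rewrite ?ltW.
  + by apply: cvg_at_right_filter; apply: cG; rewrite lexx ltW.
  + by apply: cvg_at_left_filter; apply: cG; rewrite lexx ltW.
- move=> x; rewrite in_itv/= => /andP[ax xb]; rewrite derive1E.
  by have [|_ ->] := dG x; rewrite ?ltW.
Qed.

Lemma is_derive_quotient_cvg (G : R -> R) (x l : R) : is_derive x (1 : R) G l ->
  n.+1%:R * (G (x + n.+1%:R^-1) - G x) @[n --> \oo] --> l.
Proof.
move=> [dG <-].
have h : n.+1%:R^-1 @[n --> \oo] --> (0 : R)^'.
  move=> A hA; change (\forall n \near \oo, A n.+1%:R^-1); near=> n.
  have : n.+1%:R^-1 != 0 :> R by rewrite invr_eq0.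
  by near: n; exact: (@cvg_harmonic R _ hA).
have := cvg_comp _ _ h dG; apply: cvg_trans; apply: near_eq_cvg; apply: nearW => n /=.
by rewrite invrK -[n.+1%:R^-1%:A]/(n.+1%:R^-1 * 1) mulr1 [_ + x]addrC.
Unshelve. all: by end_near. Qed.

Let lipschitz_continuous (psi : R -> R) (K : R) :
  (forall s t, `|psi s - psi t| <= K * `|s - t|) -> continuous psi.
Proof.
move=> psiK x; apply/cvgrPdist_le => e e0.
have K1 : 0 < `|K| + 1 by rewrite ltr_wpDl.
near=> y; apply: le_trans (psiK _ _) _.
apply: (@le_trans _ _ ((`|K| + 1) * `|x - y|)).
  by rewrite ler_wpM2r// (le_trans (ler_norm K))// lerDl.
rewrite -ler_pdivlMl// mulrC; near: y.
by apply: (@cvgrPdist_le _ _ _ _ _ _ _).1 => //; rewrite divr_gt0.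
Unshelve. all: by end_near. Qed.

(** The difference quotients of [psi] are bounded by the Lipschitz constant, so differentiability
    almost everywhere is enough to pass to the limit in their integrals. The same integrals are
    computed exactly as differences of quotients of a primitive of [psi], which tend to
    [psi b - psi a]. *)
Lemma lipschitz_FTC (psi psid : R -> R) (K a b : R) : a < b ->
  (forall s t, `|psi s - psi t| <= K * `|s - t|) ->
  measurable_fun `]a, b[ (psid : measurableTypeR R -> R) ->
  {ae mu, forall s, `]a, b[%classic s -> is_derive s (1 : R) psi (psid s)} ->
  (\int[mu]_(s in `]a, b[) psid s)%R = psi b - psi a.
Proof.
move=> ab psiK mpsid dpsi.
have cpsi := lipschitz_continuous psiK.
(* The primitive starts at [a - 1] in order to be differentiable at [a] as well. *)
pose P (x : R) : R := (\int[mu]_(t in `[a - 1, x]) psi t)%R.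
have dP (x : R) : a - 1 < x -> is_derive x (1 : R) P (psi x).
  move=> ax; have ax1 : x < x + 1 by rewrite ltrDl.
  have int : mu.-integrable `[a - 1, x + 1] (EFin \o psi).
    apply: continuous_compact_integrable; first exact: segment_compact.
    exact: continuous_subspaceT.
  have [dP PE] := continuous_FTC1_closed ax1 int ax (cpsi x).
  by apply: DeriveDef; [exact: dP|rewrite -derive1E PE].
pose q n (s : R) : R := n.+1%:R * (psi (s + n.+1%:R^-1) - psi s).
have cq n : continuous (q n).
  move=> x; apply: cvgM; first exact: cvg_cst.
  apply: cvgB; last exact: cpsi.
  apply: (continuous_comp (f := fun s : R => s + n.+1%:R^-1)); last exact: cpsi.
  by apply: cvgD; [exact: cvg_id|exact: cvg_cst].
have lim1 : (\int[mu]_(s in `]a, b[) q n s @[n --> \oo] --> \int[mu]_(s in `]a, b[) psid s)%R.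
  apply: (@dominated_cvg_Rintegral _ _ R mu `]a, b[ q psid (cst K)) => //.
  - by move=> n; apply: measurable_funTS; exact: continuous_measurable_fun.
  - have [S [mS S0 subS]] := dpsi; exists S; split => // s /= ns.
    by apply: subS => /= ds; apply: ns => sab; exact/is_derive_quotient_cvg/ds.
  - apply: (@bounded_integrable_fin _ _ _ _ _ _ `|K|) => //; exact: itv_fin.
  - move=> n s _; rewrite /q normrM ger0_norm// mulrC -ler_pdivlMr//.
    by apply: le_trans (psiK _ _) _; rewrite addrC addKr ger0_norm.
have qE n : (\int[mu]_(s in `]a, b[) q n s =
    n.+1%:R * (P (b + n.+1%:R^-1) - P b) - n.+1%:R * (P (a + n.+1%:R^-1) - P a))%R.
  apply: (@integral_derivative_C1 (fun s => n.+1%:R * (P (s + n.+1%:R^-1) - P s))) => // x /andP[ax xb].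
  have xa : a - 1 < x by rewrite ltrBlDr (le_lt_trans ax)// ltrDl.
  have d1 : is_derive x (1 : R) (fun s => P (s + n.+1%:R^-1)) (psi (x + n.+1%:R^-1)).
    have da : is_derive x (1 : R) ((id : R -> R) + cst n.+1%:R^-1) (1 + 0).
      by apply: is_deriveD.
    rewrite addr0 in da.
    rewrite -[X in is_derive _ _ _ X]mulr1.
    apply: (is_derive1_comp (f := P)); apply: dP.
    by rewrite (lt_trans xa)// ltrDl invr_gt0.
  have d2 : is_derive x (1 : R) (fun s => P (s + n.+1%:R^-1) - P s)
      (psi (x + n.+1%:R^-1) - psi x).
    by apply: is_deriveB => //; exact: dP.
  exact: (is_deriveZ n.+1%:R d2).
have lim2 c : a - 1 < c -> n.+1%:R * (P (c + n.+1%:R^-1) - P c) @[n --> \oo] --> psi c.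
  by move=> ac; exact/is_derive_quotient_cvg/dP.
apply: (@cvg_unique _ (@norm_hausdorff _ _) _ _ _ _ lim1).
rewrite (_ : (fun n => _) = fun n => n.+1%:R * (P (b + n.+1%:R^-1) - P b) -
  n.+1%:R * (P (a + n.+1%:R^-1) - P a)); last exact/funext.
by apply: cvgB; apply: lim2; rewrite ?ltrBlDr ?ltrDl// (lt_trans ab)// ltrDl.
Unshelve. all: by end_near. Qed.

Lemma lipschitz_FTC_itv (psi psid : R -> R) (K a b : R) : a < b ->
  (forall s t, a <= s <= b -> a <= t <= b -> `|psi s - psi t| <= K * `|s - t|) ->
  measurable_fun `]a, b[ (psid : measurableTypeR R -> R) ->
  {ae mu, forall s, `]a, b[%classic s -> is_derive s (1 : R) psi (psid s)} ->
  (\int[mu]_(s in `]a, b[) psid s)%R = psi b - psi a.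
Proof.
move=> ab psiK mpsid dpsi.
(* The projection onto [a, b] is 1-Lipschitz; composing with it extends [psi] to a Lipschitz
   function on the line without changing it on [a, b]. *)
pose clamp t := Num.min (Num.max t a) b.
have clampE t : a <= t <= b -> clamp t = t.
  by move=> /andP[at' tb]; rewrite /clamp (max_idPl at') (min_idPl tb).
have clampI t : a <= clamp t <= b.
  by rewrite /clamp le_min le_max lexx orbT (ltW ab) ge_min lexx orbT.
have clampL s t : `|clamp s - clamp t| <= `|s - t|.
  rewrite /clamp; case: (leP s a) => sa; case: (leP t a) => ta;
  rewrite /Num.min; repeat case: ifPn => ?;
  rewrite ler_norml; have := ler_norm (s - t); have := ler_norm (t - s);
  rewrite (distrC t) => h1 h2; apply/andP; split; lra.
have K0 : 0 <= K.
  have := psiK a b; rewrite !lexx (ltW ab) => /(_ isT isT).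
  by move=> /(le_trans (normr_ge0 _)); rewrite pmulr_lge0// normr_gt0 subr_eq0 lt_eqF.
have := @lipschitz_FTC (psi \o clamp) psid K a b ab.
rewrite /= !clampE ?lexx ?(ltW ab)//; apply => //.
  move=> s t; apply: le_trans (psiK _ _ (clampI s) (clampI t)) _.
  by rewrite ler_wpM2l.
have [S [mS S0 subS]] := dpsi; exists S; split => // s /= ns.
apply: subS => /= ds; apply: ns => sab; have dss := ds sab.
apply: near_eq_is_derive dss; near=> t.
have : t \in `]a, b[%R by near: t; apply: near_in_itvoo.
by rewrite in_itv/= => /andP[/ltW at' /ltW tb]; rewrite /= clampE// at'.
Unshelve. all: by end_near. Qed.

End lipschitz_FTC.

(** * Cutoff functions on the strip and their derivatives along curves *)

Section cutoff.
Context {R : realType} (d : nat).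
Notation Z := (R * 'rV[R]_d)%type.
Variable (T : R).

Definition partial_t (phi : Z -> R) : Z -> R := 'D_((1, 0) : Z) phi.
Definition partial_x (i : 'I_d) (phi : Z -> R) : Z -> R := 'D_((0, delta_mx ord0 i) : Z) phi.

Definition box (e r : R) : set Z :=
  [set p : Z | e <= p.1 <= T - e /\ forall i : 'I_d, `|p.2 ord0 i| <= r].

(** Vanishing off a closed box passes at once to products and, the complement of the box being open,
    to derivatives. *)
Record cutoff (phi : Z -> R) : Prop := {
  cutoff_elementary : elementary phi ;
  cutoff01 : forall p, 0 <= phi p <= 1 ;
  cutoff_support : exists e r, [/\ 0 < e, 0 < r & forall p, ~ box e r p -> phi p = 0] }.

Lemma compact_box e r : compact (box e r).
Proof.
have -> : box e r = `[e, T - e] `*` [set x : 'rV[R]_d | forall i, `[- r, r]%classic (x ord0 i)].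
  apply/seteqP; split => -[t x] [] /=; rewrite in_itv/= => tT xr; split => // i.
    by rewrite in_itv/= -ler_norml.
  by have := xr i; rewrite in_itv/= -ler_norml.
apply: compact_setX; first exact: segment_compact.
by apply: (@rV_compact _ _ (fun=> `[- r, r]%classic)) => _; exact: segment_compact.
Qed.

Lemma closed_box e r : closed (box e r).
Proof. by apply: compact_closed; [exact: norm_hausdorff|exact: compact_box]. Qed.

Lemma derive_out (phi : Z -> R) e r v : (forall p, ~ box e r p -> phi p = 0) ->
  forall p, ~ box e r p -> 'D_v phi p = 0.
Proof.
move=> phi0 p np; rewrite (@near_eq_derive _ _ _ _ (cst (0:R))) ?derive_cst//.
have op : open (~` box e r) by rewrite openC; exact: closed_box.
have : nbhs p (~` box e r) by exact: open_nbhs_nbhs.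
by apply: filterS => q /phi0.
Qed.

Lemma cutoff_test phi : cutoff phi -> test_function (strip T d) phi.
Proof.
move=> [ela _ [e [r [e0 r0 phi0]]]].
have sub : closure [set p | phi p != 0] `<=` box e r.
  rewrite closureE; apply: smallest_sub; first exact: closed_box.
  by move=> p /= pn; apply: contrapT => /phi0 p0; rewrite p0 eqxx in pn.
split; first exact: elementary_smooth.
- apply: (subclosed_compact _ (@compact_box e r)) => //; exact: closed_closure.
- move=> p /sub [/andP[p1 p2] _]; split => //=; rewrite in_itv/=.
  by rewrite (lt_le_trans e0 p1) (le_lt_trans p2)// ltrBlDr ltrDl.
Qed.

Lemma elementary_bounded_box (phi : Z -> R) e r : elementary phi ->
  (forall p, ~ box e r p -> phi p = 0) -> exists2 K : R, 0 < K & forall p, `|phi p| <= K.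
Proof.
move=> ela phi0.
have cphi : continuous phi by move=> p; exact/differentiable_continuous/elementary_diff.
have [M [Mr MK]] := compact_bounded (continuous_compact (continuous_subspaceT cphi) (@compact_box e r)).
exists (`|M| + 1) => [|p]; first by rewrite ltr_wpDl.
have [bp|/phi0 ->] := pselect (box e r p); last by rewrite normr0 ltW// ltr_wpDl.
apply: (MK (`|M| + 1)); last by exists p.
by rewrite (le_lt_trans (ler_norm M))// ltrDl.
Qed.

Lemma derivatives_bounded phi : cutoff phi -> exists2 K : R, 0 < K &
  forall p, `|partial_t phi p| <= K /\ forall i, `|partial_x i phi p| <= K.
Proof.
move=> [ela _ [e [r [e0 r0 phi0]]]].
have bd v : exists2 K : R, 0 < K & forall p, `|'D_v phi p| <= K.
  apply: (@elementary_bounded_box _ e r); first exact: elementary_derive.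
  exact: derive_out.
have [K0 K00 Kt] := bd (1, 0).
have /choice[Kx KxP] : forall i : 'I_d, exists K, 0 < K /\ forall p, `|partial_x i phi p| <= K.
  by move=> i; have [K K1 KP] := bd (0, delta_mx ord0 i); exists K.
exists (K0 + \sum_i Kx i) => [|p].
  by rewrite ltr_wpDr// sumr_ge0// => i _; have [/ltW] := KxP i.
have s0 : 0 <= \sum_i Kx i by rewrite sumr_ge0// => i _; have [/ltW] := KxP i.
split; first by rewrite (le_trans (Kt p))// lerDl.
move=> i; have [_ /(_ p) h] := KxP i; rewrite (le_trans h)//.
rewrite (bigD1 i)//= addrCA lerDl; apply: addr_ge0; first exact: ltW.
by rewrite sumr_ge0// => j _; have [/ltW] := KxP j.
Qed.

Lemma diff_coordinates (phi : Z -> R) p (v : Z) : differentiable phi p ->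
  'd phi p v = v.1 * partial_t phi p + \sum_i v.2 ord0 i * partial_x i phi p.
Proof.
move=> dphi; rewrite [in LHS](coordinates_sum v) linearD linearZ linear_sum/=.
rewrite /partial_t deriveE//; congr (_ + _).
by apply: eq_bigr => i _; rewrite linearZ/= /partial_x deriveE.
Qed.

Lemma is_derive_comp_diff (phi : Z -> R) (c : R -> Z) (s : R) (v : Z) :
  differentiable phi (c s) -> is_derive s (1 : R) c v ->
  is_derive s (1 : R) (phi \o c) ('d phi (c s) v).
Proof.
move=> dphi [/derivable1_diffP dc <-].
have dpc : differentiable (phi \o c) s by exact: differentiable_comp.
apply: DeriveDef; first exact/derivable1_diffP.
by rewrite deriveE// diff_comp//= deriveE.
Qed.

Lemma elementary_lipschitz phi K : elementary phi ->
  (forall p, `|partial_t phi p| <= K /\ forall i, `|partial_x i phi p| <= K) ->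
  forall p q, `|phi p - phi q| <= K * (`|p.1 - q.1| + \sum_(i < d) `|p.2 ord0 i - q.2 ord0 i|).
Proof.
move=> ela phiK p q; pose c (r : R) : Z := q + r *: (p - q).
have dc r : is_derive r (1 : R) c (p - q).
  have dl : differentiable ( *:%R^~ (p - q) : R -> Z) r by [].
  have dd : is_derive r (1 : R) (cst q + ( *:%R^~ (p - q) : R -> Z)) (0 + (p - q)).
    apply: is_deriveD; apply: DeriveDef; first exact/derivable1_diffP.
    by rewrite deriveE// diff_val scale1r.
  by rewrite add0r in dd.
have dphi r := is_derive_comp_diff (elementary_diff ela (c r)) (dc r).
have [r _] : exists2 r, r \in `[(0:R), 1]%R & (phi \o c) 1 - (phi \o c) 0 = 'd phi (c r) (p - q) * (1 - 0).
  apply: (@MVT_segment _ (phi \o c) (fun r => 'd phi (c r) (p - q))) => //.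
  apply: continuous_subspaceT => x.
  by apply/differentiable_continuous/derivable1_diffP; have [] := dphi x.
have -> : (phi \o c) 1 = phi p by rewrite /comp /c scale1r addrC subrK.
have -> : (phi \o c) 0 = phi q by rewrite /comp /c scale0r addr0.
rewrite subr0 mulr1 => ->.
rewrite diff_coordinates; last exact: elementary_diff.
apply: (le_trans (ler_normD _ _)); rewrite mulrDr; apply: lerD.
  rewrite normrM mulrC ler_wpM2r//; have [h _] := phiK (q + r *: (p - q)); exact: h.
rewrite (le_trans (ler_norm_sum _ _ _))// mulr_sumr; apply: ler_sum => i _.
rewrite normrM mulrC !mxE ler_wpM2r//; have [_ h] := phiK (q + r *: (p - q)); exact: h.
Qed.

Lemma curve_derivative (phi : Z -> R) (c : R -> 'rV[R]_d) s (v : 'rV[R]_d) :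
  elementary phi -> is_derive s (1 : R) c v ->
  is_derive s (1 : R) (fun t => phi (t, c t))
    (partial_t phi (s, c s) + \sum_i v ord0 i * partial_x i phi (s, c s)).
Proof.
move=> ela dc.
have [/derivable1_diffP ddc ddE] := dc.
have dpair : is_derive s (1 : R) (fun t => (t, c t) : Z) (1, v).
  have dd : differentiable (fun t => (t, c t) : Z) s by exact: differentiable_pair.
  apply: DeriveDef; first exact/derivable1_diffP.
  by rewrite deriveE// diff_pair//= -ddE deriveE// diff_val.
have := is_derive_comp_diff (elementary_diff ela (s, c s)) dpair.
by rewrite diff_coordinates ?mul1r//; exact: elementary_diff.
Qed.

End cutoff.

Section curve_balance.
Context {R : realType} (d : nat) (T : R).
Hypothesis T0 : 0 < T.
Notation mu := (@lebesgue_measure R).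
Notation Z := (R * 'rV[R]_d)%type.
Context (eta : R -> R) (dF : R -> 'rV[R]_d).
Hypotheses (seta : smooth eta) (eta0 : forall v : R, 0 <= derive1n 2 eta v).
Hypothesis cdF : forall i, continuous (fun v => dF v ord0 i).

Definition characteristic (g : curve T d) := {ae mu, forall t, `[0, T[%classic t ->
  is_derive (t : R) (1 : R) (position g) (dF (level g t))}.

Definition transport_derivative (phi : Z -> R) (s : R) (x : 'rV[R]_d) (v : R) : R :=
  partial_t phi (s, x) + \sum_i dF v ord0 i * partial_x i phi (s, x).

Context (g : curve T d) (phi : Z -> R).
Hypotheses (cg : characteristic g) (cphi : cutoff T phi).

Let psi (t : R) := phi (t, position g t).
Let psid (s : R) := transport_derivative phi s (position g s) (level g s).
Let W := derive1 eta.
Let w := derive1n 2 eta.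

Let mpsid : measurable_fun [set: measurableTypeR R] (psid : measurableTypeR R -> R).
Proof.
have ela := cutoff_elementary cphi.
have mc := measurable_position T0 g.
have [P [N [H [fPN _ _]]]] := bv_jordan_exists (curve_BV2 g) T0 (level_out g).
have mp (f : Z -> R) : elementary f ->
    measurable_fun [set: measurableTypeR R] (fun s : measurableTypeR R => f (s, position g s)).
  move=> ef; apply: (measurableT_comp (measurable_elementary ef)).
  exact: measurable_fun_pair.
apply: measurable_funD; first by apply: mp; exact: elementary_derive.
apply: measurable_sum => i; apply: measurable_funM; last by apply: mp; exact: elementary_derive.
apply: (measurableT_comp (continuous_measurable_fun (@cdF i))).
exact: (bv_measurable fPN).
Qed.

Let psi_lipschitz : exists2 K : R, 0 < K & forall s t, `[0, T[%classic s ->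
  `[0, T[%classic t -> `|psi s - psi t| <= K * `|s - t|.
Proof.
have [K K0 phiK] := derivatives_bounded cphi.
have [C C0 gC] := position_lipschitz g.
exists (K * (1 + d%:R * C)) => [|s t sT tT].
  by rewrite mulr_gt0// ltr_wpDr// mulr_ge0// ltW.
apply: le_trans (elementary_lipschitz (cutoff_elementary cphi) phiK _ _) _.
rewrite -mulrA ler_wpM2l ?(ltW K0)//= mulrDl mul1r lerD2l.
apply: (@le_trans _ _ (\sum_(i < d) C * `|s - t|)).
  apply: ler_sum => i _; apply: le_trans _ (gC s t sT tT).
  by have := coord_norm_le (position g s - position g t) ord0 i; rewrite !mxE.
by rewrite sumr_const card_ord -[leLHS]mulr_natl mulrA.
Qed.

Let psi_increment a b : 0 <= a -> a < b -> b < T ->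
  psi b - psi a = (\int[mu]_(s in `]a, b[) psid s)%R.
Proof.
move=> a0 ab bT; have [K K0 psiK] := psi_lipschitz; apply/esym.
apply: (@lipschitz_FTC_itv _ psi psid K a b ab).
- move=> s t /andP[s1 s2] /andP[t1 t2]; apply: psiK; rewrite /= in_itv/=.
    by rewrite (le_trans a0 s1) (le_lt_trans s2).
  by rewrite (le_trans a0 t1) (le_lt_trans t2).
- exact: measurable_funTS.
- have [S [mS S0 subS]] := cg; exists S; split => // s /= ns.
  apply: subS => /= ds; apply: ns; rewrite in_itv/= => /andP[as' sb].
  have sT : `[0, T[%classic s.
    by rewrite /= in_itv/= (le_trans a0 (ltW as'))/= (lt_trans sb).
  exact: (curve_derivative (cutoff_elementary cphi) (ds sT)).
Qed.

Let psid_bounded : exists2 C : R, 0 <= C & forall s, `|psid s| <= C.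
Proof.
have [K K0 phiK] := derivatives_bounded cphi.
have [P [N [H [fPN _ _]]]] := bv_jordan_exists (curve_BV2 g) T0 (level_out g).
pose b := bv_bound (level g) P N.
have /choice[C CP] : forall i, exists C : R, forall v : R, `|v| <= b -> `|dF v ord0 i| <= C.
  by move=> i; have [C _ CP] := continuous_bounded_ball b (@cdF i); exists C.
have C0 i : 0 <= C i.
  apply: le_trans (normr_ge0 _) (CP i 0 _); rewrite normr0.
  exact: le_trans (normr_ge0 _) (bv_boundP fPN 0).
exists (K + \sum_i C i * K) => [|s].
  by rewrite addr_ge0 ?(ltW K0)// sumr_ge0// => i _; rewrite mulr_ge0 ?(ltW K0).
have [h1 h2] := phiK (s, position g s).
rewrite (le_trans (ler_normD _ _))// lerD// (le_trans (ler_norm_sum _ _ _))//.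
apply: ler_sum => i _; rewrite normrM; apply: ler_pM (normr_ge0 _) (normr_ge0 _) _ (h2 i).
by apply: CP; exact: (bv_boundP fPN).
Qed.

(** Summation by parts puts the increments on [psi], which is Lipschitz with a derivative prescribed
    almost everywhere by the characteristic equation. They are then integrals of [psid], and no
    chain rule for BV functions enters. *)
Lemma curve_balance :
  riemann_sum T (level g) w psi n @[n --> \oo] -->
  - (\int[mu]_(s in `]0%R, T[) (W (level g s) * psid s))%R.
Proof.
have [P [N [H [fPN _ _]]]] := bv_jordan_exists (curve_BV2 g) T0 (level_out g).
have cw : continuous w by exact/smooth_continuous/smooth_derive1/smooth_derive1.
have dW (x : R) : is_derive x (1 : R) W (w x) by exact/smooth_is_derive/smooth_derive1.
have cW : continuous W by exact/smooth_continuous/smooth_derive1.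
have [ela phi01 [e [r [e0 r0 phi0]]]] := cphi.
pose f := level g.
have psi_0 : psi 0 = 0.
  by apply: phi0 => -[/= /andP[]]; rewrite leNgt e0.
(* The last grid point used is T - T / (n+1), beyond the support of [phi] once T / (n+1) < e. With
   [psi_0] this removes both boundary terms of the summation by parts. *)
have psi_n : \forall n \near \oo, psi (grid T n n) = 0.
  have h : T / n.+1%:R @[n --> \oo] --> (0 : R).
    by rewrite -(mulr0 T); apply: cvgM; [exact: cvg_cst|exact: cvg_harmonic].
  near=> n; apply: phi0 => -[/= /andP[_ tT] _]; move: tT; apply/negP; rewrite -ltNge.
  have -> : grid T n n = T - T / n.+1%:R.
    have := grid_step T n n; rewrite {1}/grid mulrAC divff ?mul1r ?pnatr_eq0// => <-; ring.
  by rewrite ltrD2l ltrN2; near: n; exact: cvgr_lt h _ e0.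
pose a n i := W (f (grid T n i)).
have mI : measurable (`]0, T[ : set (measurableTypeR R)) by exact: measurable_itv.
have [C C0 psidC] := psid_bounded.
have Too : (mu `]0%R, T[%classic < +oo)%E.
  by rewrite lebesgue_measure_itv/=; case: ifP => _; rewrite ?ltry// -EFinB ltry.
have sumE : \forall n \near \oo, riemann_sum T f w psi n =
    - (\int[mu]_(s in `]0%R, T[) (step_function T (a n) n s * psid s))%R.
  near=> n.
  have -> : riemann_sum T f w psi n = - \sum_(i < n) a n i * (psi (grid T n i.+1) - psi (grid T n i)).
    have tel : \sum_(i < n) (psi (grid T n i.+1) * a n i.+1 - psi (grid T n i) * a n i) = 0.
      rewrite -(big_mkord xpredT (fun i => psi (grid T n i.+1) * a n i.+1 - psi (grid T n i) * a n i)).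
      rewrite (telescope_sumr (fun i => psi (grid T n i) * a n i))//.
      rewrite (_ : grid T n 0 = 0); last by rewrite /grid !mul0r.
      rewrite psi_0 mul0r subr0 (_ : psi (grid T n n) = 0) ?mul0r//.
      by near: n.
    transitivity (riemann_sum T f w psi n - \sum_(i < n) (psi (grid T n i.+1) * a n i.+1 - psi (grid T n i) * a n i)).
      by rewrite tel subr0.
    rewrite /riemann_sum -sumrB -sumrN.
    apply: eq_bigr => i _; rewrite (slope_increment cw eta0 _ _ dW) /a; ring.
  congr (- _).
  have mcell i : measurable (`]grid T n i, grid T n i.+1] : set (measurableTypeR R)).
    exact: measurable_itv.
  have int0 : mu.-integrable `]0, T[ (EFin \o psid).
    by apply: (bounded_integrable_fin mI Too _ (fun s _ => psidC s)); exact: measurable_funTS.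
  have ic i : mu.-integrable `]0, T[
      (EFin \o (fun s => \1_(`]grid T n i, grid T n i.+1]) s * psid s)).
    apply: (@integrableM_bounded _ _ _ _ _ mI _ _ 1) => //.
    by move=> s _; rewrite indicE; case: (_ \in _); rewrite ?normr1 ?normr0.
  have cellE (i : nat) : (i < n)%N ->
      (\int[mu]_(s in `]0%R, T[) (\1_(`]grid T n i, grid T n i.+1]) s * psid s))%R =
      psi (grid T n i.+1) - psi (grid T n i).
    move=> ni; have sub : `]grid T n i, grid T n i.+1] `<=` (`]0, T[ : set R).
      move=> s; rewrite /= !in_itv/= => /andP[s1 s2].
      by rewrite (le_lt_trans (grid_ge0 T0 n i) s1) (le_lt_trans s2)// grid_ltT.
    rewrite psi_increment ?grid_ge0 ?grid_lt ?grid_ltT//.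
    rewrite [in RHS]Rintegral_itv_bndo_bndc; last first.
      apply: (integrableS mI _ _ int0); first exact: measurable_itv.
      apply: subset_trans sub; exact: subset_itv_oo_oc.
    rewrite -[in RHS](setIidr sub) Rintegral_mkcondr.
    apply: eq_Rintegral => s _; rewrite patchE indicE.
    by case: (s \in _); rewrite ?mul1r ?mul0r.
  apply/esym; transitivity (\int[mu]_(s in `]0%R, T[)
      (\sum_(i < n) a n i * (\1_(`]grid T n i, grid T n i.+1]) s * psid s)))%R.
    apply: eq_Rintegral => s _.
    by rewrite /step_function mulr_suml; apply: eq_bigr => i _; rewrite mulrA.
  rewrite /Rintegral; under eq_integral do rewrite -sumEFin.
  rewrite (@integral_sum _ _ _ mu `]0, T[ mI 'I_n (fun i s =>
    (a n i * (\1_(`]grid T n i, grid T n i.+1]) s * psid s))%:E))//; last first.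
    by move=> i; exact: integrableZ_EFin.
  rewrite (eq_bigr (fun i : 'I_n => (a n i * (psi (grid T n i.+1) - psi (grid T n i)))%:E)) ?sumEFin//.
  move=> i _; rewrite -cellE// -RintegralZl// /Rintegral fineK//.
  by apply: integrable_fin_num => //; exact: integrableZ_EFin.
have [CW CW0 WC] : exists2 C : R, 0 <= C & forall s, `|W (f s)| <= C.
  have [C' C'0 CP] := continuous_bounded_ball (bv_bound f P N) cW.
  by exists C' => [|s]; [exact: ltW|apply: CP; exact: (bv_boundP fPN)].
have mf : measurable_fun [set: measurableTypeR R] (f : measurableTypeR R -> R).
  exact: (bv_measurable fPN).
have lim : (\int[mu]_(s in `]0%R, T[) (step_function T (a n) n s * psid s) @[n --> \oo] -->
    \int[mu]_(s in `]0%R, T[) (W (f s) * psid s))%R.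
  apply: (@dominated_cvg_Rintegral _ _ R mu `]0, T[
    (fun n s => step_function T (a n) n s * psid s) (fun s => W (f s) * psid s) (cst (CW * C))) => //.
  - move=> n; apply: measurable_funTS; apply: measurable_funM => //.
    exact: measurable_step_function.
  - apply: measurable_funTS; apply: measurable_funM => //.
    exact: (measurableT_comp (continuous_measurable_fun cW)).
  (* The sums retain the values at left endpoints, which tend to the left limit. This differs from
     the value only at atoms, a countable set and hence null. *)
  - pose J := [set s | f s != left_lim f P N s].
    have cJ : countable J.
      have cPN : countable (\bigcup_(b in [set: bool])
          (if b then [set t | P [set t] != 0%E] else [set t | N [set t] != 0%E])).
        by apply: bigcup_countable => // -[] _; exact: countable_atoms.
      apply: sub_countable cPN; apply: subset_card_le => t; rewrite /J/= => ft.
      have [P0|] := eqVneq (P [set t]) 0%E; last by exists true.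
      exists false => //=; apply: contra ft => /eqP N0.
      by rewrite /left_lim P0 N0 subrr subr0.
    exists J; split => [||s /= ns].
    + by apply: countable_measurable => // t; exact: measurable_set1.
    + exact: countable_lebesgue_measure0.
    + rewrite /J/=; apply/negP => /eqP fs; apply: ns; rewrite in_itv/= => /andP[s0 sT].
      apply: cvgM; last exact: cvg_cst.
      apply: step_function_cvg => // k kP; apply: continuous_cvg; first exact: cW.
      rewrite fs; apply: (bv_left_cvg fPN) => //; last exact: grid_cell_cvgl.
      by move=> n; have /andP[] := kP n.
  - exact: (@bounded_integrable_fin _ _ _ _ _ _ `|CW * C| mI Too).
  - move=> n s _; rewrite normrM ler_pM//; apply: step_function_le => // i; exact: WC.
apply: cvg_trans (cvgN lim); apply: near_eq_cvg; near=> n.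
by apply/esym; near: n.
Unshelve. all: by end_near. Qed.

End curve_balance.

(** The integral of a nonnegative function is a supremum over simple functions below it.
    Monotonicity thus applies to [Tot_Var], whose measurability in the curve is not established. *)
Lemma ge0_le_integral_any d (X : measurableType d) (R : realType)
    (m : {measure set X -> \bar R}) (f g : X -> \bar R) :
  (forall x, 0 <= f x)%E -> (forall x, f x <= g x)%E ->
  (\int[m]_x f x <= \int[m]_x g x)%E.
Proof.
move=> f0 fg; have g0 x : (0 <= g x)%E by exact: le_trans (f0 x) (fg x).
rewrite !ge0_integralTE//; apply: le_ereal_sup => _ [h hf <-]; exists h => // x.
exact: le_trans (hf x) (fg x).
Qed.

Lemma measurable_subgraph (R : realType) (d : nat) (v : 'rV[R]_d -> R) :
  measurable_fun setT v -> measurable (subgraph v).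
Proof.
move=> mv; have ms : measurable_fun setT (fun p : 'rV[R]_d * R => p.2) by exact: measurable_snd.
have mf : measurable_fun setT (fun p : 'rV[R]_d * R => v p.1 - p.2).
  by apply: measurable_funB => //; exact: (measurableT_comp mv measurable_fst).
rewrite (_ : subgraph v = (fun p : 'rV[R]_d * R => p.2) @^-1` `[0, +oo[ `&`
    (fun p : 'rV[R]_d * R => v p.1 - p.2) @^-1` `[0, +oo[).
  apply: measurableI; rewrite -[X in measurable X]setTI;
    [apply: ms|apply: mf] => //; exact: measurable_itv.
apply/seteqP; split => p /=; rewrite !in_itv/= !andbT subr_ge0.
  by move=> /andP[].
by move=> [p0 pv]; apply/andP.
Qed.

(** For almost every x the section of the set above x is empty. *)
Lemma subgraph_null (R : realType) (d : nat) (v : 'rV[R]_d -> R) (M : R) :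
  measurable_fun setT v -> {ae lebesgue_rV d, forall x, 0 <= v x <= M} ->
  (lebesgue_rV d \x lebesgue_measure)%E ([set p | M < p.2] `&` subgraph v) = 0%E.
Proof.
move=> mv vM; have vM' : {ae lebesgue_rV d, forall x, v x <= M}.
  by apply: filterS vM => x /andP[].
have mM : measurable [set p : 'rV[R]_d * R | M < p.2].
  rewrite (_ : [set _ | _] = snd @^-1` `]M, +oo[); last first.
    by apply/seteqP; split => p /=; rewrite in_itv/= andbT.
  by rewrite -[X in measurable X]setTI; apply: measurable_snd => //; exact: measurable_itv.
have mA : measurable ([set p : 'rV[R]_d * R | M < p.2] `&` subgraph v).
  by apply: measurableI => //; exact: measurable_subgraph.
rewrite /product_measure1 (@ge0_ae_eq_integral _ _ _ _ setT _ (cst 0%E))//.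
- exact: integral0.
- exact: measurable_fun_xsection.
- apply: filterS vM' => x vx _; rewrite /= (_ : xsection _ _ = set0) ?measure0//.
  apply/seteqP; split => // y; rewrite /xsection/= => /set_mem[/= My /andP[_ yv]].
  by move: (lt_le_trans My (le_trans yv vx)); rewrite ltxx.
Qed.

(** * Integration over the curves *)

Section lagrangian.
Context {R : realType} (d : nat) (T : R).
Hypothesis T0 : 0 < T.
Context (u : R -> 'rV[R]_d -> R) (omega : {finite_measure set (Gamma T d) -> \bar R}).
Hypothesis marginal : forall t, `[0, T[ t -> forall A : set ('rV[R]_d * R),
    measurable A ->
    pushforward omega (fun g : curve T d => g t) A =
      (lebesgue_rV d \x lebesgue_measure)%E (A `&` subgraph (u t)).
Hypothesis mu_ : forall t, `[0, T[%classic t -> measurable_fun setT (u t).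
Hypothesis variation_oo : (\int[omega]_g Tot_Var T (fun t => ((g : curve T d) t).2) < +oo)%E.
Context (M : R).
Hypotheses (M0 : 0 <= M) (u_M : forall t, `[0, T[%classic t -> {ae lebesgue_rV d, forall x, 0 <= u t x <= M}).

(** At each rational time the marginal gives a null set of curves exceeding M. A curve exceeding M
    at some time does so, by right-continuity, at a rational time shortly after. *)
Lemma level_ae_le : {ae omega, forall g : Gamma T d, forall t, level g t <= M}.
Proof.
pose N (q : rat) : set (Gamma T d) := [set g | M < level g (ratr q)].
have N0 q : omega (N q) = 0%E.
  have [qT|qT] := pselect (`[0, T[%classic (ratr q : R)); last first.
    rewrite (_ : N q = set0) ?measure0//; apply/seteqP; split => // g.
    by rewrite /N/= level_out// ltNge M0.
  have mA : measurable [set p : 'rV[R]_d * R | M < p.2].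
    rewrite (_ : [set _ | _] = snd @^-1` `]M, +oo[); last first.
      by apply/seteqP; split => p /=; rewrite in_itv/= andbT.
    by rewrite -[X in measurable X]setTI; apply: measurable_snd => //; exact: measurable_itv.
  have := marginal qT mA; rewrite subgraph_null; [exact|exact: mu_|exact: u_M].
pose N' n : set (Gamma T d) := if @choice.unpickle rat n is Some q then N q else set0.
have mN' n : measurable (N' n).
  rewrite /N'; case: choice.unpickle => [q|//].
  rewrite (_ : N q = (fun g : Gamma T d => level g (ratr q)) @^-1` `]M, +oo[); last first.
    by apply/seteqP; split => g /=; rewrite in_itv/= andbT.
  by rewrite -[X in measurable X]setTI; apply: measurable_level_at => //; exact: measurable_itv.
have : omega.-negligible (\bigcup_n N' n).
  apply: negligible_bigcup => n; exists (N' n); split => //.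
  by rewrite /N'; case: choice.unpickle => [q|]; [exact: N0|exact: measure0].
apply: negligibleS => g /= ng; apply: contrapT => gN; apply: ng => t.
rewrite leNgt; apply/negP => Mt; apply: gN.
have tT : `[0, T[%classic t.
  by apply: contrapT => tT; move: Mt; rewrite level_out// ltNge M0.
have [e /= e0 eP] := cvgr_gt _ (level_right_cvg (g := g) tT) _ Mt.
have te : t < t + e by rewrite ltrDl.
have [q] := rat_in_itvoo te; rewrite in_itv/= => /andP[tq qe].
have Nq : N q g.
  apply: (eP (ratr q)); last by [].
  by rewrite /= ltr_norml; apply/andP; split; lra.
by exists (choice.pickle q); [exact: I|rewrite /N' choice.pickleK].
Qed.

Definition curve_variation (g : Gamma T d) : \bar R :=
  esups (fun n => (variation_sum T (level g) n)%:E) 0%N.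

Lemma measurable_curve_variation : measurable_fun setT curve_variation.
Proof.
apply: measurable_fun_esups => n; apply/measurable_EFinP.
rewrite /variation_sum; apply: measurable_sum => i.
apply: (measurableT_comp (@normr_measurable _ _)); apply: measurable_funB; exact: measurable_level_at.
Qed.

Lemma curve_variation_ge n g : ((variation_sum T (level g) n)%:E <= curve_variation g)%E.
Proof. by apply: ereal_sup_ubound; exists n. Qed.

Lemma curve_variation_ge0 g : (0 <= curve_variation g)%E.
Proof.
by apply: le_trans (curve_variation_ge 0 g); rewrite lee_fin sumr_ge0.
Qed.

Lemma integrable_curve_variation : omega.-integrable setT curve_variation.
Proof.
apply/integrableP; split; first exact: measurable_curve_variation.
under eq_integral do rewrite gee0_abs ?curve_variation_ge0//.
apply: le_lt_trans variation_oo; apply: ge0_le_integral_any => g; first exact: curve_variation_ge0.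
by apply: ge_ereal_sup => _ [n _ <-]; exact: variation_sum_le_Tot_Var.
Qed.

Context (eta : R -> R).
Hypotheses (seta : smooth eta) (eta0 : forall v : R, 0 <= derive1n 2 eta v).

(** One majorant serves for the production of every set and for all Riemann sums. The constant is
    doubled because each Jordan part is bounded by C times the variation. *)
Lemma production_bound : exists2 C : R, 0 < C & forall g : Gamma T d,
  (forall t, level g t <= M) ->
  (forall B, measurable B -> (`|curve_production eta g B| <= C%:E * curve_variation g)%E) /\
  (forall (a : R * 'rV[R]_d -> R) n, (forall p, 0 <= a p <= 1) ->
    (`|(riemann_sum T (level g) (derive1n 2 eta) (fun t => a (t, position g t)) n)%:E| <=
      C%:E * curve_variation g)%E).
Proof.
pose w := derive1n 2 eta.
have cw : continuous w by exact/smooth_continuous/smooth_derive1/smooth_derive1.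
have [C C1 CP] := continuous_bounded_ball M cw.
have wC v : `|v| <= M -> w v <= C by move=> /CP; exact: le_trans (ler_norm _).
exists (C + C) => [|g gM]; first by rewrite addr_gt0.
(* A curve of infinite variation makes the right-hand side infinite since C + C > 0; otherwise the
   variation is a real number bounding all the variation sums. *)
have CV x : (forall r, (forall n, variation_sum T (level g) n <= r) -> `|x| <= (C + C) * r) ->
    (`|x%:E| <= (C + C)%:E * curve_variation g)%E.
  move=> h; have := curve_variation_ge0 g; have := fun n => curve_variation_ge n g.
  case: (curve_variation g) => [r| |] hr r0.
  - by rewrite -EFinM lee_fin; apply: h => n; rewrite -lee_fin.
  - by rewrite gt0_muley ?leey// lte_fin addr_gt0.
  - by move: r0; rewrite leeNy_eq.
split => [B mB|a n a01].
  have [nu [CE bnd _ _]] := curve_production_charge T0 seta eta0 g.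
  rewrite CE// -[nu B]fineK ?fin_num_measure//; apply: CV => r hr; rewrite mulrDl.
  apply: (bnd M C r gM _ hr) => // v /andP[v0 vM].
  by apply: wC; rewrite ger0_norm.
apply: CV => r hr; have r0 : 0 <= r by apply: le_trans (hr 0); rewrite sumr_ge0.
apply: (@le_trans _ _ (C * variation_sum T (level g) n)); last first.
  by rewrite (le_trans (ler_wpM2l (ltW C1) (hr n)))// ler_wpM2r// lerDl ltW.
rewrite /riemann_sum /variation_sum (le_trans (ler_norm_sum _ _ _))// mulr_sumr.
apply: ler_sum => i _; have /andP[a0 a1] := a01 (grid T n i.+1, position g (grid T n i.+1)).
have s0 := slope_ge0 eta0 (level g (grid T n i)) (level g (grid T n i.+1)).
have lM t : `|level g t| <= M by rewrite ger0_norm ?gM//; exact: curve_ge0.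
rewrite !normrM (ger0_norm a0) (ger0_norm s0) mulrA ler_wpM2r//.
rewrite -[leRHS]mul1r ler_pM//.
exact: (slope_le cw eta0 wC).
Qed.

Lemma integrable_curve_production B : measurable B ->
  omega.-integrable setT (fun g : Gamma T d => curve_production eta g B).
Proof.
move=> mB; have [C C0 CV] := production_bound.
apply/integrableP; split; first exact: measurable_curve_production.
have iV : omega.-integrable setT (fun g => C%:E * curve_variation g)%E.
  by apply: integrableZl => //; exact: integrable_curve_variation.
have := integrableP _ _ _ iV => -[mV]; apply: le_lt_trans.
apply: ae_ge0_le_integral => //.
- by apply: measurableT_comp => //; exact: measurable_curve_production.
- exact: measurableT_comp.
- apply: filterS level_ae_le => g gM _.
  have [/(_ B mB) h _] := CV g gM; apply: le_trans h (lee_abs _).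
Qed.

End lagrangian.

(** * Exchange of integrals for bounded kernels; integrals of derivatives vanish *)

Section bounded_kernel.
Context d1 d2 (X : measurableType d1) (Y : measurableType d2) (R : realType).
Context (m1 : {sigma_finite_measure set X -> \bar R})
  (m2 : {sigma_finite_measure set Y -> \bar R}).

(** Boundedness with support in a product of sets of finite measure makes all inner integrals finite
    at every point, not merely almost everywhere, so that the exchange can be stated with
    real-valued integrals. *)
Record bounded_kernel (k : X * Y -> R) (A : set X) (B : set Y) (C : R) : Prop := {
  bk_mA : measurable A ; bk_mB : measurable B ;
  bk_Aoo : (m1 A < +oo)%E ; bk_Boo : (m2 B < +oo)%E ;
  bk_meas : measurable_fun setT k ;
  bk_le : forall p, `|k p| <= C ;
  bk_supp : forall p, ~ (A p.1 /\ B p.2) -> k p = 0 }.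

Context (k : X * Y -> R) (A : set X) (B : set Y) (C : R).
Hypothesis bk : bounded_kernel k A B C.

Let integrable_supp d (Z : measurableType d) (m : {measure set Z -> \bar R}) (D : set Z)
    (f : Z -> R) : measurable D -> (m D < +oo)%E -> measurable_fun setT f ->
  (forall z, `|f z| <= C) -> (forall z, ~ D z -> f z = 0) -> m.-integrable setT (EFin \o f).
Proof.
move=> mD Doo mf fC f0.
have : m.-integrable D (EFin \o f).
  by apply: (bounded_integrable_fin mD Doo _ (fun z _ => fC z)); exact: measurable_funTS.
rewrite (integrable_mkcond _ mD) (_ : _ \_ D = EFin \o f)//.
apply/funext => z; rewrite patchE; case: ifPn => // /negP zD.
by rewrite /= f0// => Dz; apply: zD; exact: mem_set.
Qed.

Lemma bk_integrable : (m1 \x m2)%E.-integrable setT (EFin \o k).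
Proof.
apply: (@integrable_supp _ _ _ (A `*` B)).
- by apply: measurableX; [exact: bk_mA bk|exact: bk_mB bk].
- rewrite /= product_measure1E; [|exact: bk_mA bk|exact: bk_mB bk].
  have := bk_Aoo bk; have := bk_Boo bk.
  rewrite -!ge0_fin_numE ?mule_ge0// => h1 h2; exact: fin_numM.
- exact: bk_meas bk.
- exact: bk_le bk.
- exact: bk_supp bk.
Qed.

Lemma bk_integrable2 x : m2.-integrable setT (EFin \o (fun y => k (x, y))).
Proof.
apply: (@integrable_supp _ _ _ B); [exact: bk_mB bk|exact: bk_Boo bk| | |].
- by apply: (measurableT_comp (bk_meas bk)); exact: measurable_pair1.
- by move=> y; exact: bk_le bk _.
- by move=> y nB; apply: (bk_supp bk) => -[].
Qed.

Lemma bk_integrable1 y : m1.-integrable setT (EFin \o (fun x => k (x, y))).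
Proof.
apply: (@integrable_supp _ _ _ A); [exact: bk_mA bk|exact: bk_Aoo bk| | |].
- by apply: (measurableT_comp (bk_meas bk)); exact: measurable_pair2.
- by move=> x; exact: bk_le bk _.
- by move=> x nA; apply: (bk_supp bk) => -[].
Qed.

Lemma bk_Rintegral1 x : ((\int[m2]_y k (x, y))%R%:E = \int[m2]_y (k (x, y))%:E)%E.
Proof. by rewrite /Rintegral fineK//; apply: integrable_fin_num => //; exact: bk_integrable2. Qed.

Lemma bk_Rintegral2 y : ((\int[m1]_x k (x, y))%R%:E = \int[m1]_x (k (x, y))%:E)%E.
Proof. by rewrite /Rintegral fineK//; apply: integrable_fin_num => //; exact: bk_integrable1. Qed.

Lemma bk_integrableF : m1.-integrable setT (EFin \o (fun x => \int[m2]_y k (x, y))%R).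
Proof.
rewrite (_ : _ \o _ = fubini_F m2 (EFin \o k)); last by apply/funext => x; exact: bk_Rintegral1.
exact: integrable_fubini_F bk_integrable.
Qed.

Lemma bk_integrableG : m2.-integrable setT (EFin \o (fun y => \int[m1]_x k (x, y))%R).
Proof.
rewrite (_ : _ \o _ = fubini_G m1 (EFin \o k)); last by apply/funext => x; exact: bk_Rintegral2.
have mG := measurable_fubini_G bk_integrable.
apply/integrableP; split => //.
have := (integrable21ltyP m1 m2 (measurable_int _ bk_integrable)).1 bk_integrable.
apply: le_lt_trans; apply: ge0_le_integral => //.
- exact: measurableT_comp.
- apply: (@measurable_fun_fubini_tonelli_G _ _ _ _ _ m1 (abse \o (EFin \o k))) => //=.
  by apply: measurableT_comp => //; exact: measurable_int bk_integrable.
- move=> y _; apply: le_abse_integral => //.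
  by have /integrableP[] := bk_integrable1 y.
Qed.

Lemma bk_product : (\int[(m1 \x m2)%E]_z k z = \int[m1]_x \int[m2]_y k (x, y))%R.
Proof.
rewrite {1}/Rintegral -(integral12_prod_meas1 bk_integrable) [in RHS]/Rintegral.
by congr fine; apply: eq_integral => x _; rewrite bk_Rintegral1.
Qed.

Lemma bk_Fubini : (\int[m1]_x \int[m2]_y k (x, y) = \int[m2]_y \int[m1]_x k (x, y))%R.
Proof.
rewrite -bk_product {1}/Rintegral -(integral21_prod_meas1 bk_integrable) [in RHS]/Rintegral.
by congr fine; apply: eq_integral => x _; rewrite bk_Rintegral2.
Qed.

End bounded_kernel.

Section vanishing_integrals.
Context {R : realType}.
Notation mu := (@lebesgue_measure R).

Definition cube d (r : R) : set 'rV[R]_d := [set x | forall i, `|x ord0 i| <= r].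
Arguments cube : clear implicits.

Lemma measurable_cube d r : measurable (cube d r).
Proof.
rewrite (_ : cube d r = \bigcap_(i in [set: 'I_d]) ((fun x : 'rV[R]_d => x ord0 i) @^-1` `[- r, r])).
  apply: fin_bigcap_measurable => // i _; rewrite -[X in measurable X]setTI.
  by apply: measurable_rV_coord => //; exact: measurable_itv.
apply/seteqP; split => x /= h i; first by move=> _; rewrite /= in_itv/= -ler_norml.
by have := h i I; rewrite /= in_itv/= -ler_norml.
Qed.

Lemma cons_rV0 d (a : R) (x : 'rV[R]_d) : cons_rV (a, x) ord0 ord0 = a.
Proof. by rewrite /cons_rV mxE; case: fintype.splitP => // j _; rewrite mxE. Qed.

Lemma cons_rVS d (a : R) (x : 'rV[R]_d) j : cons_rV (a, x) ord0 (lift ord0 j) = x ord0 j.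
Proof.
rewrite /cons_rV mxE; case: fintype.splitP => [k|k /= /eqP]; first by rewrite ord1.
by rewrite eqSS => /eqP jk; congr (x _ _); exact/val_inj.
Qed.

Lemma cube_cons d r (a : R) (x : 'rV[R]_d) :
  cube d.+1 r (cons_rV (a, x)) <-> `|a| <= r /\ cube d r x.
Proof.
split=> [h|[ar xr] i].
  by split=> [|j]; [have := h ord0; rewrite cons_rV0|have := h (lift ord0 j); rewrite cons_rVS].
by case: (unliftP ord0 i) => [j ->|->]; rewrite ?cons_rV0 ?cons_rVS.
Qed.

Lemma cons_rV_shift0 d (a t : R) (x : 'rV[R]_d) :
  cons_rV (a, x) + t *: delta_mx ord0 ord0 = cons_rV (a + t, x).
Proof.
apply/rowP => i; rewrite [LHS]mxE [X in _ + X]mxE [X in _ * X]mxE eqxx/=.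
case: (unliftP ord0 i) => [j ->|->]; first by rewrite !cons_rVS mulr0 addr0.
by rewrite !cons_rV0 eqxx mulr1.
Qed.

Lemma cons_rV_shift d (a t : R) (x : 'rV[R]_d) j :
  cons_rV (a, x) + t *: delta_mx ord0 (lift ord0 j) = cons_rV (a, x + t *: delta_mx ord0 j).
Proof.
apply/rowP => i; rewrite [LHS]mxE [X in _ + X]mxE [X in _ * X]mxE eqxx/=.
case: (unliftP ord0 i) => [k ->|->]; last by rewrite !cons_rV0 mulr0 addr0.
by rewrite !cons_rVS [RHS]mxE [X in _ = _ + X]mxE [X in _ = _ + _ * X]mxE eqxx/= (inj_eq lift_inj).
Qed.

Let itv_norm (r : R) : [set a | `|a| <= r] = `[- r, r].
Proof. by apply/seteqP; split => a /=; rewrite in_itv/= ler_norml. Qed.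

Let itv_norm_fin (r : R) : (mu [set a : R | (`|a| <= r)%R] < +oo)%E.
Proof. by rewrite itv_norm lebesgue_measure_itv/=; case: ifP => _; rewrite ?ltry// -EFinB ltry. Qed.

Let measurable_itv_norm (r : R) : measurable ([set a | `|a| <= r] : set (measurableTypeR R)).
Proof. by rewrite itv_norm; exact: measurable_itv. Qed.

Lemma lebesgue_cube_fin d r : (lebesgue_rV d (cube d r) < +oo)%E.
Proof.
elim: d => [|d IH]; first by rewrite /= diracE ltry.
have -> : lebesgue_rV d.+1 (cube d.+1 r) = (mu \x lebesgue_rV d)%E ([set a : R | `|a| <= r] `*` cube d r).
  rewrite /= /lebesgue_rVS /pushforward; congr (_ _).
  by apply/seteqP; split => -[a x] /= /cube_cons.
rewrite product_measure1E//; last exact: measurable_cube.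
move: IH (itv_norm_fin r); rewrite -!ge0_fin_numE ?mule_ge0// => h1 h2; exact: fin_numM.
Qed.

Lemma Rintegral_lebesgue_rVS d (k : 'rV[R]_d.+1 -> R) (r C : R) :
  measurable_fun setT k -> (forall x, `|k x| <= C) -> (forall x, ~ cube d.+1 r x -> k x = 0) ->
  (\int[lebesgue_rV d.+1]_x k x = \int[mu]_a \int[lebesgue_rV d]_x k (cons_rV (a, x)))%R /\
  (\int[lebesgue_rV d.+1]_x k x = \int[lebesgue_rV d]_x \int[mu]_a k (cons_rV (a, x)))%R.
Proof.
move=> mk kC k0.
have bk : bounded_kernel mu (lebesgue_rV d) (k \o @cons_rV R d) [set a | `|a| <= r] (cube d r) C.
  split => //.
  - exact: measurable_cube.
  - exact: itv_norm_fin.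
  - exact: lebesgue_cube_fin.
  - exact: (measurableT_comp mk (@measurable_cons_rV R d)).
  - by move=> p; exact: kC.
  - by move=> [a x] n; apply: k0 => /cube_cons.
suff -> : (\int[lebesgue_rV d.+1]_x k x = \int[(mu \x lebesgue_rV d)%E]_p k (cons_rV p))%R.
  by rewrite (bk_product bk); split => //; rewrite (bk_Fubini bk).
rewrite /Rintegral; congr fine.
have mk' : measurable_fun setT (EFin \o k) by exact/measurable_EFinP.
exact: (integral_pushforward (@measurable_cons_rV R d) mk' (bk_integrable bk) measurableT).
Qed.

Lemma integral_derivative_R (h k : R -> R) (r : R) : (forall x, r < `|x| -> h x = 0) ->
  (forall x, r < `|x| -> k x = 0) -> continuous k ->
  (forall x : R, is_derive x (1 : R) h (k x)) -> (\int[mu]_x k x = 0)%R.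
Proof.
move=> h0 k0 ck dh; pose b := `|r| + 1.
have b0 : 0 < b by rewrite ltr_wpDl.
have rb : r < b by rewrite (le_lt_trans (ler_norm r))// ltrDl.
transitivity (\int[mu]_(x in `]- b, b[) k x)%R.
  rewrite [RHS]Rintegral_mkcond; apply: eq_Rintegral => x _; rewrite patchE.
  case: ifPn => // /negP xb; apply: k0; apply: (lt_le_trans rb).
  rewrite leNgt; apply/negP => xb'; apply: xb; apply: mem_set; rewrite /= in_itv/=.
  by rewrite -ltr_norml.
rewrite (integral_derivative_C1 _ ck (fun x _ => dh x)).
  by rewrite !h0 ?subrr ?normrN// gtr0_norm.
by rewrite (@lt_trans _ _ 0)// oppr_lt0.
Qed.

(** Induction on the dimension. When the derivative is along the first coordinate, that coordinate
    is integrated first and the fundamental theorem applies; otherwise it is frozen and the slices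
    fall under the induction hypothesis. *)
Lemma integral_partial_derivative d (i : 'I_d) (h k : 'rV[R]_d -> R) (r C : R) :
  measurable_fun setT k -> (forall x, `|k x| <= C) ->
  (forall x, ~ cube d r x -> h x = 0 /\ k x = 0) ->
  (forall x, is_derive x (delta_mx ord0 i) h (k x)) ->
  (forall x, continuous (fun t : R => k (x + t *: delta_mx ord0 i))) ->
  (\int[lebesgue_rV d]_x k x = 0)%R.
Proof.
elim: d i h k => [[]//|d IH] i h k mk kC hk0 dh ck.
have k0 x : ~ cube d.+1 r x -> k x = 0 by case/hk0.
have [E1 E2] := Rintegral_lebesgue_rVS mk kC k0.
case: (unliftP ord0 i) => [j ij|i0].
  rewrite E1 (_ : (fun a => _) = cst 0)//; first by rewrite Rintegral_cst// mul0r.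
  apply/funext => a /=; apply: (IH j (fun x => h (cons_rV (a, x))) (fun x => k (cons_rV (a, x)))).
  - exact: (measurableT_comp mk (measurableT_comp (@measurable_cons_rV R d) (measurable_pair1 a))).
  - by move=> x; exact: kC.
  - by move=> x nx; apply: hk0 => /cube_cons[].
  - move=> x; have [dx <-] := dh (cons_rV (a, x)).
    have e : (fun t : R => t^-1 *: (h (cons_rV (a, t *: delta_mx ord0 j + x)) - h (cons_rV (a, x)))) =
        (fun t : R => t^-1 *: (h (t *: delta_mx ord0 i + cons_rV (a, x)) - h (cons_rV (a, x)))).
      by apply/funext => t; rewrite ij [t *: _ + x]addrC [t *: _ + cons_rV _]addrC cons_rV_shift.
    split; first by rewrite /derivable e.
    by rewrite /derive e.
  - move=> x; have := ck (cons_rV (a, x)); rewrite ij.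
    by under [X in continuous X]eq_fun do rewrite cons_rV_shift.
rewrite E2 (_ : (fun x => _) = cst 0)//; first by rewrite Rintegral_cst// mul0r.
apply/funext => x /=.
apply: (@integral_derivative_R (fun a => h (cons_rV (a, x))) (fun a => k (cons_rV (a, x))) r).
- by move=> a ra; have [] := hk0 (cons_rV (a, x)); rewrite ?cube_cons// leNgt ra => -[].
- by move=> a ra; have [] := hk0 (cons_rV (a, x)); rewrite ?cube_cons// leNgt ra => -[].
- have := ck (cons_rV (0, x)); rewrite i0.
  by under [X in continuous X -> _]eq_fun do rewrite cons_rV_shift0 add0r.
- move=> a; have [dx <-] := dh (cons_rV (a, x)).
  have e : (fun t : R => t^-1 *: (h (cons_rV (t *: 1 + a, x)) - h (cons_rV (a, x)))) =
      (fun t : R => t^-1 *: (h (t *: delta_mx ord0 i + cons_rV (a, x)) - h (cons_rV (a, x)))).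
    by apply/funext => t; rewrite i0 -[t *: 1]/(t * 1) mulr1 [t + a]addrC [t *: _ + cons_rV _]addrC cons_rV_shift0.
  split; first by rewrite /derivable e.
  by rewrite /derive e.
Qed.

End vanishing_integrals.

Lemma Rintegral_marginal d1 d2 (Y : measurableType d1) (X : measurableType d2) (R : realType)
    (m : {finite_measure set Y -> \bar R}) (n : {measure set X -> \bar R}) (q : Y -> X)
    (D : set X) (f : X -> R) (C : R) :
  measurable_fun setT q -> measurable D ->
  (forall A, measurable A -> m (q @^-1` A) = n (A `&` D)) ->
  measurable_fun setT f -> (forall x, `|f x| <= C) ->
  (\int[m]_y f (q y) = \int[n]_(x in D) f x)%R.
Proof.
move=> mq mD mn mf fC.
pose p : {measure set X -> \bar R} :=
  measure_function_pushforward__canonical__measure_function_Measure m mq.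
have pE A : p A = m (q @^-1` A) by [].
have pT : (p setT < +oo)%E by rewrite pE preimage_setT -ge0_fin_numE// fin_num_measure.
have mf' : measurable_fun setT (EFin \o f) by exact/measurable_EFinP.
have ifq : m.-integrable setT (EFin \o f \o q).
  apply: (@bounded_integrable _ _ _ _ _ (f \o q) C) => //.
    exact: measurableT_comp.
  by move=> y _; exact: fC.
have ip : p.-integrable setT (EFin \o f).
  exact: (bounded_integrable_fin measurableT pT mf (fun x _ => fC x)).
rewrite /Rintegral; congr fine.
transitivity (\int[p]_x (f x)%:E)%E.
  by rewrite -[RHS]/(\int[pushforward m q]_(x in setT) (EFin \o f) x)%E
    (integral_pushforward mq mf' ifq).
rewrite (@negligible_integral _ _ _ p setT (~` D))//; [|exact: measurableC|].
  rewrite setTD setCK; apply: eq_measure_integral => A mA AD.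
  by rewrite pE mn// setIidl.
by rewrite pE mn ?setICl ?measure0//; exact: measurableC.
Qed.

Lemma cvg_sum_fin (R : realType) (I : finType) (V : topologicalType) (x : V)
    (f : I -> V -> R) (a : I -> R) : (forall i, f i y @[y --> x] --> a i) ->
  \sum_i f i y @[y --> x] --> \sum_i a i.
Proof.
move=> fa; rewrite (_ : (fun y => _) = \sum_i f i); last by apply/funext => y; rewrite fct_sumE.
elim/big_ind2 : _ => [|g b h c gb hc|i _]; [exact: cvg_cst|exact: cvgD|exact: fa].
Qed.

(** * The balance of a test function as an integral over curves *)

Section production_balance.
Context {R : realType} (d : nat) (T : R).
Hypothesis T0 : 0 < T.
Notation mu := (@lebesgue_measure R).
Notation Z := (R * 'rV[R]_d)%type.
Context (u : R -> 'rV[R]_d -> R) (omega : {finite_measure set (Gamma T d) -> \bar R}).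
Hypothesis marginal : forall t, `[0, T[ t -> forall A : set ('rV[R]_d * R),
    measurable A ->
    pushforward omega (fun g : curve T d => g t) A =
      (lebesgue_rV d \x mu)%E (A `&` subgraph (u t)).
Hypothesis mu_ : forall t, `[0, T[%classic t -> measurable_fun setT (u t).
Context (M : R).
Hypotheses (M0 : 0 <= M)
  (u_M : forall t, `[0, T[%classic t -> {ae lebesgue_rV d, forall x, 0 <= u t x <= M}).
Context (eta : R -> R) (dF Q : R -> 'rV[R]_d) (phi : Z -> R).
Hypothesis seta : smooth eta.
Hypothesis cdF : forall i, continuous (fun v => dF v ord0 i).
Hypothesis dQ : forall (v : R) i, is_derive v (1 : R) (fun v => Q v ord0 i) (derive1 eta v * dF v ord0 i).
Hypothesis cphi : cutoff T phi.

(* Almost all curves have levels in [0, M]; truncating makes the density below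
   bounded on all curves. *)
Definition truncate (v : R) : R := Num.min (Num.max v 0) M.

Definition truncated_density (s : R) (p : 'rV[R]_d * R) : R :=
  derive1 eta (truncate p.2) * transport_derivative dF phi s p.1 (truncate p.2).

Lemma truncateE v : 0 <= v <= M -> truncate v = v.
Proof. by move=> /andP[v0 vM]; rewrite /truncate (max_idPl v0) (min_idPl vM). Qed.

Let truncate_norm v : `|truncate v| <= M.
Proof.
rewrite ger0_norm /truncate; first by rewrite ge_min lexx orbT.
by rewrite le_min le_max lexx orbT.
Qed.

Let ela := cutoff_elementary cphi.

Let eW : forall x : R, is_derive x (1 : R) eta (derive1 eta x).
Proof. exact: smooth_is_derive. Qed.

Let cW : continuous (derive1 eta).
Proof. exact/smooth_continuous/smooth_derive1. Qed.

Let mpart_t : measurable_fun setT (partial_t phi).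
Proof. by apply: measurable_elementary; exact: elementary_derive. Qed.

Let mpart_x i : measurable_fun setT (partial_x i phi).
Proof. by apply: measurable_elementary; exact: elementary_derive. Qed.

Let mdensity : measurable_fun setT
  (fun q : R * ('rV[R]_d * R) => truncated_density q.1 q.2).
Proof.
have mt : measurable_fun setT (fun q : R * ('rV[R]_d * R) => truncate q.2.2).
  apply: measurable_minr => //; apply: measurable_maxr => //.
  exact: (measurableT_comp measurable_snd measurable_snd).
have mz : measurable_fun setT (fun q : R * ('rV[R]_d * R) => (q.1, q.2.1) : Z).
  apply: measurable_fun_pair; first exact: measurable_fst.
  exact: (measurableT_comp measurable_fst measurable_snd).
apply: measurable_funM.
  exact: (measurableT_comp (continuous_measurable_fun cW) mt).
apply: measurable_funD; first exact: (measurableT_comp mpart_t mz).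
apply: measurable_sum => i; apply: measurable_funM; last exact: (measurableT_comp (mpart_x i) mz).
exact: (measurableT_comp (continuous_measurable_fun (@cdF i)) mt).
Qed.

Let density_bounded : exists C : R, forall s p, `|truncated_density s p| <= C.
Proof.
have [K K0 phiK] := derivatives_bounded cphi.
have [CW CW0 WC] := continuous_bounded_ball M cW.
have /choice[C CP] : forall i, exists C : R, 0 <= C /\ forall v : R, `|v| <= M -> `|dF v ord0 i| <= C.
  by move=> i; have [C C0 CP] := continuous_bounded_ball M (@cdF i); exists C; split => //; exact: ltW.
exists (CW * (K + \sum_i C i * K)) => s p.
rewrite normrM ler_pM//; first exact: WC.
have [h1 h2] := phiK (s, p.1).
rewrite (le_trans (ler_normD _ _))// lerD// (le_trans (ler_norm_sum _ _ _))//.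
apply: ler_sum => i _; rewrite normrM; apply: ler_pM (normr_ge0 _) (normr_ge0 _) _ (h2 i).
by have [_] := CP i; apply.
Qed.

Let supp : exists e r, [/\ 0 < e, 0 < r & forall p : Z, ~ box T e r p ->
  [/\ phi p = 0, partial_t phi p = 0 & forall i, partial_x i phi p = 0]].
Proof.
have [_ _ [e [r [e0 r0 phi0]]]] := cphi.
exists e, r; split => // p np; split; first exact: phi0.
  exact: derive_out phi0 _ np.
by move=> i; exact: derive_out phi0 _ np.
Qed.

Let density0 e r s p : (forall p : Z, ~ box T e r p ->
    [/\ phi p = 0, partial_t phi p = 0 & forall i, partial_x i phi p = 0]) ->
  ~ box T e r (s, p.1) -> truncated_density s p = 0.
Proof.
move=> h /h[_ t0 x0]; rewrite /truncated_density /transport_derivative t0 add0r.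
by rewrite big1 ?mulr0// => i _; rewrite x0 mulr0.
Qed.

Let mT : measurable (`]0, T[ : set (measurableTypeR R)).
Proof. exact: measurable_itv. Qed.

Let Too : (mu `]0%R, T[%classic < +oo)%E.
Proof. by rewrite lebesgue_measure_itv/=; case: ifP => _; rewrite ?ltry// -EFinB ltry. Qed.

Let itv_fin (a b : R) : (mu `[a, b]%classic < +oo)%E.
Proof. by rewrite lebesgue_measure_itv/=; case: ifP => _; rewrite ?ltry// -EFinB ltry. Qed.

Let box_itv e r s (x : 'rV[R]_d) : 0 < e -> box T e r (s, x) -> `]0, T[%classic s.
Proof.
move=> e0 [/= /andP[s1 s2] _]; rewrite in_itv/=.
by rewrite (lt_le_trans e0 s1) (le_lt_trans s2)// ltrBlDr ltrDl.
Qed.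

(** The time derivative of the spatial integral of [phi]. With the factor [eta 0] it is all that
    remains of the lower endpoint v = 0 of the primitives, and it disappears on integrating in
    time. *)
Let mass_derivative (s : R) : R := (\int[lebesgue_rV d]_x partial_t phi (s, x))%R.

Let bk_t : exists r C, bounded_kernel mu (lebesgue_rV d)
  (fun p : measurableTypeR R * 'rV[R]_d => partial_t phi p) `]0, T[ (@cube R d r) C.
Proof.
have [e [r [e0 r0 h]]] := supp; have [K K0 phiK] := derivatives_bounded cphi.
exists r, K; split => //.
- exact: measurable_cube.
- exact: lebesgue_cube_fin.
- by move=> p; have [] := phiK p.
- move=> [s x] n; have [|_ -> //] := h (s, x); apply: contra_not n => b.
  by split; [exact: box_itv b|case: b].
Qed.

Lemma mass_derivative_integral : (\int[mu]_s mass_derivative s = 0)%R.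
Proof.
have [r [C bk]] := bk_t; rewrite /mass_derivative (bk_Fubini bk).
rewrite (_ : (fun x => _) = cst 0)//; first by rewrite Rintegral_cst// mul0r.
apply/funext => x /=; have [e [r' [e0 r0 h]]] := supp.
have out s : T < `|s| -> ~ box T e r' (s, x).
  move=> Ts [/= /andP[s1 s2] _]; move: Ts; rewrite ltNge => /negP; apply.
  rewrite ger0_norm; first by rewrite (le_trans s2)// gerBl ltW.
  exact: le_trans (ltW e0) s1.
apply: (@integral_derivative_R _ (fun s => phi (s, x)) (fun s => partial_t phi (s, x)) T).
- by move=> s /out /h[].
- by move=> s /out /h[].
- move=> s; apply: (continuous_comp (f := fun s : R => (s, x) : Z)).
    exact: (cvg_pair cvg_id (cvg_cst x)).
  by apply/differentiable_continuous/elementary_diff; exact: elementary_derive.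
- move=> s; have := curve_derivative ela (is_derive_cst x s (1 : R)).
  by rewrite big1 ?addr0// => i _; rewrite mxE mul0r.
Qed.

Lemma partial_x_integral s i : (\int[lebesgue_rV d]_x partial_x i phi (s, x) = 0)%R.
Proof.
have [e [r [e0 r0 h]]] := supp; have [K K0 phiK] := derivatives_bounded cphi.
apply: (@integral_partial_derivative _ d i (fun x => phi (s, x)) (fun x => partial_x i phi (s, x)) r K).
- exact: (measurableT_comp (mpart_x i) (measurable_pair1 s)).
- by move=> x; have [_] := phiK (s, x); apply.
- by move=> x nx; have [|-> _ ->] := h (s, x); [move=> [] //|].
- move=> x; have := diff_derivable (elementary_diff ela (s, x)).
  move=> /(_ (0, delta_mx ord0 i)) dx.
  have e' : (fun t : R => t^-1 *: (phi (s, t *: delta_mx ord0 i + x) - phi (s, x))) =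
      (fun t : R => t^-1 *: (phi (t *: ((0, delta_mx ord0 i) : Z) + (s, x)) - phi (s, x))).
    apply/funext => t; congr (_ *: (phi _ - _)).
    apply/eqP; rewrite xpair_eqE/= eqxx andbT; apply/eqP.
    by rewrite -[LHS]add0r; congr (_ + _); rewrite -[RHS]/(t * 0) mulr0.
  split; first by rewrite /derivable e'.
  by rewrite /derive e'.
- move=> x t; apply: (continuous_comp (f := fun t : R => (s, x + t *: delta_mx ord0 i) : Z)).
    have h1 : x + r *: delta_mx ord0 i @[r --> t] --> x + t *: delta_mx ord0 i.
      by apply: cvgD; [exact: cvg_cst|exact: scalel_continuous].
    exact: (cvg_pair (cvg_cst s) h1).
  by apply/differentiable_continuous/elementary_diff; exact: elementary_derive.
Qed.

(** Cutting the subgraph at height M removes a null set by [u_M], and confines v to [0, M] so that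
    the kernels have supports of finite measure. *)
Let slice (s : R) : set ('rV[R]_d * R) := subgraph (u s) `&` [set p | p.2 <= M].

Let mslice s : `]0, T[%classic s -> measurable (slice s).
Proof.
move=> sT; apply: measurableI.
  by apply: measurable_subgraph; apply: mu_; exact: subset_itv_oo_co sT.
rewrite (_ : [set _ | _] = snd @^-1` `]-oo, M]); last first.
  by apply/seteqP; split => p /=; rewrite in_itv.
by rewrite -[X in measurable X]setTI; apply: measurable_snd => //; exact: measurable_itv.
Qed.

Let marginal_slice s A : `]0, T[%classic s -> measurable A ->
  omega ((fun g : curve T d => (position g s, level g s)) @^-1` A) =
  (lebesgue_rV d \x mu)%E (A `&` slice s).
Proof.
move=> sT mA; have sT' : `[0, T[%classic s by exact: subset_itv_oo_co sT.
have mS := mslice sT.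
have mB : measurable (A `&` subgraph (u s)).
  by apply: measurableI => //; apply: measurable_subgraph; exact: mu_.
transitivity (omega ((fun g : curve T d => g s) @^-1` A)).
  by congr (omega _); apply/seteqP; split => g /=; rewrite /position /level; case: (g s).
apply: etrans (marginal sT' mA) _.
have DI := measureDI (lebesgue_rV d \x mu)%E mB mS.
apply: etrans DI _; rewrite (_ : (A `&` subgraph (u s)) `&` slice s = A `&` slice s); last first.
  by apply/seteqP; split => p; rewrite /slice; [move=> [[? ?] [? ?]]|move=> [? [? ?]]].
rewrite [X in (X + _)%E](_ : _ = 0%E) ?add0e//.
apply: subset_measure0 (subgraph_null (mu_ sT') (u_M sT')).
- exact: measurableD.
- apply: measurableI; last by apply: measurable_subgraph; exact: mu_.
  rewrite (_ : [set _ | _] = snd @^-1` `]M, +oo[); last first.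
    by apply/seteqP; split => p /=; rewrite in_itv/= andbT.
  by rewrite -[X in measurable X]setTI; apply: measurable_snd => //; exact: measurable_itv.
- move=> p [[Ap sp] ns]; split => //=; rewrite ltNge; apply/negP => pM.
  by apply: ns; split.
Qed.

(** At v = u(s, x) this is the integrand of [balance]; its derivative in v is the untruncated
    density. *)
Let primitive s x v : R := eta v * partial_t phi (s, x) +
  \sum_(i < d) Q v ord0 i * partial_x i phi (s, x).

Let primitive_derive s x (v : R) : is_derive v (1 : R) (primitive s x)
  (derive1 eta v * transport_derivative dF phi s x v).
Proof.
have d1 : is_derive v (1 : R) (eta * cst (partial_t phi (s, x)))
    (derive1 eta v * partial_t phi (s, x)).
  apply: (is_derive_eq (is_deriveM (eW v) (is_derive_cst _ v (1 : R)))).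
  by rewrite scaler0 add0r -[LHS]/(partial_t phi (s, x) * derive1 eta v) mulrC.
have d2 : is_derive v (1 : R) (\sum_(i < d) ((fun v => Q v ord0 i) * cst (partial_x i phi (s, x))))
    (\sum_(i < d) (derive1 eta v * dF v ord0 i * partial_x i phi (s, x))).
  apply: is_derive_sum => i.
  apply: (is_derive_eq (is_deriveM (dQ v i) (is_derive_cst _ v (1 : R)))).
  by rewrite scaler0 add0r -[LHS]/(partial_x i phi (s, x) * _) mulrC.
have := is_deriveD d1 d2.
rewrite (_ : _ + _ = primitive s x); last by apply/funext => z; rewrite /primitive fct_sumE.
rewrite (_ : _ + _ = derive1 eta v * transport_derivative dF phi s x v)//.
rewrite /transport_derivative mulrDr mulr_sumr; congr (_ + _).
by apply: eq_bigr => i _; rewrite mulrA.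
Qed.

Let slice_integral s x : 0 <= u s x <= M ->
  (\int[mu]_v (truncated_density s (x, v) * \1_(slice s) (x, v)) =
   primitive s x (u s x) - primitive s x 0)%R.
Proof.
move=> /andP[u0 uM].
have cg : continuous (fun v => derive1 eta v * transport_derivative dF phi s x v).
  move=> v; apply: cvgM; first exact: cW.
  apply: cvgD; first exact: cvg_cst.
  by apply: cvg_sum_fin => i; apply: cvgM; [exact: cdF|exact: cvg_cst].
transitivity (\int[mu]_(v in `[0%R, u s x]) (derive1 eta v * transport_derivative dF phi s x v))%R.
  rewrite [RHS]Rintegral_mkcond; apply: eq_Rintegral => v _; rewrite patchE indicE.
  have [|] := boolP (v \in `[0%R, u s x]%classic).
    move=> /set_mem/=; rewrite in_itv/= => /andP[v0 vu].
    rewrite mem_set ?mulr1; last first.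
      by split; [apply/andP|exact: le_trans vu uM].
    by rewrite /truncated_density truncateE//= v0 (le_trans vu).
  move=> /negP nv; rewrite memNset ?mulr0// => -[/= vs _].
  by apply: nv; apply: mem_set; rewrite /= in_itv.
move: u0; rewrite le_eqVlt => /predU1P[u0|u0].
  by rewrite -u0 subrr set_itv1 Rintegral_set1.
rewrite -(integral_derivative_C1 u0 cg (fun v _ => primitive_derive s x v)).
have int : mu.-integrable `[0, u s x] (EFin \o (fun v => derive1 eta v * transport_derivative dF phi s x v)).
  apply: continuous_compact_integrable; first exact: segment_compact.
  exact: continuous_subspaceT.
rewrite [in RHS]Rintegral_itv_bndo_bndc; last first.
  by apply: integrableS int => //; exact: subset_itv_oo_cc.
rewrite [in RHS]Rintegral_itv_obnd_cbnd//.
apply: integrableS int => //; exact: subset_itv_oc_cc.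
Qed.

Let mprimitive s : `]0, T[%classic s -> measurable_fun setT (fun x => primitive s x (u s x)).
Proof.
move=> sT; have mus : measurable_fun setT (u s) by apply: mu_; exact: subset_itv_oo_co sT.
have dcont (f df : R -> R) : (forall x : R, is_derive x (1 : R) f (df x)) -> measurable_fun setT f.
  move=> df'; apply: continuous_measurable_fun => x.
  by apply/differentiable_continuous/derivable1_diffP; have [] := df' x.
have mpt : measurable_fun setT (fun x => partial_t phi (s, x)).
  exact: (measurableT_comp mpart_t (measurable_pair1 s)).
have mpx i : measurable_fun setT (fun x => partial_x i phi (s, x)).
  exact: (measurableT_comp (mpart_x i) (measurable_pair1 s)).
apply: measurable_funD.
  by apply: measurable_funM mpt; exact: (measurableT_comp (dcont _ _ eW) mus).
apply: measurable_sum => i; apply: measurable_funM (mpx i).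
exact: (measurableT_comp (dcont _ _ (fun v => dQ v i)) mus).
Qed.

(** The marginal turns the integral over curves into one over the slice, where integrating v from 0
    to u(s, x) leaves a difference of primitives. At v = 0 the terms in [Q 0] are constants times
    spatial derivatives and integrate to 0; the term in [eta 0] stays. *)
Let density_marginal s : `]0, T[%classic s ->
  (\int[lebesgue_rV d]_x primitive s x (u s x) =
   \int[omega]_g truncated_density s (position g s, level g s) +
   eta 0 * mass_derivative s)%R.
Proof.
move=> sT; have sT' : `[0, T[%classic s by exact: subset_itv_oo_co sT.
have mS := mslice sT.
have [C dC] := density_bounded.
have [e [r [e0 r0 h]]] := supp; have [K K0 phiK] := derivatives_bounded cphi.
have md : measurable_fun setT (truncated_density s).
  exact: (measurableT_comp mdensity (measurable_pair1 s)).
have mq : measurable_fun setT (fun g : Gamma T d => (position g s, level g s)).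
  apply: measurable_fun_pair; last exact: measurable_level_at.
  by apply: measurable_fun_rVP => i; exact: measurable_position_at.
rewrite (@Rintegral_marginal _ _ _ _ _ omega (lebesgue_rV d \x mu)%E _ _ _ _ mq mS
  (fun A => marginal_slice sT (A := A)) md (dC s)).
pose k (p : 'rV[R]_d * measurableTypeR R) : R := truncated_density s p * \1_(slice s) p.
have bk : bounded_kernel (lebesgue_rV d) mu k (@cube R d r) `[0, M] C.
  split.
  - exact: measurable_cube.
  - exact: measurable_itv.
  - exact: lebesgue_cube_fin.
  - exact: itv_fin.
  - by apply: measurable_funM => //; exact: measurable_indic.
  - move=> p; rewrite normrM (le_trans _ (dC s p))// ler_piMr// indicE.
    by case: (_ \in _); rewrite ?normr1 ?normr0.
  - move=> [x v] n; rewrite /k indicE.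
    have [/set_mem[/= /andP[v0 vu] vM]|_] := boolP (_ \in _); last by rewrite mulr0.
    rewrite (density0 h) ?mul0r// => -[_ b]; apply: n; split => //=.
    by rewrite in_itv/= v0.
have -> : (\int[(lebesgue_rV d \x mu)%E]_(p in slice s) truncated_density s p =
    \int[lebesgue_rV d]_x \int[mu]_v k (x, v))%R.
  rewrite -(bk_product bk) [LHS]Rintegral_mkcond; apply: eq_Rintegral => p _.
  by rewrite patchE /k indicE; case: (_ \in _); rewrite ?mulr1 ?mulr0.
have bc (f : 'rV[R]_d -> R) : measurable_fun setT f -> (forall x, `|f x| <= K) ->
    (forall x, ~ box T e r (s, x) -> f x = 0) -> (lebesgue_rV d).-integrable setT (EFin \o f).
  move=> mf fK f0.
  have mc := @measurable_cube R d r.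
  have : (lebesgue_rV d).-integrable (@cube R d r) (EFin \o f).
    apply: (bounded_integrable_fin mc (lebesgue_cube_fin d r) _ (fun x _ => fK x)).
    exact: measurable_funTS.
  rewrite (integrable_mkcond _ mc) (_ : _ \_ _ = EFin \o f)//.
  apply/funext => x; rewrite patchE; case: ifPn => // /negP nx.
  by rewrite /= f0// => -[_ b]; apply: nx; exact: mem_set.
have ipt : (lebesgue_rV d).-integrable setT (EFin \o (fun x => partial_t phi (s, x))).
  apply: bc; first exact: (measurableT_comp mpart_t (measurable_pair1 s)).
    by move=> x; have [] := phiK (s, x).
  by move=> x /h[].
have ipx i : (lebesgue_rV d).-integrable setT (EFin \o (fun x => partial_x i phi (s, x))).
  apply: bc; first exact: (measurableT_comp (mpart_x i) (measurable_pair1 s)).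
    by move=> x; have [_] := phiK (s, x); apply.
  by move=> x /h[].
have iQ i : (lebesgue_rV d).-integrable setT
    (fun x => (Q 0 ord0 i * partial_x i phi (s, x))%:E) by exact: integrableZ_EFin.
have isum : (lebesgue_rV d).-integrable setT
    (EFin \o (fun x => \sum_(i < d) Q 0 ord0 i * partial_x i phi (s, x))).
  rewrite (_ : _ \o _ = fun x => (\sum_(i < d) (Q 0 ord0 i * partial_x i phi (s, x))%:E)%E).
    by apply: integrable_sum => // i _; exact: iQ.
  by apply/funext => x; rewrite /= sumEFin.
have i0 : (lebesgue_rV d).-integrable setT (EFin \o (fun x => primitive s x 0)).
  by apply: integrableD_EFin => //; exact: integrableZ_EFin.
have E0 : (\int[lebesgue_rV d]_x primitive s x 0 = eta 0 * mass_derivative s)%R.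
  rewrite RintegralD//; last exact: integrableZ_EFin.
  rewrite RintegralZl//.
  rewrite [X in _ + X](_ : _ = 0) ?addr0//.
  rewrite /Rintegral; under eq_integral do rewrite -sumEFin.
  rewrite (@integral_sum _ _ _ (lebesgue_rV d) setT measurableT 'I_d
    (fun i x => (Q 0 ord0 i * partial_x i phi (s, x))%:E))//.
  rewrite big1// => i _.
  rewrite -[LHS]fineK; last exact: integrable_fin_num.
  by rewrite -/(Rintegral _ _ _) RintegralZl// partial_x_integral mulr0.
rewrite -E0 -RintegralD//; last exact: bk_integrableF bk.
rewrite /Rintegral; congr fine; apply: ae_eq_integral => //.
- by apply/measurable_EFinP; exact: mprimitive.
- apply/measurable_EFinP; apply: measurable_funD.
    by have /measurable_int/measurable_EFinP := bk_integrableF bk.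
  by have /measurable_int/measurable_EFinP := i0.
- apply: filterS (u_M sT') => x ux _; congr EFin.
  have -> : fine (\int[mu]_v (k (x, v))%:E) = primitive s x (u s x) - primitive s x 0 := slice_integral ux.
  by rewrite subrK.
Qed.

Let kernel (p : Gamma T d * measurableTypeR R) : R :=
  truncated_density p.2 (position p.1 p.2, level p.1 p.2).

Let kernel0 g s : ~ `]0, T[%classic s -> kernel (g, s) = 0.
Proof.
have [e [r [e0 r0 h]]] := supp.
by move=> n; apply: (density0 h); apply: contra_not n; exact: box_itv.
Qed.

Let bk_kernel : exists C, bounded_kernel omega mu kernel setT `]0, T[ C.
Proof.
have [C dC] := density_bounded; exists C.
have mz : measurable_fun setT (fun p : Gamma T d * measurableTypeR R =>
    (p.2 : R, (position p.1 p.2, level p.1 p.2))).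
  apply: measurable_fun_pair; first exact: measurable_snd.
  apply: measurable_fun_pair; first exact: measurable_position_evaluation.
  exact: measurable_level_evaluation.
split => //.
- by rewrite -ge0_fin_numE// fin_num_measure.
- exact: (measurableT_comp mdensity mz).
- by move=> p; exact: dC.
- by move=> [g s] n; apply: kernel0; apply: contra_not n.
Qed.

Let kernelE g : (\int[mu]_(s in `]0%R, T[) truncated_density s (position g s, level g s) =
  \int[mu]_s kernel (g, s))%R.
Proof.
rewrite Rintegral_mkcond; apply: eq_Rintegral => s _.
by rewrite patchE; case: ifPn => // /negP n; rewrite kernel0// => sT; apply: n; exact: mem_set.
Qed.

Lemma truncated_density_integrable : omega.-integrable setT (fun g : Gamma T d =>
  (\int[mu]_(s in `]0%R, T[) truncated_density s (position g s, level g s))%R%:E).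
Proof.
have [C bk] := bk_kernel; under eq_fun do rewrite kernelE.
exact: bk_integrableF bk.
Qed.

(** Once the curve and time integrals are exchanged, [density_marginal] applies at every time, and
    the leftover mass term integrates to 0. *)
Lemma truncated_density_balance :
  (\int[omega]_g \int[mu]_(s in `]0%R, T[) truncated_density s (position g s, level g s) =
   - balance T u eta Q phi)%R.
Proof.
have [C bk] := bk_kernel; have [e [r [e0 r0 h]]] := supp.
under eq_Rintegral do rewrite kernelE.
rewrite (bk_Fubini bk) /balance opprK.
have iG := bk_integrableG bk.
have [r' [C' bkt]] := bk_t.
have imd : mu.-integrable setT (EFin \o mass_derivative) := bk_integrableF bkt.
have iS (f : R -> R) : mu.-integrable setT (EFin \o f) -> mu.-integrable `]0, T[ (EFin \o f).
  by apply: integrableS => //; exact: measurable_itv.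
transitivity (\int[mu]_(s in `]0%R, T[) (\int[omega]_g kernel (g, s) + eta 0 * mass_derivative s))%R; last first.
  by apply: eq_Rintegral => s /set_mem sT; rewrite -density_marginal.
rewrite RintegralD//; [|exact: iS|by apply: (iS (fun s => eta 0 * mass_derivative s)); exact: integrableZ_EFin].
rewrite RintegralZl//; last exact: iS.
have -> : (\int[mu]_(s in `]0%R, T[) mass_derivative s = 0)%R.
  rewrite -[RHS]mass_derivative_integral Rintegral_mkcond; apply: eq_Rintegral => s _.
  rewrite patchE; case: ifPn => // /negP n; rewrite /mass_derivative.
  rewrite (_ : (fun x => _) = cst 0) ?Rintegral_cst ?mul0r//.
  apply/funext => x /=; have [|_ -> //] := h (s, x).
  by move=> b; apply: n; apply: mem_set; exact: box_itv b.
rewrite mulr0 addr0 [RHS]Rintegral_mkcond; apply: eq_Rintegral => s _.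
rewrite patchE; case: ifPn => // /negP n.
rewrite (_ : (fun g => _) = cst 0) ?Rintegral_cst ?mul0r//.
by apply/funext => g /=; rewrite kernel0// => sT; apply: n; exact: mem_set.
Qed.

End production_balance.

(** * Identification of the two measures *)

Section cutoff_sets.
Context {R : realType} (d : nat) (T : R).
Hypothesis T0 : 0 < T.
Notation Z := (R * 'rV[R]_d)%type.

Definition cutoff_limit (A : set Z) := exists phi : nat -> Z -> R,
  (forall n, cutoff T (phi n)) /\ forall p, phi n p @[n --> \oo] --> (\1_A p : R).

Lemma cutoffM (a b : Z -> R) : cutoff T a -> unit_elementary b -> cutoff T (a * b).
Proof.
move=> [ela a01 [e [r [e0 r0 a0]]]] ub.
have [elab ab01] := unit_elementaryM (conj ela a01) ub; split => //.
by exists e, r; split => // p /a0 ap; rewrite -[(a * b) p]/(a p * b p) ap mul0r.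
Qed.

Lemma cutoff_limitI A B : cutoff_limit A -> cutoff_limit B -> cutoff_limit (A `&` B).
Proof.
move=> [a [ca aA]] [b [cb bB]]; exists (fun n => a n * b n); split=> [n|p].
  by apply: cutoffM => //; have [? ? _] := cb n; split.
rewrite indicI [X in _ --> X](_ : _ = (\1_A p : R) * \1_B p)//.
exact: cvgM.
Qed.

Lemma step_affine_cvg (a b : R) : 0 < a ->
  step (n.+1%:R * a + b) @[n --> \oo] --> (1 : R).
Proof.
move=> a0; apply: cvg_near_cst; near=> n; apply: step_eq1.
rewrite -lerBlDr -ler_pdivrMr//.
apply: le_trans (_ : n%:R <= _); last by rewrite ler_nat.
by near: n; exact: nbhs_infty_ger.
Unshelve. all: by end_near. Qed.

Lemma cvg_prod_fin (I : finType) (f : nat -> I -> R) (a : I -> R) :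
  (forall i, f n i @[n --> \oo] --> a i) ->
  \prod_i f n i @[n --> \oo] --> \prod_i a i.
Proof.
move=> fa; rewrite (_ : (fun n => \prod_i f n i) = \prod_i (fun n => f n i)); last first.
  by apply/funext => n; rewrite fct_prodE.
elim/big_ind2 : _ => [|g b h c gb hc|i _]; [exact: cvg_cst|exact: cvgM|exact: fa].
Qed.

Lemma unit_elementary_prod (I : finType) (f : I -> Z -> R) :
  (forall i, unit_elementary (f i)) -> unit_elementary (\prod_i f i).
Proof.
move=> uf; elim/big_ind : _ => [|a b|i _]; last exact: uf.
- exact: unit_elementary1.
- exact: unit_elementaryM.
Qed.

Lemma cutoff_limit_strip : cutoff_limit (strip T d).
Proof.
have [lt clt ltE] := @time_linear_exists R d.
have [lx clx] : exists2 l : 'I_d -> {linear Z -> R}, forall i, continuous (l i) &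
    forall i p, l i p = p.2 ord0 i.
  have H i : exists l : {linear Z -> R}, continuous l /\ forall p, l p = p.2 ord0 i.
    by have [l cl lE] := @coordinate_linear_exists R d i; exists l.
  by have [l lE] := choice H; exists l => i; have [] := lE i.
move=> lxE.
(* [a n] vanishes for t <= 1/(n+1), [b n] for t >= T - 1/(n+1), and [c n i] when the i-th coordinate
   is at least n+1 in absolute value. At each point of the strip all of them are eventually 1. *)
pose a n : Z -> R := fun p => step (n.+1%:R * lt p + -1).
pose b n : Z -> R := fun p => step (- n.+1%:R * lt p + (n.+1%:R * T - 1)).
pose c n i : Z -> R := (fun p => step (1 * lx i p + n.+1%:R)) * (fun p => step (-1 * lx i p + n.+1%:R)).
have ua n : unit_elementary (a n) by exact: unit_elementary_step.
have ub n : unit_elementary (b n) by exact: unit_elementary_step.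
have uc n i : unit_elementary (c n i).
  by apply: unit_elementaryM; exact: unit_elementary_step.
exists (fun n => a n * b n * \prod_i c n i); split => [n|p].
  have [el bd] : unit_elementary (a n * b n * \prod_i c n i).
    by apply: unit_elementaryM; [exact: unit_elementaryM|exact: unit_elementary_prod].
  split => //; exists n.+1%:R^-1, n.+1%:R; split; [by rewrite invr_gt0|by []|].
  move=> p; apply: contra_notP => /eqP.
  rewrite -[(_ * _) p]/(a n p * b n p * (\prod_i c n i) p) fct_prodE.
  rewrite mulf_eq0 (mulf_eq0 (a n p)) !negb_or => /andP[/andP[a0 b0] /prodf_neq0 c0].
  have pos y : step y != 0 -> 0 < y.
    by rewrite ltNge; apply: contra => /step_eq0 ->.
  have n0 : (0 : R) < n.+1%:R by [].
  move: (pos _ _ a0) (pos _ _ b0); rewrite ltE => h1 h2; split; last first.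
    move=> i; have := c0 i isT; rewrite -[c n i p]/(step _ * step _).
    by rewrite mulf_eq0 negb_or => /andP[/pos + /pos]; rewrite lxE ler_norml => *; apply/andP; split; lra.
  apply/andP; split.
    by rewrite -[X in X <= _]mul1r ler_pdivrMr//; lra.
  by rewrite -(ler_pM2l n0) mulrBr divff ?gt_eqF//; lra.
have [pT|pT] := pselect (strip T d p); last first.
  rewrite indicE memNset//; apply: cvg_near_cst; apply: nearW => n.
  rewrite -[LHS]/(a n p * b n p * (\prod_i c n i) p).
  have n0 : (0 : R) < n.+1%:R by [].
  have [p0|p0] := leP p.1 0.
    rewrite /a ltE step_eq0 ?mul0r//.
    by have := mulr_ge0_le0 (ltW n0) p0; lra.
  rewrite /b ltE (@step_eq0 _ (- _ * _ + _)) ?mulr0 ?mul0r//.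
  have Tp : T <= p.1.
    by rewrite leNgt; apply/negP => pT'; apply: pT; split => //=; rewrite in_itv/= p0.
  by have : n.+1%:R * T <= n.+1%:R * p.1 by [rewrite ler_pM2l]; lra.
rewrite indicE mem_set//.
have [+ _] := pT; rewrite /= in_itv/= => /andP[p0 p1].
rewrite (_ : (fun n => _) = fun n => step (n.+1%:R * p.1 + -1) * step (n.+1%:R * (T - p.1) + -1) *
   \prod_i (step (n.+1%:R * 1 + p.2 ord0 i) * step (n.+1%:R * 1 + - p.2 ord0 i))); last first.
  apply/funext => n; rewrite -[LHS]/(a n p * b n p * (\prod_i c n i) p) fct_prodE.
  rewrite /a /b ltE; congr (_ * _ * _); first by congr step; ring.
  apply: eq_bigr => i _; rewrite -[LHS]/(step _ * step _) lxE.
  by congr (step _ * step _); ring.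
rewrite [X in _ --> X](_ : _ = 1 * 1 * \prod_(i < d) (1 * 1)); last first.
  by rewrite big1 ?mulr1// => i _; rewrite mulr1.
apply: cvgM; first by apply: cvgM; apply: step_affine_cvg; lra.
by apply: cvg_prod_fin => i; apply: cvgM; exact: step_affine_cvg.
Qed.

Lemma cutoff_limit_ray (l : {linear Z -> R}) (c : R) : continuous l ->
  cutoff_limit ([set p | c < l p] `&` strip T d).
Proof.
move=> cl; have [chi [cchi chiT]] := cutoff_limit_strip.
exists (fun n => chi n * (fun p => step (n.+1%:R * (l p - c)))); split=> [n|p].
  apply: cutoffM => //.
  rewrite (_ : (fun p => _) = fun p => step (n.+1%:R * l p + - (n.+1%:R * c))).
    exact: unit_elementary_step.
  by apply/funext => p; rewrite mulrBr.
rewrite indicI [X in _ --> X](_ : _ = (\1_(strip T d) p : R) * \1_[set p | c < l p] p); last first.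
  by rewrite -[LHS]/(_ * _) mulrC.
apply: cvgM; first exact: chiT.
have := step_dilation_cvg (t := c) (x := l p).
rewrite indicE mem_setE in_itv/= andbT => h; rewrite indicE.
rewrite (_ : (p \in _) = (c < l p))//; apply/idP/idP => [/set_mem|h']//.
exact/mem_set.
Qed.

(** Cutoffs vanish near the times 0 and T, so only the trace of a set on the strip can be a limit of
    them. Requiring no more than that keeps the system large enough to generate all Borel sets. *)
Definition cutoff_system : set (set Z) :=
  [set A | measurable A /\ cutoff_limit (A `&` strip T d)].

Lemma measurable_strip : measurable (strip T d).
Proof. by apply: measurableX => //; exact: measurable_itv. Qed.

Lemma cutoff_system_setI : setI_closed cutoff_system.
Proof.
move=> A B [mA cA] [mB cB]; split; first exact: measurableI.
rewrite (_ : _ `&` strip T d = (A `&` strip T d) `&` (B `&` strip T d)).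
  exact: cutoff_limitI.
by rewrite setIACA setIid.
Qed.

Lemma measurable_cutoff_generated : @measurable _ Z = <<s cutoff_system >>.
Proof.
apply/seteqP; split; last first.
  by apply: smallest_sub; [exact: sigma_algebra_measurable|move=> A []].
pose Y := g_sigma_algebraType cutoff_system.
have ray (f : Z -> R) (l : {linear Z -> R}) : measurable_fun setT f -> continuous l ->
    (forall p, l p = f p) -> measurable_fun setT (f : Y -> R).
  move=> mf cl lf; apply: measurable_fun_open_rays => c.
  have E : f @^-1` `]c, +oo[ = [set p | c < l p].
    by apply/seteqP; split => p /=; rewrite in_itv/= andbT lf.
  apply: sub_sigma_algebra; split; last by rewrite E; exact: cutoff_limit_ray.
  by rewrite -[X in measurable X]setTI; apply: mf => //; exact: measurable_itv.
have mid : measurable_fun setT (fun p : Y => p : Z).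
  rewrite (_ : (fun p => _) = fun p : Y => (p.1, p.2)); last by apply/funext => -[].
  apply: measurable_fun_pair.
    have [l cl lE] := @time_linear_exists R d.
    by apply: (ray fst l) => //; exact: measurable_fst.
  apply: measurable_fun_rVP => i; have [l cl lE] := @coordinate_linear_exists R d i.
  apply: (ray (fun p => p.2 ord0 i) l) => //.
  exact: (measurableT_comp (measurable_rV_coord i) measurable_snd).
by move=> B mB; have := mid measurableT B mB; rewrite setTI.
Qed.

End cutoff_sets.

Section production_measure.
Context {R : realType} (d : nat) (T : R).
Hypothesis T0 : 0 < T.
Notation mu := (@lebesgue_measure R).
Notation Z := (R * 'rV[R]_d)%type.
Notation X := (R * 'rV[R]_d * R)%type.
Context (u : R -> 'rV[R]_d -> R) (omega : {finite_measure set (Gamma T d) -> \bar R}).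
Hypothesis marginal : forall t, `[0, T[ t -> forall A : set ('rV[R]_d * R),
    measurable A ->
    pushforward omega (fun g : curve T d => g t) A =
      (lebesgue_rV d \x mu)%E (A `&` subgraph (u t)).
Hypothesis mu_ : forall t, `[0, T[%classic t -> measurable_fun setT (u t).
Hypothesis variation_oo : (\int[omega]_g Tot_Var T (fun t => ((g : curve T d) t).2) < +oo)%E.
Context (M : R).
Hypotheses (M0 : 0 <= M)
  (u_M : forall t, `[0, T[%classic t -> {ae lebesgue_rV d, forall x, 0 <= u t x <= M}).
Context (eta : R -> R).
Hypotheses (seta : smooth eta) (eta0 : forall v : R, 0 <= derive1n 2 eta v).

Lemma production_dominated_cvg (f_ : nat -> Gamma T d -> \bar R) (B : set X) (C : R) :
  measurable B ->
  (forall n, measurable_fun setT (f_ n)) ->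
  {ae omega, forall g, forall n, (`|f_ n g| <= C%:E * curve_variation g)%E} ->
  {ae omega, forall g, f_ n g @[n --> \oo] --> curve_production eta g B} ->
  (\int[omega]_g f_ n g)%E @[n --> \oo] --> (\int[omega]_g curve_production eta g B)%E.
Proof.
move=> mB mf fC fcvg.
have iV : omega.-integrable setT (fun g => C%:E * curve_variation g)%E.
  by apply: integrableZl => //; exact: integrable_curve_variation.
have mCP := measurable_curve_production T0 seta eta0 mB.
have f1 : {ae omega, forall g, setT g -> f_ n g @[n --> \oo] --> curve_production eta g B}.
  by apply: filterS fcvg => g h _.
have f2 : {ae omega, forall g n, setT g -> (`|f_ n g| <= C%:E * curve_variation g)%E}.
  by apply: filterS fC => g h n _.
by have [_ _] := dominated_convergence measurableT mf mCP f1 iV f2.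
Qed.

Context (dF Q : R -> 'rV[R]_d).
Hypothesis cdF : forall i, continuous (fun v => dF v ord0 i).
Hypothesis dQ : forall (v : R) i, is_derive v (1 : R) (fun v => Q v ord0 i) (derive1 eta v * dF v ord0 i).
Hypothesis characteristics : {ae omega, forall g : Gamma T d, characteristic dF g}.

Let mfst (A : set Z) : measurable A -> measurable ((fst : X -> Z) @^-1` A).
Proof. by move=> mA; rewrite -[X in measurable X]setTI; exact: measurable_fst. Qed.

(** For a fixed n and almost every curve, the limit of the Riemann sums is computed in two ways: by
    [curve_balance] it is the integrand of the balance, and by [curve_production_charge] it tends,
    as n grows, to the production of the cylinder over A. The bound on the Riemann sums survives the
    first limit and gives the domination for the second. *)
Lemma production_cutoff (phi : nat -> Z -> R) (A : set Z) : measurable A ->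
  (forall n, cutoff T (phi n)) -> (forall p, phi n p @[n --> \oo] --> (\1_A p : R)) ->
  ((balance T u eta Q (phi n))%:E @[n --> \oo] -->
   \int[omega]_g curve_production eta g (fst @^-1` A))%E.
Proof.
move=> mA cphi phiA; have [C C0 CV] := production_bound d T0 M seta eta0.
pose I n (g : Gamma T d) : R :=
  (\int[mu]_(s in `]0%R, T[) truncated_density M eta dF (phi n) s (position g s, level g s))%R.
have balanceE n : (balance T u eta Q (phi n))%:E = (\int[omega]_g (- I n g)%:E)%E.
  have iI : omega.-integrable setT (fun g => (I n g)%:E).
    exact: truncated_density_integrable.
  have := truncated_density_balance T0 marginal mu_ M0 u_M seta cdF dQ (cphi n).
  move=> h; rewrite -[balance _ _ _ _ _]opprK -h EFinN fineK//; last exact: integrable_fin_num.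
  by have := integralN (integrable_add_def measurableT iI) => /esym.
under eq_fun do rewrite balanceE.
have lim_I : {ae omega, forall g : Gamma T d, forall n,
    riemann_sum T (level g) (derive1n 2 eta) (fun t => phi n (t, position g t)) m @[m --> \oo] --> - I n g}.
  have lM := level_ae_le T0 marginal mu_ M0 u_M.
  near=> g => n.
  have cg : characteristic dF g by near: g.
  have gM : forall t, level g t <= M by near: g.
  have := curve_balance T0 seta eta0 cdF cg (cphi n).
  rewrite (_ : Rintegral _ _ _ = I n g)//; apply: eq_Rintegral => s _.
  by rewrite /truncated_density /= truncateE// gM andbT curve_ge0.
apply: (production_dominated_cvg (C := C)).
- exact: mfst.
- move=> n; apply/measurable_EFinP; apply: measurable_funN; apply/measurable_EFinP.
  by have /integrableP[] := truncated_density_integrable T0 omega M0 seta cdF (cphi n).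
- have lM := level_ae_le T0 marginal mu_ M0 u_M.
  near=> g => n.
  have gM : forall t, level g t <= M by near: g.
  have lg : forall n, riemann_sum T (level g) (derive1n 2 eta) (fun t => phi n (t, position g t)) m @[m --> \oo] --> - I n g by near: g.
  have [_ h] := CV g gM.
  have {}h := fun m => h _ m (cutoff01 (cphi n)).
  apply: (cvge_to_le (f := fun m => `|(riemann_sum T (level g) (derive1n 2 eta) (fun t => phi n (t, position g t)) m)%:E|%E) (a := \oo)); last exact: nearW.
  by apply: cvg_abse; apply: cvg_EFin; [exact: nearW|exact: lg].
near=> g.
have lg : forall n, riemann_sum T (level g) (derive1n 2 eta) (fun t => phi n (t, position g t)) m @[m --> \oo] --> - I n g by near: g.
have [nu0 [CE _ _ h]] := curve_production_charge T0 seta eta0 g.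
rewrite CE; last exact: mfst.
rewrite -[nu0 _]fineK ?fin_num_measure//; last exact: mfst.
apply: cvg_EFin; first exact: nearW.
have {h} := h (fst @^-1` A) phi (fun=> cst 1) (mfst mA) _ _ _.
have -> : cst 1 * derive1n 2 eta = derive1n 2 eta by apply/funext => v; exact: mul1r.
have E n : limn (riemann_sum T (level g) (derive1n 2 eta) (fun t => phi n (t, position g t))) = - I n g.
  by apply/cvg_lim => //; exact: lg.
under eq_fun do rewrite E.
apply.
- by move=> n; have [? ? _] := cphi n; split.
- by move=> n; exact: unit_continuous1.
- by move=> p; under eq_fun do rewrite mulr1; exact: phiA.
Unshelve. all: by end_near. Qed.

Context (nu : {charge set Z -> \bar R}).
Hypothesis entropy : entropy_production T u eta Q nu.

(** Both sides are limits of the same balances: one by [production_cutoff], the other by bounded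
    convergence against the two Jordan parts of [nu]. *)
Lemma production_cutoff_limit A : measurable A -> cutoff_limit T A -> A `<=` strip T d ->
  (\int[omega]_g curve_production eta g (fst @^-1` A) = nu A)%E.
Proof.
move=> mA [phi [cphi phiA]] AT.
have h1 := production_cutoff mA cphi phiA.
have [P [N [H [mH _ _ nuE intE]]]] := charge_integralP nu.
have mphi n : measurable_fun setT (phi n).
  exact: measurable_elementary (cutoff_elementary (cphi n)).
have cvgI (m : {finite_measure set Z -> \bar R}) :
    (\int[m]_(p in strip T d) phi n p @[n --> \oo] --> fine (m A))%R.
  have -> : fine (m A) = (\int[m]_(p in strip T d) (\1_A p))%R.
    by rewrite /Rintegral integral_indic ?setIidl//; exact: measurable_strip.
  apply: (@bounded_cvg_Rintegral _ _ _ _ _ _ _ 1) => //.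
  - exact: measurable_strip.
  - by move=> n; exact: measurable_funTS.
  - by move=> n p _; have /andP[p0 p1] := cutoff01 (cphi n) p; rewrite ger0_norm.
have finI (m : {finite_measure set Z -> \bar R}) n :
    (\int[m]_(p in strip T d) (phi n p)%:E = (\int[m]_(p in strip T d) phi n p)%R%:E)%E.
  rewrite fineK//; apply: integrable_fin_num; first exact: measurable_strip.
  apply: (@bounded_integrable_fin _ _ _ _ _ _ 1).
  - exact: measurable_strip.
  - by rewrite -ge0_fin_numE// fin_num_measure//; exact: measurable_strip.
  - exact: measurable_funTS.
  - by move=> p _; have /andP[p0 p1] := cutoff01 (cphi n) p; rewrite ger0_norm.
have h2 : (balance T u eta Q (phi n))%:E @[n --> \oo] --> nu A.
  rewrite nuE// -[P A]fineK ?fin_num_measure// -[N A]fineK ?fin_num_measure// -EFinB.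
  apply: cvg_EFin; first exact: nearW.
  rewrite (_ : fine \o _ = fun n => (\int[P]_(p in strip T d) phi n p - \int[N]_(p in strip T d) phi n p)%R).
    exact: cvgB.
  apply/funext => n /=; apply: EFin_inj.
  by rewrite -(entropy (cutoff_test (cphi n))) intE !finI.
exact: (cvg_unique _ h1 h2).
Qed.

(** Taking traces on the strip lets A range over all Borel sets, so that complements and disjoint
    unions stay within the class and the Dynkin induction runs. *)
Lemma production_strip A : measurable A ->
  (\int[omega]_g curve_production eta g (fst @^-1` (A `&` strip T d)) = nu (A `&` strip T d))%E.
Proof.
have mS := @measurable_strip R d T.
have iCP (B : set Z) : measurable B ->
    omega.-integrable setT (fun g : Gamma T d => curve_production eta g (fst @^-1` B)).
  by move=> mB; apply: (integrable_curve_production T0 marginal mu_ variation_oo M0 u_M seta eta0); exact: mfst.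
have PT : (\int[omega]_g curve_production eta g (fst @^-1` strip T d) = nu (strip T d))%E.
  apply: production_cutoff_limit => //; exact: cutoff_limit_strip.
rewrite [X in X A -> _](@measurable_cutoff_generated R d T)//.
apply: (@dynkin_induction _ Z (@cutoff_system R d T) (fun A =>
  (\int[omega]_g curve_production eta g (fst @^-1` (A `&` strip T d)) = nu (A `&` strip T d))%E)).
- exact: measurable_cutoff_generated.
- exact: cutoff_system_setI.
- by rewrite setTI.
- by move=> B [mB cB]; apply: production_cutoff_limit => //; exact: measurableI.
- move=> B mB IB.
  have mBS : measurable (B `&` strip T d) by exact: measurableI.
  rewrite (_ : ~` B `&` strip T d = strip T d `\` (B `&` strip T d)); last first.
    by rewrite setDIr setDv setU0 setDE setIC.
  have SBS : strip T d `&` (B `&` strip T d) = B `&` strip T d by rewrite setICA setIid.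
  rewrite chargeD// SBS -IB -PT -integralB//; [|exact: iCP|exact: iCP].
  apply: eq_integral => g _; have [nu0 [CE _ _ _]] := curve_production_charge T0 seta eta0 g.
  rewrite !CE; [|exact: mfst|exact: mfst|apply: mfst; exact: measurableD].
  rewrite (_ : fst @^-1` (_ `\` _) = fst @^-1` strip T d `\` fst @^-1` (B `&` strip T d))// chargeD; [|exact: mfst|exact: mfst].
  by rewrite -preimage_setI SBS.
- move=> F mF tF IF.
  pose G n := F n `&` strip T d.
  have mG n : measurable (G n) by exact: measurableI.
  have tG : trivIset setT G by exact: trivIset_setIr.
  have tG' : trivIset setT (fun n => (fst : X -> Z) @^-1` G n).
    by apply/trivIsetP => i j _ _ ij; rewrite -preimage_setI (trivIsetP.1 tG)// preimage_set0.
  have mUG : measurable (\bigcup_n G n) by exact: bigcup_measurable.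
  rewrite setI_bigcupl -/G.
  have [C C0 CV] := production_bound d T0 M seta eta0.
  have h2 : (\sum_(0 <= i < n) nu (G i))%E @[n --> \oo] --> nu (\bigcup_n G n).
    exact: charge_semi_sigma_additive.
  apply: cvg_unique h2; first by [].
  rewrite (_ : (fun n => _) = fun n => (\int[omega]_g \sum_(0 <= i < n) curve_production eta g (fst @^-1` G i))%E); last first.
    apply/funext => n; rewrite integral_sum//; last by move=> i; exact: iCP.
    by apply: eq_bigr => i _; rewrite IF.
  apply: (production_dominated_cvg (C := C)).
  + exact: mfst.
  + by move=> n; apply: emeasurable_sum => i _; exact: (measurable_int omega (iCP _ (mG i))).
  (* A finite partial sum is the production of a finite disjoint union, so the same majorant
     applies. *)
  + have := level_ae_le T0 marginal mu_ M0 u_M; apply: filterS => g gM n.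
    have [h _] := CV g gM; have [nu0 [CE _ _ _]] := curve_production_charge T0 seta eta0 g.
    rewrite big_mkord; under eq_bigr do rewrite (CE _ (mfst (mG _))).
    have mU : measurable (\big[setU/set0]_(i < n) (fst : X -> Z) @^-1` G i).
      by apply: bigsetU_measurable => i _; exact: mfst.
    have := h _ mU; rewrite CE// (@charge_semi_additive _ _ _ nu0 (fun i => fst @^-1` G i))//.
    by move=> i; exact: (mfst (mG i)).
  + apply: nearW => g; have [nu0 [CE _ _ _]] := curve_production_charge T0 seta eta0 g.
    rewrite CE; last exact: mfst.
    under eq_fun do under eq_bigr do rewrite (CE _ (mfst (mG _))).
    rewrite preimage_bigcup; apply: charge_semi_sigma_additive => //.
      by move=> i; exact: (mfst (mG i)).
    by rewrite -preimage_bigcup; exact: mfst.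
Qed.

End production_measure.

Theorem proposition5p12 (R : realType) (d : nat) (T : R)
    (F : R -> 'rV[R]_d) (u0 : 'rV[R]_d -> R) (u : R -> 'rV[R]_d -> R)
    (omega : {finite_measure set (Gamma T d) -> \bar R}) :
  (0 < d)%N -> 0 < T -> C2 F ->
  (lebesgue_rV d).-integrable setT (fun x => (u0 x)%:E) ->
  (\int[lebesgue_rV d]_x (`|u0 x|)%:E = 1)%E ->
  weak_solution_fep T F u0 u -> bounded_nonneg T u ->
  lagrangian_representation F u omega ->
  forall (eta : R -> R) (Q : R -> 'rV[R]_d)
    (mu : {charge set (R * 'rV[R]_d)%type -> \bar R}),
  smooth eta -> (forall v : R, 0 <= derive1n 2 eta v) ->
  entropy_flux F eta Q -> entropy_production T u eta Q mu ->
  (forall B : set (R * 'rV[R]_d * R), measurable B ->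
    omega.-integrable setT
      (fun g : Gamma T d => curve_production eta (g : curve T d) B)) /\
  (forall A : set (R * 'rV[R]_d), measurable A -> A `<=` strip T d ->
    pushforward
      (fun B => (\int[omega]_g curve_production eta (g : curve T d) B)%E)
      (fun p : R * 'rV[R]_d * R => p.1) A = mu A).
Proof.
move=> _ T0 [_ ddF _] _ _ [[iu _] _ _ _] [M0 uM] [marg char vari] eta Q nu seta eta0 flux ep.
have sub t : `[0, T[%classic t -> `[0, T]%classic t.
  by rewrite /= !in_itv/= => /andP[-> /ltW ->].
have mu_ t : `[0, T[%classic t -> measurable_fun setT (u t).
  by move=> /sub /iu /(measurable_int (lebesgue_rV d)) /measurable_EFinP.
(* The absolute value supplies the nonnegative bound that the truncation requires. *)
pose M := `|M0|.
have u_M t : `[0, T[%classic t -> {ae lebesgue_rV d, forall x, 0 <= u t x <= M}.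
  move=> /sub /uM; apply: filterS => x /andP[-> xM] /=.
  by rewrite (le_trans xM)// ler_norm.
have coordc i : continuous (fun v : 'rV[R]_d => v ord0 i) by move=> v; exact: coord_continuous.
have cdF i : continuous (fun v => derive1 F v ord0 i).
  move=> v; apply: (@continuous_comp _ _ _ (derive1 F) (fun v : 'rV[R]_d => v ord0 i)); last exact: coordc.
  exact/differentiable_continuous/derivable1_diffP/ddF.
have dQ (v : R) i : is_derive v (1 : R) (fun v => Q v ord0 i) (derive1 eta v * derive1 F v ord0 i).
  have [dQv Qv] := flux v.
  split; first exact: (derivable_mxP _ _ _).1 dQv ord0 i.
  by have := derive_mx dQv; rewrite Qv => /matrixP /(_ ord0 i); rewrite !mxE => <-.
have M_ge0 : 0 <= M by exact: normr_ge0.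
split=> [B mB|A mA AT].
  exact: (integrable_curve_production T0 marg mu_ vari M_ge0 u_M seta eta0).
have char' : {ae omega, forall g : Gamma T d, characteristic (derive1 F) g}.
  by [].
have := production_strip T0 marg mu_ vari M_ge0 u_M seta eta0 cdF dQ char' ep mA.
by rewrite setIidl.
Qed.
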